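(* Let the $X_{ij}$ be i.i.d. copies of $X_{11}$ for all $i\in\{1,\dots,n\}$ and $j\in\{1,\dots,p\}$. Let $X_{11}$ be in the domain of attraction of the normal distribution, with the distribution of $X_{11}$ non-degenerate and symmetric around $0$. Define $\omega_n=[\delta_{n,0}]^{-1/6}$. Then $$\tau_{n,\mathcal{A}^{re}}\to0\quad\text{as } n\to\infty,$$ provided $\log p=o(\omega_n^2)$. Moreover, there exists a positive constant $c\le1/8$ such that whenever $\log p\le\epsilon\,\omega_n^2$ with $0<\epsilon<c$, $$\limsup_{n\to\infty}\tau_{n,\mathcal{A}^{re}}<\epsilon^{5/3}.$$
   Context: Setting: $p=p_n$ is a sequence of positive integers that may grow with $n$; $X_i=(X_{i1},\dots,X_{ip})'$, $i=1,\dots,n$. The law of $X_{11}$ does not depend on $n$. Self-normalized sum: $T_n=(T_{n1},\dots,T_{np})'$ with $T_{nj}=\sum_{i=1}^n X_{ij}\big/\sqrt{\sum_{i=1}^n X_{ij}^2}$ (with $0/0:=0$). $Z$ is a standard Gaussian vector in $\mathbb{R}^p$ (mean $0$, identity covariance). $\mathcal{A}^{re}=\{\prod_{j=1}^p([a_j,b_j]\cap\mathbb{R}): -\infty\le a_j\le b_j\le\infty,\ j=1,\dots,p\}$ and $\tau_{n,\mathcal{A}^{re}}=\sup_{A\in\mathcal{A}^{re}}|\mathbf{P}(T_n\in A)-\mathbf{P}(Z\in A)|$. With $Y=X_{11}$, let $\kappa_{n,0}=\sup\{s>0: n s^{-2}\mathbf{E}[Y^2 I(|Y|\le s)]\ge1\}$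 (well defined for all large $n$) and $$\delta_{n,0}=n\mathbf{P}(|Y|>\kappa_{n,0})+n\kappa_{n,0}^{-1}\big|\mathbf{E}[Y I(|Y|\le\kappa_{n,0})]\big|+n\kappa_{n,0}^{-3}\mathbf{E}[|Y|^3I(|Y|\le\kappa_{n,0})].$$ *)

(* Defs.v *)
From HB Require Import structures.
From mathcomp Require Import all_boot all_order all_algebra finmap.
From mathcomp Require Import all_classical all_reals all_analysis.

Set Implicit Arguments.
Unset Strict Implicit.
Unset Printing Implicit Defensive.

Import Order.TTheory GRing.Theory Num.Theory.
Import numFieldNormedType.Exports.

Local Open Scope classical_set_scope.
Local Open Scope ring_scope.

Section random_variables.
Context {R : realType}.

Definition mutually_independent {d : measure_display} {T : measurableType d}
    {P : probability T R} {I : choiceType} (X : I -> {RV P >-> R}) : Prop :=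
  forall (J : {fset I}) (B : I -> set R), (forall i, measurable (B i)) ->
    P (\bigcap_(i in [set` J]) (X i @^-1` B i)) =
    (\prod_(i <- J) P (X i @^-1` B i))%E.

(* Laws are compared on measurable sets only: a measure is a function on all
   sets, with unspecified values outside the sigma-algebra. *)
Definition has_law {d : measure_display} {T : measurableType d}
    {P : probability T R} (X : {RV P >-> R}) (mu : set R -> \bar R) : Prop :=
  forall A : set R, measurable A -> distribution P X A = mu A.

Definition iid_with_law {d : measure_display} {T : measurableType d}
    {P : probability T R} {I : choiceType} (X : I -> {RV P >-> R})
    (mu : set R -> \bar R) : Prop :=
  mutually_independent X /\ forall i, has_law (X i) mu.

Definition standard_gaussian_vector {d : measure_display}
    {T : measurableType d} {P : probability T R} {p : nat}
    (Z : 'I_p -> {RV P >-> R}) : Prop :=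
  iid_with_law Z (normal_prob 0 1).

Definition nondegenerate_law {d : measure_display} {T : measurableType d}
    {P : probability T R} (Y : {RV P >-> R}) : Prop :=
  ~ exists a : R, distribution P Y [set a] = 1%E.

Definition symmetric_law {d : measure_display} {T : measurableType d}
    {P : probability T R} (Y : {RV P >-> R}) : Prop :=
  forall A : set R, measurable A ->
    distribution P Y [set x | A (- x)] = distribution P Y A.

(* Affinely normalised partial sums of i.i.d. copies of Y converge in
   distribution to N(0,1); as the limit is continuous, this is convergence of
   the distribution functions at every real x. *)
Definition in_normal_domain_of_attraction {d : measure_display}
    {T : measurableType d} {P : probability T R} (Y : {RV P >-> R}) : Prop :=
  exists (d' : measure_display) (T' : measurableType d')
    (P' : probability T' R) (xi : nat -> {RV P' >-> R}) (a b : nat -> R),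
  [/\ iid_with_law xi (distribution P Y),
      forall n, 0 < a n
    & forall x : R,
        P' [set w | (\sum_(i < n) xi i w - b n) / a n <= x] @[n --> \oo]
          --> normal_prob 0 1 [set y : R | y <= x]].

End random_variables.

Section truncated_quantities.
Context {R : realType} {d : measure_display} {T : measurableType d}
  {P : probability T R}.
Implicit Types (Y : {RV P >-> R}) (n : nat).

(* The set is empty, so that kappa0 Y n = 0, for at most finitely many n when
   Y is nondegenerate. *)
Definition kappa0 Y n : R :=
  sup [set s : R | 0 < s /\
    1 <= n%:R * s ^- 2 * fine 'E_P[fun w => Y w ^+ 2 * (`|Y w| <= s)%R%:R]].

Definition delta0 Y n : R :=
  let k := kappa0 Y n in
  n%:R * fine (P [set w | k < `|Y w|])
  + n%:R * k^-1 * `|fine 'E_P[fun w => Y w * (`|Y w| <= k)%R%:R]|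
  + n%:R * k ^- 3 * fine 'E_P[fun w => `|Y w| ^+ 3 * (`|Y w| <= k)%R%:R].

Definition omega0 Y n : R := delta0 Y n `^ (- (1 / 6)).

End truncated_quantities.

Section hyperrectangles.
Context {R : realType}.

(* Since x^-1 = 0 for x = 0 in a field, 0 / 0 = 0 here. *)
Definition self_normalized_sum {d : measure_display} {T : measurableType d}
    {P : probability T R} {n p : nat} (X : 'I_n -> 'I_p -> {RV P >-> R})
    (w : T) : 'rV[R]_p :=
  \row_(j < p) ((\sum_(i < n) X i j w) / Num.sqrt (\sum_(i < n) X i j w ^+ 2)).

Definition hyperrectangles (p : nat) : set (set 'rV[R]_p) :=
  [set A : set 'rV[R]_p | exists a b : 'I_p -> \bar R, (forall j, (a j <= b j)%E) /\
     A = [set x : 'rV[R]_p | forall j, (a j <= (x 0 j)%:E <= b j)%E]].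

Definition tau_re {d : measure_display} {T : measurableType d}
    {P : probability T R} {d' : measure_display} {T' : measurableType d'}
    {P' : probability T' R} {n p : nat} (X : 'I_n -> 'I_p -> {RV P >-> R})
    (Z : 'I_p -> {RV P' >-> R}) : R :=
  sup [set `|fine (P [set w | A (self_normalized_sum X w)])
             - fine (P' [set w | A (\row_(j < p) Z j w)])|
       | A in @hyperrectangles p].

End hyperrectangles.

(* Main.v *)
(* Both parts follow from: if log p <= omega^2 / 8 eventually, then tau -> 0.

   Write [gtail] for the standard normal tail, delta for [delta0 Y n], and put
   M = delta^(-1/48), so that omega^2 = M^16.  The heart of the matter is the
   moderate deviation bound, with an absolute constant C,
     |P(T_n1 >= x) - gtail x| <= (C / M) (gtail x + 1 / p)   for all x >= 0.
   By symmetry of the law one may first average over random signs: given the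
   absolute values, T_n1 is a Rademacher sum with weights w_i, sum w_i^2 = 1.
   Replacing the signs one at a time by Gaussian smoothing (the heat semigroup)
   costs a multiple of |w_i|^3, and measuring the error against the weight
   exp(x (y - x)) makes the bound relative to exp(-x^2 / 2).  The sum of the
   |w_i|^3 is small outside an event of small probability, by Chebyshev's
   inequality for the truncated squares and Markov's for the truncated cubes; on
   that event, and for x > M^8, Hoeffding's inequality suffices.

   The coordinates of T_n are independent, so P(T_n in A) and P(Z in A) are
   products over j whose factors have relative tail error C / M, and the products
   are then within O(M^(-1/2)) of each other.

   It remains that delta -> 0.  Membership in the domain of attraction of the
   normal law gives t^2 P(|Y| > t) = o(E[Y^2; |Y| <= t]) (Levy's condition): if
   this failed along a sequence of t, then for a suitable n the partial sum would
   exceed t, a large multiple of its normalising constant, with more probability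
   than the Gaussian limit permits. *)

Require Import Defs.
From HB Require Import structures.
From mathcomp Require Import all_boot all_order all_algebra finmap.
From mathcomp Require Import all_classical all_reals all_analysis.
From mathcomp Require Import measurable_realfun ring lra.

Set Implicit Arguments.
Unset Strict Implicit.
Unset Printing Implicit Defensive.

Import Order.TTheory GRing.Theory Num.Theory.
Import numFieldNormedType.Exports.

Local Open Scope classical_set_scope.
Local Open Scope ring_scope.

(** * Gaussian tails and Rademacher sums *)

(** The obstacle is the product over p coordinates: an absolute error per factor would be multiplied
    by p. An error relative to the tail, with an additive allowance 1/p, sums to a small multiple of
    the total exit mass plus 1, and a large exit mass makes both products negligible. Relative
    precision must survive the exceptional event where the cubes are large. It does because
    Hoeffding's inequality holds for every realization of the absolute values: that event costs its
    probability times exp(-x^2/2), not its probability alone. Sign changes leave the normalizer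
    fixed, so conditioning on absolute values makes the statistic linear in the signs. Passing from
    exp(-x^2/2) to the Gaussian tail loses a factor 1 + x, which the powers of M can pay for up to x
    = M^8 = omega. Beyond that point exp(-x^2/2) is far below 1/p, since log p <= M^16 / 8. *)

Section gaussian.
Context {R : realType}.
Implicit Types x y : R.

Definition gauss x : R := expR (- (x ^+ 2) / 2).

Lemma gauss_gt0 x : 0 < gauss x. Proof. exact: expR_gt0. Qed.

Lemma gaussN x : gauss (- x) = gauss x. Proof. by rewrite /gauss sqrrN. Qed.

Lemma is_derive_gauss x : is_derive x 1 gauss (- x * gauss x).
Proof.
rewrite /gauss.
have : is_derive x 1 (fun y : R => - y ^+ 2 / 2) (- x).
  apply: is_derive_eq; rewrite /GRing.scale/= !mulr1; lra.
move=> H; have := @is_derive1_comp R expR (fun y => - y ^+ 2 / 2) x _ _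
  (is_derive_expR _) H.
by rewrite mulrC.
Qed.

Lemma le0_derive_le (f df : R -> R) a b : a <= b ->
  (forall x, a <= x <= b -> is_derive x 1 f (df x)) ->
  (forall x, a <= x <= b -> df x <= 0) -> f b <= f a.
Proof.
move=> ab fdf df0.
have [||c] := @MVT_segment R f df a b ab.
- by move=> x; rewrite in_itv/= => /andP[ax xb]; apply: fdf; rewrite !ltW.
- apply: derivable_within_continuous => x; rewrite in_itv/= => xab.
  by have [] := fdf x xab.
- rewrite in_itv/= => cab fE; rewrite -subr_le0 fE.
  by rewrite mulr_le0_ge0 ?df0// subr_ge0.
Qed.

(** Equivalent to [F x <= F 0] for [F] below: the derivative of [F] is [gauss] times [H], and [H]
    starts at 0 with derivative [- z * (expR z - expR (- z))]. The sharp exponent 1/2 lets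
    Hoeffding's inequality produce exactly [gauss x]. *)
Lemma cosh_le_expR x : (expR x + expR (- x)) / 2 <= expR (x ^+ 2 / 2).
Proof.
wlog x0 : x / 0 <= x.
  move=> H; have [/H//|/ltW x0] := leP 0 x.
  by have := H (- x); rewrite opprK sqrrN oppr_ge0 addrC; apply.
have expN y : is_derive y 1 (fun z : R => expR (- z)) (- expR (- y)).
  have := @is_derive1_comp R expR -%R y _ _
    (is_derive_expR _) (is_deriveNid y 1).
  by rewrite mulrN1.
pose H y : R := (1 - y) * expR y - (1 + y) * expR (- y).
have H0 y : 0 <= y -> H y <= 0.
  move=> y0; have -> : 0 = H 0.
    by rewrite /H oppr0 expR0; ring.
  apply: (@le0_derive_le H (fun z => - z * (expR z - expR (- z)))) => //.
    move=> z _; rewrite /H; apply: is_derive_eq.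
    by rewrite /GRing.scale/=; ring.
  move=> z /andP[z0 _]; rewrite mulNr oppr_le0 mulr_ge0// subr_ge0 ler_expR; lra.
pose F y : R := gauss y * (expR y + expR (- y)).
have : F x <= F 0.
  apply: (@le0_derive_le F (fun z => gauss z * H z)) => //.
    move=> z _; rewrite /F; have := is_derive_gauss z => ?.
    apply: is_derive_eq.
    by rewrite /GRing.scale/= /H; ring.
  by move=> z /andP[z0 _]; rewrite mulr_ge0_le0 ?H0// expR_ge0.
rewrite /F /gauss oppr0 expR0 expr0n/= oppr0 mul0r expR0 mulNr (expRN (x ^+ 2 / 2)).
by rewrite mulrC ler_pdivrMr ?expR_gt0// mul1r; lra.
Qed.

Definition gauss_peak : R := normal_peak 1.

Lemma gauss_peak_gt0 : 0 < gauss_peak.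
Proof. by rewrite normal_peak_gt0// oner_neq0. Qed.

Lemma gauss_peak_le1 : gauss_peak <= 1.
Proof.
rewrite /gauss_peak /normal_peak invf_le1 ?sqrtr_gt0.
  by rewrite -[X in X <= _]sqrtr1 ler_wsqrtr// expr1n mul1r; have := pi_ge2 R; lra.
by have := pi_ge2 R; rewrite expr1n mul1r; lra.
Qed.

Lemma normal_pdf01E x : normal_pdf 0 1 x = gauss_peak * gauss x.
Proof.
rewrite normal_pdfE ?oner_neq0// /normal_fun subr0 expr1n.
by rewrite /gauss mulr2n.
Qed.

Definition Phi x : R := fine (normal_prob 0 1 `]-oo, x]).

Lemma is_derive_Phi x : is_derive x 1 Phi (gauss_peak * gauss x).
Proof.
have [] := @continuous_FTC1 R (normal_pdf 0 1) -oo%O x (x + 1) _ _ _ _.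
- by rewrite ltrDl.
- apply: integrableS (integrable_normal_pdf 0 1) => //.
- by rewrite ltNyr.
- apply: continuous_normal_pdf; exact: oner_neq0.
move=> dF F'; rewrite -normal_pdf01E -F' derive1E.
exact: derivableP.
Qed.

Definition mfun_of d1 d2 (T1 : measurableType d1) (T2 : measurableType d2)
    (f : T1 -> T2) (mf : measurable_fun setT f) : {mfun T1 >-> T2} :=
  HB.pack f (isMeasurableFun.Build _ _ _ _ f mf).

(** As the law of the identity, the normal distribution inherits the limits of a cdf at both
    infinities. *)
Let id_RV : {RV (@normal_prob R 0 1) >-> R} :=
  @mfun_of _ _ (measurableTypeR R) R idfun (@measurable_id _ _ setT).

Lemma Phi_cvgy : Phi x @[x --> +oo] --> (1 : R).
Proof.
have := cvg_cdfy1 id_RV.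
by move/fine_cvg.
Qed.

Lemma Phi_cvgNy : Phi x @[x --> -oo] --> (0 : R).
Proof.
have := cvg_cdfNy0 id_RV.
by move/fine_cvg.
Qed.

Lemma Phi_homo : {homo Phi : x y / x <= y}.
Proof.
move=> x y xy; apply: fine_le; rewrite ?fin_num_measure//.
by apply: le_measure; rewrite ?inE//; exact: subset_itvl.
Qed.

Lemma Phi_ge0 x : 0 <= Phi x. Proof. by rewrite fine_ge0. Qed.

Lemma Phi_le1 x : Phi x <= 1.
Proof. by rewrite -lee_fin fineK ?fin_num_measure// probability_le1. Qed.

(** Since [gauss] is even, [Phi y + Phi (- y)] has derivative 0; its constant value is read off at
    infinity. *)
Lemma PhiN x : Phi (- x) = 1 - Phi x.
Proof.
pose F y : R := Phi y + Phi (- y).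
have dF y : is_derive y 1 F 0.
  have h1 := is_derive_Phi y.
  have h2 := @is_derive1_comp R Phi -%R y _ _ (is_derive_Phi _) (is_deriveNid y 1).
  by rewrite /F; apply: is_derive_eq; rewrite gaussN; ring.
have Fx y : F y = F x by exact: is_derive_0_is_cst.
have : F y @[y --> +oo] --> (1 + 0 : R).
  apply: cvgD; first exact: Phi_cvgy.
  by have := Phi_cvgNy; rewrite cvgNy_compNP.
under eq_fun do rewrite Fx.
move=> /(cvg_lim (@norm_hausdorff _ _)); rewrite lim_cst// /F; lra.
Qed.

Definition gtail x : R := Phi (- x).

Lemma gtail_ge0 x : 0 <= gtail x. Proof. exact: Phi_ge0. Qed.

Lemma gtail_le1 x : gtail x <= 1. Proof. exact: Phi_le1. Qed.

Lemma gtailE x : gtail x = 1 - Phi x. Proof. exact: PhiN. Qed.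

Lemma gtail_nhomo x y : x <= y -> gtail y <= gtail x.
Proof. by move=> xy; apply: Phi_homo; rewrite lerN2. Qed.

(** For [1 <= x] the function [Phi + gauss] decreases on [[x, +oo[], its derivative being
    [(gauss_peak - z) * gauss z], and it stays above [Phi], which tends to 1. For [x < 1] the
    right-hand side is at least 1, because [gauss 1 >= 1 / 2]. *)
Lemma gtail_le_gauss x : 0 <= x -> gtail x <= 2 * gauss x.
Proof.
move=> x0; have [x1|x1] := lerP 1 x.
  suff : 1 <= Phi x + gauss x by rewrite gtailE; have := gauss_gt0 x; lra.
  pose F y : R := Phi y + gauss y.
  have FF y : x <= y -> F y <= F x.
    move=> xy; apply: (@le0_derive_le _ (fun z => gauss_peak * gauss z - z * gauss z)) => //.
      move=> z _; have h1 := is_derive_Phi z; have h2 := is_derive_gauss z.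
      by rewrite /F; apply: is_derive_eq; ring.
    move=> z /andP[xz _]; rewrite -mulrBl mulr_le0_ge0 ?(ltW (gauss_gt0 _))//.
    have := gauss_peak_le1; lra.
  rewrite -(cvg_lim (@norm_hausdorff _ R^o) Phi_cvgy).
  apply: limr_le; first by apply/cvg_ex; exists 1; exact: Phi_cvgy.
  apply: filterS (nbhs_pinfty_ge (num_real x)) => y xy.
  by apply: le_trans (FF y xy); rewrite lerDl ltW// gauss_gt0.
apply: (@le_trans _ _ 1); first exact: gtail_le1.
have : gauss 1 <= gauss x.
  by rewrite ler_expR ler_wpM2r// lerN2 lerXn2r ?nnegrE ?ler01// ltW.
have : 1 + - 1 ^+ 2 / 2 <= gauss 1 := expR_ge1Dx _.
rewrite expr1n; lra.
Qed.

(** Only the mass of the interval of length [1 / (1 + x)] to the right of [x] is kept: there the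
    squared argument exceeds [x ^+ 2] by at most 3. *)
Lemma gtail_ge_gauss x : 0 <= x ->
  gauss_peak * expR (- (3 / 2)) * gauss x / (1 + x) <= gtail x.
Proof.
move=> x0; pose t := (1 + x)^-1.
have t0 : 0 < t by rewrite invr_gt0; lra.
have t1 : t <= 1 by rewrite invf_le1//; lra.
have tx : t * x <= 1 by rewrite mulrC ler_pdivrMr; lra.
have [|||c + cE] := @MVT_segment R Phi (fun y => gauss_peak * gauss y) x (x + t).
- by lra.
- by move=> y _; exact: is_derive_Phi.
- apply: derivable_within_continuous => y _; by have [] := is_derive_Phi y.
rewrite in_itv/= => /andP[xc cxt].
have ? : 0 <= x + t by lra.
have {}cE : gauss_peak * gauss c * t <= gtail x.
  by move: cE; rewrite gtailE (addrAC x) subrr add0r => <-; have := Phi_le1 (x + t); lra.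
apply: le_trans cE; rewrite ler_pM2r// -mulrA ler_pM2l ?gauss_peak_gt0//.
rewrite /gauss -expRD ler_expR.
have : c ^+ 2 <= (x + t) ^+ 2 by rewrite lerXn2r ?nnegrE//; lra.
have : t ^+ 2 <= 1 by rewrite expr_le1// ltW.
by rewrite sqrrD; nra.
Qed.

(* Distribution function of N(a, v); the variance is the time variable of the
   heat equation. *)
Definition heat (a v y : R) : R := Phi ((y - a) / Num.sqrt v).

Definition heat1 (a v y : R) : R :=
  gauss_peak * gauss ((y - a) / Num.sqrt v) / Num.sqrt v.

Definition heat2 (a v y : R) : R := - ((y - a) / v) * heat1 a v y.

Definition heat3 (a v y : R) : R := ((y - a) ^+ 2 / v ^+ 2 - v^-1) * heat1 a v y.

Lemma is_derive_heat1 a v y : 0 < v -> is_derive y 1 (heat1 a v) (heat2 a v y).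
Proof.
move=> v0; have sv0 : Num.sqrt v != 0 by rewrite sqrtr_eq0 -ltNge.
have dA : is_derive y 1 (fun z : R => (z - a) / Num.sqrt v) (Num.sqrt v)^-1.
  by apply: is_derive_eq; rewrite /GRing.scale/=; ring.
have h2 := @is_derive1_comp R gauss _ y _ _ (is_derive_gauss _) dA.
rewrite /heat1; apply: is_derive_eq; rewrite /GRing.scale/= /heat2 /heat1.
move: sv0 (esym (sqr_sqrtr (ltW v0))); move: (Num.sqrt v) => s s0 ->.
by field.
Qed.

Lemma is_derive_heat2 a v y : 0 < v -> is_derive y 1 (heat2 a v) (heat3 a v y).
Proof.
move=> v0; have h1 := is_derive_heat1 a y v0.
rewrite /heat2; apply: is_derive_eq; rewrite /GRing.scale/= /heat3 /heat2.
by field; rewrite gt_eqF.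
Qed.

(** Along the curve the point moves by [e * r], with [e] a sign, while the variance drops by
    [r ^+ 2]. By the heat equation the derivative of [heat] in [v] is half of [heat2], so the second
    motion contributes [- r * heat2]. *)
Lemma is_derive_heat_curve a v y (e r : R) : e ^+ 2 = 1 -> r ^+ 2 < v ->
  is_derive r 1 (fun r => heat a (v - r ^+ 2) (y + e * r))
   (e * heat1 a (v - r ^+ 2) (y + e * r) - r * heat2 a (v - r ^+ 2) (y + e * r)).
Proof.
move=> e1 rv; have v0 : 0 < v - r ^+ 2 by rewrite subr_gt0.
have sv0 : Num.sqrt (v - r ^+ 2) != 0 by rewrite sqrtr_eq0 -ltNge.
have dv : is_derive r 1 (fun z : R => v - z ^+ 2) (- (2 * r)).
  by apply: is_derive_eq; rewrite /GRing.scale/=; ring.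
have ds := @is_derive1_comp R Num.sqrt _ r _ _ (is_derive1_sqrt v0) dv.
have dA : is_derive r 1 (fun z : R => (y + e * z - a) / Num.sqrt (v - z ^+ 2))
   (e / Num.sqrt (v - r ^+ 2) + r * ((y + e * r - a) / (v - r ^+ 2)) / Num.sqrt (v - r ^+ 2)).
  apply: is_derive_eq; rewrite /GRing.scale/=.
  move: sv0 (esym (sqr_sqrtr (ltW v0))); move: (Num.sqrt (v - r ^+ 2)) => s s0 ->.
  by field.
have := @is_derive1_comp R Phi _ r _ _ (is_derive_Phi _) dA.
rewrite /heat; move/is_derive_eq; apply; rewrite /heat2 /heat1.
by field; rewrite sv0 gt_eqF.
Qed.

Lemma MVT_closed (f df : R -> R) a b : a <= b ->
  (forall x, a <= x <= b -> is_derive x 1 f (df x)) ->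
  exists2 c, a <= c <= b & f b - f a = df c * (b - a).
Proof.
move=> ab fdf; have [||c] := @MVT_segment R f df a b ab.
- by move=> x; rewrite in_itv/= => /andP[ax xb]; apply: fdf; rewrite !ltW.
- apply: derivable_within_continuous => x; rewrite in_itv/= => xab.
  by have [] := fdf x xab.
- by rewrite in_itv/= => cab fE; exists c.
Qed.

Lemma le_norm_derive (f df : R -> R) (K a b : R) : a <= b ->
  (forall x, a <= x <= b -> is_derive x 1 f (df x)) ->
  (forall x, a <= x <= b -> `|df x| <= K) -> `|f b - f a| <= K * (b - a).
Proof.
move=> ab fdf dfK; have [c cab ->] := MVT_closed ab fdf.
by rewrite normrM (ger0_norm (_ : 0 <= b - a)) ?ler_wpM2r ?dfK// subr_ge0.
Qed.

Lemma expRN_le (t : R) : 0 <= t -> expR (- t) * (1 + t) <= 1.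
Proof.
move=> t0; rewrite expRN mulrC ler_pdivrMr ?expR_gt0// mul1r.
exact: expR_ge1Dx.
Qed.

(* Completing the square in the exponent trades the Gaussian factor of the
   third derivative for the weight [expR (x * (y - a))]. *)
Lemma heat3_le (h x a v y : R) : 0 < h -> 0 <= x -> x * h <= 1 -> h ^+ 2 <= v ->
  `|heat3 a v y| <= 8 / h ^+ 3 * expR (x * (y - a) + x ^+ 2 * v / 2).
Proof.
move=> h0 x0 xh hv; have v0 : 0 < v by rewrite (lt_le_trans _ hv)// exprn_gt0.
rewrite /heat3 /heat1; have vE := esym (sqr_sqrtr (ltW v0)).
have hs : h <= Num.sqrt v by rewrite -(ger0_norm (ltW h0)) -sqrtr_sqr ler_wsqrtr.
move: (Num.sqrt v) hs vE => s hs vE.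
have s0 : 0 < s := lt_le_trans h0 hs.
pose z := (y - a) / s; rewrite -/z; pose b := x * s.
have gE : gauss z = expR (- ((z + b) ^+ 2 / 2)) * expR (x * (y - a) + x ^+ 2 * v / 2).
  rewrite /gauss -expRD; congr expR; rewrite vE /b.
  have -> : y - a = z * s by rewrite /z divfK// gt_eqF.
  by field.
rewrite gE; set E := expR (x * _ + _).
have -> : ((y - a) ^+ 2 / v ^+ 2 - v^-1) *
    (gauss_peak * (expR (- ((z + b) ^+ 2 / 2)) * E) / s) =
    gauss_peak * E * (((z ^+ 2 - 1) * expR (- ((z + b) ^+ 2 / 2))) / s ^+ 3).
  rewrite vE /z; field; exact: lt0r_neq0.
have E0 : 0 < E := expR_gt0 _.
have pE : `|gauss_peak * E| <= E.
  rewrite ger0_norm ?mulr_ge0// ?(ltW gauss_peak_gt0) ?(ltW E0)//.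
  by rewrite ler_piMl ?gauss_peak_le1// ltW.
rewrite normrM mulrC; apply: ler_pM => //.
set t := (z + b) ^+ 2 / 2; have t0 : 0 <= t by rewrite divr_ge0// sqr_ge0.
(* A bound linear in [t] suffices, since [expR (- t) * (1 + t) <= 1]; the factor [1 + b ^+ 2] is
   paid for later by [x * h <= 1] and [h <= s]. *)
have zt : `|z ^+ 2 - 1| <= 4 * (1 + b ^+ 2) * (1 + t).
  have bt : 0 <= b ^+ 2 * t by rewrite mulr_ge0 ?sqr_ge0.
  have -> : 4 * (1 + b ^+ 2) * (1 + t)
      = 4 + z ^+ 2 + (z + 2 * b) ^+ 2 + 2 * b ^+ 2 + 4 * (b ^+ 2 * t).
    by rewrite /t; field.
  have := sqr_ge0 b; have := sqr_ge0 (z + 2 * b); have := sqr_ge0 z.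
  by move=> *; rewrite ler_norml; apply/andP; split; lra.
have b0 : 0 <= 1 + b ^+ 2 by rewrite addr_ge0// sqr_ge0.
have : `|(z ^+ 2 - 1) * expR (- t)| <= 4 * (1 + b ^+ 2).
  rewrite normrM (ger0_norm (expR_ge0 _)).
  apply: (@le_trans _ _ (4 * (1 + b ^+ 2) * (1 + t) * expR (- t))).
    by rewrite ler_wpM2r ?expR_ge0.
  rewrite -mulrA; apply: ler_piMr; first by rewrite mulr_ge0.
  by rewrite mulrC expRN_le.
move=> H; rewrite normrM (ger0_norm (_ : 0 <= s ^- 3)) ?invr_ge0 ?exprn_ge0 ?(ltW s0)//.
apply: (@le_trans _ _ (4 * (1 + b ^+ 2) / s ^+ 3)).
  by rewrite ler_wpM2r// invr_ge0 exprn_ge0// ltW.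
have -> : 4 * (1 + b ^+ 2) / s ^+ 3 = 4 * (s ^- 3 + x ^+ 2 / s).
  rewrite /b; field; exact: lt0r_neq0.
have h3 : s ^- 3 <= h ^- 3.
  by rewrite lef_pV2 ?posrE ?exprn_gt0// lerXn2r// nnegrE ltW.
have : x ^+ 2 / s <= h ^- 3.
  have xi : x <= h^-1 by rewrite -[h^-1]mul1r ler_pdivlMr.
  have -> : h ^- 3 = (h^-1) ^+ 2 / h by rewrite exprVn -invfM -exprSr.
  by apply: ler_pM; rewrite ?invr_ge0 ?sqr_ge0 ?(ltW s0)// ?lerXn2r ?nnegrE ?invr_ge0 ?(ltW h0)// lef_pV2.
lra.
Qed.

(** One Lindeberg swap: the sign [w] against a centred Gaussian of variance [w ^+ 2]. The path [F]
    runs from the Gaussian term at [r = 0] to the sign average at [r = w], and its derivative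
    reduces to [r] times increments of [heat2], which the third derivative controls. *)
Lemma heat_step (h x a v y w : R) :
  0 < h -> 0 <= x -> x * h <= 1 -> h ^+ 2 <= v ->
  `|(heat a v (y + w) + heat a v (y - w)) / 2 - heat a (v + w ^+ 2) y|
  <= 16 / h ^+ 3 * `|w| ^+ 3 *
     expR (x * (y + `|w| - a) + x ^+ 2 * (v + w ^+ 2) / 2).
Proof.
move=> h0 x0 xh hv; wlog w0 : w / 0 <= w.
  move=> H; have [/H//|/ltW w0] := leP 0 w.
  by have := H (- w); rewrite sqrrN normrN opprK (addrC (heat _ _ (y - w))) oppr_ge0; apply.
rewrite (ger0_norm w0); set V := v + w ^+ 2.
pose F r : R := (heat a (V - r ^+ 2) (y + 1 * r) + heat a (V - r ^+ 2) (y + -1 * r)) / 2.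
set K := 8 / h ^+ 3 * expR (x * (y + w - a) + x ^+ 2 * V / 2).
have v0 : 0 < v by rewrite (lt_le_trans _ hv)// exprn_gt0.
have rwV r : 0 <= r <= w -> v <= V - r ^+ 2.
  move=> /andP[r0 rw]; rewrite /V -addrA lerDl subr_ge0 lerXn2r//.
pose dF r : R :=
  (heat1 a (V - r ^+ 2) (y + r) - r * heat2 a (V - r ^+ 2) (y + r)
   + (- heat1 a (V - r ^+ 2) (y - r) - r * heat2 a (V - r ^+ 2) (y - r))) / 2.
have FdF r : 0 <= r <= w -> is_derive r 1 F (dF r).
  move=> /rwV rV; have vr : r ^+ 2 < V by rewrite -subr_gt0 (lt_le_trans v0).
  have h1 := @is_derive_heat_curve a V y 1 r (expr1n _ _) vr.
  have h2 := @is_derive_heat_curve a V y (-1) r (sqrr_sign R 1) vr.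
  by rewrite /F; apply: is_derive_eq; rewrite /dF /GRing.scale/= mul1r mulN1r; field.
have dFK r : 0 <= r <= w -> `|dF r| <= 2 * w ^+ 2 * K.
  move=> /[dup] /rwV rV /andP[r0 rw].
  set vr := V - r ^+ 2 in rV *.
  have vr0 : 0 < vr := lt_le_trans v0 rV.
  have h2K c d : y - r <= c -> c <= d -> d <= y + r ->
      `|heat2 a vr d - heat2 a vr c| <= K * (d - c).
    move=> yc cd dy; apply: (@le_norm_derive (heat2 a vr) (heat3 a vr)) => // [u _|u /andP[cu ud]].
      exact: is_derive_heat2.
    apply: le_trans (heat3_le _ _ h0 x0 xh (le_trans hv rV)) _.
    rewrite ler_wpM2l ?divr_ge0// ?exprn_ge0 ?(ltW h0)// ler_expR lerD//.
      by rewrite ler_wpM2l//; lra.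
    rewrite ler_wpM2r// ler_wpM2l ?sqr_ge0// /vr gerDl oppr_le0 sqr_ge0//.
  have K0 : 0 <= K by rewrite mulr_ge0 ?expR_ge0// divr_ge0// exprn_ge0// ltW.
  (* The increment of [heat1] is [2 * r * heat2 c]; against the heat-equation terms it leaves only
     differences of [heat2]. *)
  have [||c /andP[yc cy] cE] := @MVT_closed (heat1 a vr) (heat2 a vr) (y - r) (y + r).
  - by lra.
  - by move=> u _; exact: is_derive_heat1.
  have c1 := h2K c (y + r) yc cy (lexx _).
  have c2 := h2K (y - r) c (lexx _) yc cy.
  have -> : dF r = r / 2 * ((heat2 a vr c - heat2 a vr (y - r)) -
                            (heat2 a vr (y + r) - heat2 a vr c)).
    have {}cE : heat1 a vr (y + r) = heat1 a vr (y - r) + heat2 a vr c * (y + r - (y - r)).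
      by rewrite -cE; ring.
    by rewrite /dF -/vr cE; field.
  rewrite normrM (ger0_norm (_ : 0 <= r / 2)) ?divr_ge0//.
  apply: (@le_trans _ _ (r / 2 * (K * (c - (y - r)) + K * (y + r - c)))).
    by rewrite ler_wpM2l ?divr_ge0// (le_trans (ler_normB _ _))// lerD.
  rewrite -mulrDr (_ : c - _ + _ = 2 * r); last by ring.
  have : r ^+ 2 <= w ^+ 2 by rewrite lerXn2r.
  have -> : r / 2 * (K * (2 * r)) = r ^+ 2 * K by field.
  have := sqr_ge0 w; nra.
have := le_norm_derive w0 FdF dFK.
rewrite /F expr0n/= !mulr0 !subr0 !addr0 mul1r mulN1r /V addrK.
rewrite (_ : (heat a (v + _) y + _) / 2 = heat a (v + w ^+ 2) y); last by field.
move/le_trans; apply; rewrite /K le_eqVlt; apply/orP; left; apply/eqP; ring.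
Qed.

End gaussian.

(** * Rademacher sums: Lindeberg replacement and Hoeffding's inequality *)

Section rademacher.
Context {R : realType}.
Implicit Types (F G : R -> R) (ws : seq R) (x y a : R).

(* Expectation of [F (y + sum_i e_i w_i)] over independent random signs. *)
Fixpoint radm F ws y : R :=
  if ws is w :: ws' then (radm F ws' (y + w) + radm F ws' (y - w)) / 2 else F y.

Lemma radm_le F G ws y : (forall z, F z <= G z) -> radm F ws y <= radm G ws y.
Proof.
move=> FG; elim: ws y => [|w ws IH] y //=.
by rewrite ler_wpM2r// lerD.
Qed.

Lemma radm_ge0 F ws y : (forall z, 0 <= F z) -> 0 <= radm F ws y.
Proof. by move=> F0; elim: ws y => [|w ws IH] y //=; rewrite divr_ge0// addr_ge0. Qed.

Lemma radm_linear F G (c : R) ws y :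
  radm (fun z => F z + c * G z) ws y = radm F ws y + c * radm G ws y.
Proof.
by elim: ws y => [|w ws IH] y //=; rewrite !IH; field.
Qed.

(** Hoeffding's bound on the moment generating function, with one use of [cosh_le_expR] per sign. *)
Lemma radm_expR x a ws y : radm (fun z => expR (x * (z - a))) ws y <=
  expR (x * (y - a) + x ^+ 2 * (\sum_(w <- ws) w ^+ 2) / 2).
Proof.
elim: ws y => [|w ws IH] y /=; first by rewrite big_nil mulr0 mul0r addr0.
rewrite big_cons; set s := \sum_(_ <- _) _.
apply: (@le_trans _ _ ((expR (x * w) + expR (- (x * w))) / 2 *
    expR (x * (y - a) + x ^+ 2 * s / 2))).
  rewrite mulrAC ler_wpM2r// mulrDl -!expRD.
  apply: lerD; apply: le_trans (IH _) _; rewrite ler_expR le_eqVlt;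
    apply/orP; left; apply/eqP; rewrite -/s; ring.
apply: le_trans (ler_wpM2r (expR_ge0 _) (cosh_le_expR _)) _.
by rewrite -expRD ler_expR le_eqVlt; apply/orP; left; apply/eqP; ring.
Qed.

(** One swap per induction step. Averaging the exponential weight over [y + w] and [y - w] brings it
    back to [y], and the loss in [cosh_le_expR] is exactly the growth of the variance by [w ^+ 2];
    so the errors add up without compounding. [W] absorbs the displacement by the absolute value of
    [w] in [heat_step]. *)
Lemma radm_heat (h x a v W : R) ws y :
  0 < h -> 0 <= x -> x * h <= 1 -> h ^+ 2 <= v ->
  (forall w, w \in ws -> `|w| <= W) ->
  let s := \sum_(w <- ws) w ^+ 2 in
  `|radm (heat a v) ws y - heat a (v + s) y| <=
  16 / h ^+ 3 * (\sum_(w <- ws) `|w| ^+ 3) * expR (x * W) *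
    expR (x * (y - a) + x ^+ 2 * (v + s) / 2).
Proof.
move=> h0 x0 xh hv; elim: ws y => [|w ws IH] y wsW /=.
  by rewrite !big_nil addr0 subrr normr0 mulr0 !mul0r.
have {}IH z := IH z (fun w' w'ws => wsW w' (@mem_behead _ (w :: ws) w' w'ws)).
rewrite !big_cons; set s := \sum_(_ <- _) _ ^+ 2 in IH *.
set b := \sum_(_ <- _) _ in IH *.
have s0 : 0 <= s by apply: sumr_ge0 => i _; exact: sqr_ge0.
have b0 : 0 <= b by apply: sumr_ge0 => i _; exact: exprn_ge0.
have c0 : 0 <= 16 / h ^+ 3 by rewrite divr_ge0// exprn_ge0// ltW.
set e := expR (x * W); set E := expR (x * (y - a) + _).
pose c := 16 / h ^+ 3; have cE : 16 / h ^+ 3 = c by [].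
rewrite cE in c0 IH *; move: c c0 IH cE => c c0 IH cE.
have split4 (p q r1 r2 t : R) :
  (p + q) / 2 - t = ((p - r1) + (q - r2)) / 2 + ((r1 + r2) / 2 - t) by field.
rewrite (split4 _ _ (heat a (v + s) (y + w)) (heat a (v + s) (y - w))).
rewrite [in heat a (v + (_ + _)) y](_ : v + (w ^+ 2 + s) = v + s + w ^+ 2); last by ring.
have -> : c * (`|w| ^+ 3 + b) * e * E = c * b * e * E + c * `|w| ^+ 3 * (e * E).
  by ring.
apply: le_trans (ler_normD _ _) _; apply: lerD.
  rewrite normrM (ger0_norm (_ : 0 <= 2^-1))// ler_pdivrMr//.
  apply: le_trans (ler_normD _ _) _.
  apply: le_trans (lerD (IH _) (IH _)) _.
  rewrite -mulrDr -(mulrA _ E 2) ler_wpM2l//.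
    by rewrite !mulr_ge0 ?expR_ge0.
  rewrite -ler_pdivrMr//.
  have -> : (expR (x * (y + w - a) + x ^+ 2 * (v + s) / 2) +
     expR (x * (y - w - a) + x ^+ 2 * (v + s) / 2)) / 2 =
    (expR (x * w) + expR (- (x * w))) / 2 * expR (x * (y - a) + x ^+ 2 * (v + s) / 2).
    by rewrite [RHS]mulrAC (mulrDl (expR (x * w))) -!expRD; congr ((expR _ + expR _) / _); ring.
  apply: le_trans (ler_wpM2r (expR_ge0 _) (cosh_le_expR _)) _.
  by rewrite -expRD ler_expR le_eqVlt; apply/orP; left; apply/eqP; ring.
have hvs : h ^+ 2 <= v + s by rewrite (le_trans hv)// lerDl.
apply: le_trans (heat_step _ _ _ h0 x0 xh hvs) _.
rewrite cE ler_wpM2l ?mulr_ge0 ?exprn_ge0// -expRD ler_expR.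
have -> : x * W + (x * (y - a) + x ^+ 2 * (v + (w ^+ 2 + s)) / 2) =
  x * (y + W - a) + x ^+ 2 * (v + s + w ^+ 2) / 2 by ring.
by rewrite lerD2r ler_wpM2l// lerD2r lerD2l wsW// mem_head.
Qed.

Lemma gtailB_le x u : 0 <= x -> 0 <= u ->
  gtail (x - u) <= gtail x + u * (expR (x * u) * gauss x).
Proof.
move=> x0 u0; rewrite !gtailE.
have [||c /andP[xc cx] cE] := @MVT_closed R Phi (fun y => gauss_peak * gauss y) (x - u) x.
- by rewrite gerBl.
- by move=> y _; exact: is_derive_Phi.
have : gauss_peak * gauss c <= expR (x * u) * gauss x.
  apply: (@le_trans _ _ (gauss c)).
    by rewrite ler_piMl ?gauss_peak_le1// ltW// gauss_gt0.
  rewrite /gauss -expRD ler_expR; nra.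
move=> /(ler_wpM2l u0); rewrite opprB addrCA subrr addr0 in cE.
by move: cE; lra.
Qed.

Lemma gtailD_ge x u : 0 <= x -> 0 <= u ->
  gtail x - u * gauss x <= gtail (x + u).
Proof.
move=> x0 u0; rewrite !gtailE.
have [||c /andP[xc cx] cE] := @MVT_closed R Phi (fun y => gauss_peak * gauss y) x (x + u).
- by rewrite lerDl.
- by move=> y _; exact: is_derive_Phi.
have : gauss_peak * gauss c <= gauss x.
  apply: (@le_trans _ _ (gauss c)).
    by rewrite ler_piMl ?gauss_peak_le1// ltW// gauss_gt0.
  by rewrite /gauss ler_expR; nra.
move=> /(ler_wpM2l u0); rewrite addrAC subrr add0r in cE.
by move: cE; lra.
Qed.

Lemma gauss_shift x : expR (x * (0 - x) + x ^+ 2 / 2) = gauss x.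
Proof. by congr expR; field. Qed.

(** Hoeffding's inequality: Markov's inequality for the exponential with the optimal parameter
    [x]. *)
Lemma radm_le_gauss F ws x : 0 <= x -> \sum_(w <- ws) w ^+ 2 <= 1 ->
  (forall y, F y <= (x <= y)%R%:R) -> radm F ws 0 <= gauss x.
Proof.
move=> x0 s1 FxE; apply: (@le_trans _ _ (radm (fun y => expR (x * (y - x))) ws 0)).
  apply: radm_le => y; apply: le_trans (FxE y) _.
  have [xy|_] := leP x y; last exact: expR_ge0.
  by rewrite -expR0 ler_expR mulr_ge0// subr_ge0.
apply: le_trans (radm_expR _ _ _ _) _.
rewrite -gauss_shift ler_expR lerD2l ler_wpM2r// ler_piMr// sqr_ge0//.
Qed.

(** [F] may be either indicator, strict or weak. It is sandwiched between Gaussian distribution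
    functions of width [h], shifted by [M * h] to either side: the swaps cost the cubic term, the
    shift costs [M * theta / (1 + x)], and the leak across [x] costs [gauss M]. *)
Lemma radm_gtail F ws x (M theta : R) :
  let b := \sum_(w <- ws) `|w| ^+ 3 in
  0 <= x -> 1 <= M -> 0 < theta -> M * theta <= 1 ->
  \sum_(w <- ws) w ^+ 2 = 1 -> (1 + x) ^+ 3 * b <= 1 ->
  (forall y, (x < y)%R%:R <= F y <= (x <= y)%R%:R) ->
  `|radm F ws 0 - gtail x| <= 16 * expR 3 * gauss x *
     ((1 + x) ^+ 3 * b / theta ^+ 3 + M * theta / (1 + x) + gauss M).
Proof.
move=> b x0 M1 th0 Mth s1 xb FxE.
have M0 : 0 < M by rewrite (lt_le_trans _ M1).
have x10 : 0 < 1 + x by lra.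
(* The Gaussian tail at [x] varies on the scale [1 / (1 + x)]; the smoothing width is a fraction
   [theta] of it. *)
pose h := theta / (1 + x).
have h0 : 0 < h by rewrite divr_gt0.
have th1 : theta <= 1 by nra.
have hx1 : h * (1 + x) = theta by rewrite /h divfK// gt_eqF.
have xh : x * h <= theta by nra.
have Mxh : M * (x * h) <= 1 by nra.
have Mh : M * h = M * theta / (1 + x) by rewrite /h mulrA.
have Mh0 : 0 < M * h by rewrite mulr_gt0.
have b0 : 0 <= b by apply: sumr_ge0 => i _; exact: exprn_ge0.
(* The cube of a single weight is at most [b]; hence the factor [expR (x * W)] of [radm_heat] is at
   most [expR 1]. *)
have wW w : w \in ws -> `|w| <= (1 + x)^-1.
  move=> wws; rewrite -[leRHS]mul1r ler_pdivlMr//.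
  rewrite -(@ler_pXn2r _ 3) ?nnegrE ?mulr_ge0 ?(ltW x10)//.
  rewrite exprMn expr1n (le_trans _ xb)// mulrC ler_wpM2l ?exprn_ge0 ?(ltW x10)//.
  by rewrite /b (big_rem w)//= lerDl sumr_ge0// => i _; exact: exprn_ge0.
have hvv : h ^+ 2 <= h ^+ 2 by [].
have heatE a : `|radm (heat a (h ^+ 2)) ws 0 - heat a (h ^+ 2 + 1) 0| <=
    16 * ((1 + x) ^+ 3 * b / theta ^+ 3) * (expR (x * (x - a) + 3 / 2) * gauss x).
  have := @radm_heat h x a (h ^+ 2) (1 + x)^-1 ws 0 h0 x0 (le_trans xh th1) hvv wW.
  rewrite s1 -/b => /le_trans; apply.
  have -> : 16 / h ^+ 3 * b = 16 * ((1 + x) ^+ 3 * b / theta ^+ 3).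
    by rewrite /h; field; rewrite !gt_eqF.
  rewrite -mulrA ler_wpM2l//.
    by rewrite !mulr_ge0 ?invr_ge0 ?exprn_ge0 ?(ltW th0) ?(ltW x10).
  rewrite /gauss -!expRD ler_expR.
  have : x / (1 + x) <= 1 by rewrite ler_pdivrMr//; lra.
  have : x ^+ 2 * h ^+ 2 <= 1.
    have xh1 : x * h <= 1 := le_trans xh th1.
    by rewrite -exprMn expr_le1// mulr_ge0// ltW.
  by lra.
(* Smoothing raises the total variance to [1 + h ^+ 2]; the standard deviation is then so close to 1
   that the argument moves by at most [M * h]. *)
have sq1 : 1 <= Num.sqrt (h ^+ 2 + 1).
  by rewrite -[X in X <= _]sqrtr1 ler_wsqrtr// lerDr sqr_ge0.
have sq2 : Num.sqrt (h ^+ 2 + 1) <= 1 + h ^+ 2.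
  have /ler_wsqrtr : h ^+ 2 + 1 <= (1 + h ^+ 2) ^+ 2 by have := sqr_ge0 h; nra.
  by rewrite sqrtr_sqr ger0_norm// addr_ge0// sqr_ge0.
have gM0 := gauss_gt0 M; have gx0 := gauss_gt0 x.
have gM : gtail M <= 2 * gauss M by rewrite gtail_le_gauss// ltW.
have e1 : 1 <= expR 1 :> R by have := expR_ge1Dx (1 : R); lra.
have e3 : expR (x * (M * h) + 3 / 2) <= expR 3.
  by rewrite ler_expR; rewrite mulrCA; lra.
have e3' : expR (3 / 2) <= expR 3 :> R by rewrite ler_expR; lra.
have e31 : 1 <= expR 3 :> R by rewrite -[X in X <= _]expR0 ler_expR.
have sh : Num.sqrt (h ^+ 2) = h by rewrite sqrtr_sqr gtr0_norm.
set A := (1 + x) ^+ 3 * b / theta ^+ 3; rewrite -/A in heatE.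
have A0 : 0 <= A by rewrite divr_ge0 ?mulr_ge0 ?exprn_ge0 ?(ltW th0) ?(ltW x10).
have A16 : 0 <= 16 * A by rewrite (@mulr_ge0 R 16 A).
have tailE : radm (fun y => expR (x * (y - x))) ws 0 <= gauss x.
  by apply: le_trans (radm_expR _ _ _ _) _; rewrite s1 mulr1 gauss_shift.
rewrite -Mh ler_distl; apply/andP; split.
(* Lower bound. Left of [x] the function centred at [x + M * h] is not 0, but it is at most
   [2 * gauss M] times the weight: with [y = x - z * h], the factor [expR (- z * M)] is below
   [expR (- x * z * h)] because [x * h <= M]. *)
- have : radm (heat (x + M * h) (h ^+ 2)) ws 0 <=
      radm F ws 0 + 2 * gauss M * radm (fun y => expR (x * (y - x))) ws 0.
    rewrite -radm_linear; apply: radm_le => y.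
    have /andP[FE _] := FxE y; apply: le_trans (lerD FE (lexx _)).
    have e0 := expR_ge0 (x * (y - x)).
    have [xy|yx] := ltP x y.
      rewrite (le_trans (Phi_le1 _))// lerDl mulr_ge0// mulr_ge0// ltW//.
    rewrite add0r /heat sh.
    pose z := (x - y) / h.
    have z0 : 0 <= z by rewrite divr_ge0 ?subr_ge0// ltW.
    have -> : (y - (x + M * h)) / h = - (z + M) by rewrite /z; field; rewrite gt_eqF.
    apply: le_trans (gtail_le_gauss _) _; first by rewrite addr_ge0// ltW.
    rewrite -mulrA ler_wpM2l// /gauss -expRD ler_expR.
    have -> : y = x - z * h by rewrite /z divfK ?gt_eqF//; ring.
    have : x * h <= M by lra.
    by move=> /(ler_wpM2l z0); have := sqr_ge0 z; lra.
  have : heat (x + M * h) (h ^+ 2 + 1) 0 >= gtail x - M * h * gauss x.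
    apply: le_trans (gtailD_ge x0 (ltW Mh0)) _; apply: Phi_homo.
    rewrite sub0r mulNr lerN2 ler_pdivrMr ?(lt_le_trans _ sq1)//.
    by rewrite ler_peMr// addr_ge0// ltW.
  have := heatE (x + M * h); rewrite ler_norml => /andP[+ _].
  have : expR (x * (x - (x + M * h)) + 3 / 2) <= expR 3.
    by apply: le_trans e3'; rewrite ler_expR gerDr mulr_ge0_le0// opprD addrA subrr sub0r oppr_le0 ltW.
  set E1 := expR (x * (x - (x + M * h)) + 3 / 2); set H := heat _ _ _; set r1 := radm _ _ _; set r2 := radm F _ _.
  move: tailE; set r3 := radm _ _ _.
  move: (expR 3 : R) e31 => e e31 tailE E1e k1 k2 k3.
  have k4 : 2 * gauss M * r3 <= 2 * gauss M * gauss x by rewrite ler_wpM2l// mulr_ge0// ltW.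
  have k5 : 16 * A * (E1 * gauss x) <= 16 * A * (e * gauss x).
    by rewrite (ler_wpM2l A16)// ler_wpM2r// ltW.
  have k6 : M * h * gauss x <= 16 * e * gauss x * (M * h).
    have : 0 <= (e - 1) * (gauss x * (M * h)).
      by rewrite mulr_ge0 ?subr_ge0// mulr_ge0 ?(ltW gx0) ?(ltW Mh0).
    have : 0 <= gauss x * (M * h) by rewrite mulr_ge0 ?(ltW gx0) ?(ltW Mh0).
    by nra.
  have k7 : 2 * gauss M * gauss x <= 16 * e * gauss x * gauss M.
    have : 0 < gauss M * gauss x by rewrite mulr_gt0.
    by nra.
  rewrite !mulrDr; lra.
(* Upper bound. Right of [x] the function centred at [x - M * h] is at least [Phi M], and the
   deficit [gtail M] is covered by the weight, which is at least 1 there. *)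
- have : radm F ws 0 <= radm (heat (x - M * h) (h ^+ 2)) ws 0 +
      gtail M * radm (fun y => expR (x * (y - x))) ws 0.
    rewrite -radm_linear; apply: radm_le => y.
    have /andP[_ FE] := FxE y; apply: le_trans FE _.
    have [xy|yx] := leP x y; last first.
      by rewrite addr_ge0 ?Phi_ge0// mulr_ge0 ?gtail_ge0 ?expR_ge0.
    have ex : 1 <= expR (x * (y - x)).
      by rewrite -[X in X <= _]expR0 ler_expR mulr_ge0// subr_ge0.
    have : Phi M <= heat (x - M * h) (h ^+ 2) y.
      apply: Phi_homo; rewrite sh ler_pdivlMr//; lra.
    have := ler_wpM2l (gtail_ge0 M) ex; have := gtailE M.
    by rewrite (_ : true%:R = 1 :> R)// mulr1; lra.
  have : heat (x - M * h) (h ^+ 2 + 1) 0 <= gtail (x - 2 * (M * h)).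
    apply: Phi_homo; rewrite sub0r mulNr lerN2 ler_pdivlMr ?(lt_le_trans _ sq1)//.
    have h1 : x * h ^+ 2 <= h * theta by nra.
    have h2 : h * theta <= M * h by nra.
    have : 0 <= h ^+ 2 by exact: sqr_ge0.
    have [k|k] := leP 0 (x - 2 * (M * h)).
      move: sq2 => /(ler_wpM2l k); nra.
    by have := ler_wnM2l (ltW k) sq1; lra.
  have := @gtailB_le x (2 * (M * h)) x0 _.
  rewrite mulr_ge0 ?(ltW Mh0)// => /(_ isT).
  have := heatE (x - M * h); rewrite ler_norml => /andP[_ +].
  have : expR (x * (x - (x - M * h)) + 3 / 2) <= expR 3.
    by rewrite opprB addrCA subrr addr0.
  have : expR (x * (2 * (M * h))) <= expR 3 by rewrite ler_expR; lra.
  set E1 := expR (x * (2 * _)); set E2 := expR (x * (x - (x - M * h)) + 3 / 2).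
  set H := heat _ _ _; set r1 := radm _ _ _; set r2 := radm F _ _.
  move: tailE; set r3 := radm _ _ _.
  move: (expR 3 : R) e31 => e e31 tailE E1e E2e k1 k2 k3 k3'.
  have k4 : gtail M * r3 <= 2 * gauss M * gauss x.
    apply: (@le_trans _ _ (gtail M * gauss x)); first by rewrite ler_wpM2l// gtail_ge0.
    by rewrite ler_wpM2r// ltW.
  have k5 : 16 * A * (E2 * gauss x) <= 16 * A * (e * gauss x).
    by rewrite (ler_wpM2l A16)// ler_wpM2r// ltW.
  have k6 : 2 * (M * h) * (E1 * gauss x) <= 16 * e * gauss x * (M * h).
    have -> : 2 * (M * h) * (E1 * gauss x) = 2 * E1 * (gauss x * (M * h)) by ring.
    have g0 : 0 <= gauss x * (M * h) by rewrite mulr_ge0 ?(ltW gx0) ?(ltW Mh0).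
    by rewrite -(mulrA (16 * e)); apply: (ler_wpM2r g0); lra.
  have k7 : 2 * gauss M * gauss x <= 16 * e * gauss x * gauss M.
    have : 0 < gauss M * gauss x by rewrite mulr_gt0.
    by nra.
  rewrite !mulrDr; lra.
Qed.

End rademacher.

(** * Expectations of bounded measurable functions *)

Section bounded_expectation.
Context {d} {T : measurableType d} {R : realType} (P : probability T R).
Implicit Types (f g : T -> R) (A : set T) (b : T -> bool).

(** A class closed under the operations used below and on which integrability is automatic, so that
    expectations can be handled as real numbers. *)
Definition bmf f := measurable_fun setT f /\ exists C : R, forall x, `|f x| <= C.

Lemma bmf_integrable f : bmf f -> P.-integrable setT (EFin \o f).
Proof.
move=> [mf [C fC]]; apply: measurable_bounded_integrable => //.
  exact: le_lt_trans (probability_le1 P measurableT) (ltry _).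
exists C; split; first exact: num_real.
by move=> M CM x _ /=; apply: le_trans (fC x) (ltW CM).
Qed.

Lemma bmf_cst (c : R) : bmf (fun=> c).
Proof. by split => //; exists `|c|. Qed.

Lemma bmfD f g : bmf f -> bmf g -> bmf (fun x => f x + g x).
Proof.
move=> [mf [C fC]] [mg [D gD]]; split; first exact: measurable_funD.
by exists (C + D) => x; rewrite (le_trans (ler_normD _ _))// lerD.
Qed.

Lemma bmfM f g : bmf f -> bmf g -> bmf (fun x => f x * g x).
Proof.
move=> [mf [C fC]] [mg [D gD]]; split; first exact: measurable_funM.
by exists (C * D) => x; rewrite normrM ler_pM.
Qed.

Lemma bmf_sum I (s : seq I) (f : I -> T -> R) : (forall i, bmf (f i)) ->
  bmf (fun x => \sum_(i <- s) f i x).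
Proof.
move=> bf; elim: s => [|i s IH].
  by under eq_fun do rewrite big_nil; exact: bmf_cst.
by under eq_fun do rewrite big_cons; exact: bmfD.
Qed.

Lemma bmf_bool b : measurable [set x | b x] -> bmf (fun x => (b x)%:R).
Proof.
move=> mb; split; last by exists 1 => x; case: (b x); rewrite ?normr1 ?normr0.
rewrite (_ : (fun x => _) = \1_[set x | b x]); last first.
  by apply/funext => x; rewrite indicE; congr (nat_of_bool _)%:R; apply/idP/idP; rewrite inE.
exact: measurable_indic.
Qed.

Lemma fine_expectation f : fine 'E_P[f] = \int[P]_x f x.
Proof. by rewrite unlock. Qed.

Lemma Rint_prob b : measurable [set x | b x] ->
  \int[P]_x (b x)%:R = fine (P [set x | b x]).
Proof.
move=> mb; rewrite /Rintegral; congr fine.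
rewrite -[X in P X]setIT -(integral_indic P measurableT mb).
by apply: eq_integral => x _; rewrite indicE; congr ((nat_of_bool _)%:R)%:E;
  apply/idP/idP; rewrite inE.
Qed.

Lemma Rint_cst (c : R) : \int[P]_x c = c.
Proof. by rewrite Rintegral_cst// [X in fine X](@probability_setT _ _ _ P) mulr1. Qed.

Lemma Rint_le f g : bmf f -> bmf g -> (forall x, f x <= g x) ->
  \int[P]_x f x <= \int[P]_x g x.
Proof. by move=> bf bg fg; apply: le_Rintegral => //; exact: bmf_integrable. Qed.

Lemma RintD f g : bmf f -> bmf g ->
  \int[P]_x (f x + g x) = \int[P]_x f x + \int[P]_x g x.
Proof. by move=> bf bg; rewrite RintegralD//; exact: bmf_integrable. Qed.

Lemma RintZ (c : R) f : bmf f -> \int[P]_x (c * f x) = c * \int[P]_x f x.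
Proof. by move=> bf; rewrite RintegralZl//; exact: bmf_integrable. Qed.

Lemma Rint_sum I (s : seq I) (f : I -> T -> R) : (forall i, bmf (f i)) ->
  \int[P]_x (\sum_(i <- s) f i x) = \sum_(i <- s) \int[P]_x f i x.
Proof.
move=> bf; elim: s => [|i s IH].
  by under eq_Rintegral do rewrite big_nil; rewrite Rint_cst big_nil.
under eq_Rintegral do rewrite big_cons.
by rewrite RintD ?IH ?big_cons//; exact: bmf_sum.
Qed.

Lemma Rint_ge0 f : (forall x, 0 <= f x) -> 0 <= \int[P]_x f x.
Proof. by move=> f0; apply: Rintegral_ge0. Qed.

End bounded_expectation.

(** * Independence and sign symmetry *)

Section product_space.
Context {R : realType} {I : finType}.

Definition box (B : I -> set R) : set (I -> R) := [set v | forall i, B i (v i)].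

Definition boxes : set (set (I -> R)) :=
  [set A | exists B, (forall i, measurable (B i)) /\ A = box B].

(** The product sigma-algebra on finite families. Its generators, the boxes, are stable under
    intersection, so finite measures agreeing on boxes coincide. *)
Definition coord_space := g_sigma_algebraType boxes.

Lemma measurable_box (B : I -> set R) : (forall i, measurable (B i)) ->
  measurable (box B : set coord_space).
Proof. by move=> mB; apply: sub_sigma_algebra; exists B. Qed.

Lemma measurable_coord (i : I) :
  measurable_fun setT (fun v : coord_space => v i : R).
Proof.
move=> _ A mA; rewrite setTI; pose B j := if j == i then A else setT.
rewrite [X in measurable X](_ : _ = box B).
  by apply: measurable_box => j; rewrite /B; case: ifP.
apply/seteqP; split => [v Av j|v /(_ i)]; rewrite /B ?eqxx//.
by case: eqP => // ->.
Qed.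

Lemma measurable_coord_space {d} {T : measurableType d} (f : T -> coord_space) :
  (forall i, measurable_fun setT (fun w => f w i)) -> measurable_fun setT f.
Proof.
move=> mf; apply: (@measurability _ _ T coord_space setT f boxes) => //.
move=> _ [_ [B [mB ->]] <-]; rewrite setTI.
rewrite [X in measurable X](_ : _ = \bigcap_(i in setT) ((fun w => f w i) @^-1` B i)).
  apply: fin_bigcap_measurable => // i _; rewrite -[X in measurable X]setTI.
  exact: mf.
by apply/seteqP; split => [w Bw i _|w Bw i]; [exact: Bw|exact: Bw].
Qed.

Lemma setI_closed_boxes : setI_closed boxes.
Proof.
move=> _ _ [B [mB ->]] [C [mC ->]]; exists (fun i => B i `&` C i); split.
  by move=> i; exact: measurableI.
apply/seteqP; split => [v [Bv Cv] i|v BCv]; first by split.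
by split => i; have [] := BCv i.
Qed.

Lemma eq_coord_measure (m1 m2 : {measure set coord_space -> \bar R}) :
  (m1 setT < +oo)%E ->
  (forall B, (forall i, measurable (B i)) -> m1 (box B) = m2 (box B)) ->
  forall A, measurable A -> m1 A = m2 A.
Proof.
move=> m1T m12; apply: (@measure_unique _ R coord_space boxes (fun=> setT)) => //.
- exact: setI_closed_boxes.
- move=> _; exists (fun=> setT); split => //.
  by apply/seteqP; split.
- by apply/seteqP; split => // v _; exists 0%N.
- by move=> _ [B [mB ->]]; exact: m12.
Qed.

End product_space.
Arguments coord_space : clear implicits.

Definition pushm {d1 d2} {T1 : measurableType d1} {T2 : measurableType d2}
    {R : realType} (m : {measure set T1 -> \bar R}) (f : T1 -> T2)
    (mf : measurable_fun setT f) : {measure set T2 -> \bar R}.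
Proof. by unshelve refine (pushforward m f : {measure set T2 -> \bar R}). Defined.

Section independence.
Local Open Scope ereal_scope.
Context {d} {T : measurableType d} {R : realType} (P : probability T R).

Definition independent {I : finType} (X : I -> T -> R) := forall B : I -> set R,
  (forall i, measurable (B i)) ->
  P [set w | forall i, B i (X i w)] = \prod_i P (X i @^-1` B i).

Lemma mutually_independent_sub {I : choiceType} {K : finType}
    (X : I -> {RV P >-> R}) (f : K -> I) : injective f ->
  mutually_independent X -> independent (fun k => X (f k)).
Proof.
move=> f_inj indX B mB.
(* [mutually_independent] wants sets for all indices: those outside the image of [f] receive
   [setT]. *)
pose B' i := if [pick k | f k == i] is Some k then B k else setT.
have B'f k : B' (f k) = B k.
  by rewrite /B'; case: pickP => [k' /eqP/f_inj->//|/(_ k)]; rewrite eqxx.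
have mB' i : measurable (B' i) by rewrite /B'; case: pickP.
pose J : {fset I} := [fset f k | k in K]%fset.
have := indX J B' mB'.
rewrite (_ : \bigcap_(i in _) _ = [set w | forall k, B k (X (f k) w)]); last first.
  apply/seteqP; split => w /= h.
    move=> k; have := h (f k); rewrite B'f; apply => /=.
    by apply/imfsetP; exists k.
  by move=> i /imfsetP[k _ ->]; rewrite B'f; exact: h.
move=> ->; rewrite (perm_big [seq f k | k <- enum K])/=; last first.
  apply: uniq_perm; [exact: fset_uniq|by rewrite (map_inj_uniq f_inj) enum_uniq|move=> i].
  by apply/imfsetP/mapP => -[k _ ->]; exists k; rewrite ?mem_enum.
by rewrite big_map big_enum/=; apply: eq_bigr => k _; rewrite B'f.
Qed.

Section blocks.
Context {I J : finType} (X : J -> I -> T -> R).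
Hypothesis mX : forall j i, measurable_fun setT (X j i).
Hypothesis indX : forall B : J -> I -> set R, (forall j i, measurable (B j i)) ->
  P [set w | forall j i, B j i (X j i w)] = \prod_j \prod_i P (X j i @^-1` B j i).

Let Xv j (w : T) : coord_space R I := fun i => X j i w.

Let mXv j : measurable_fun setT (Xv j).
Proof. by apply: measurable_coord_space => i; exact: mX. Qed.

Lemma independent_block j : independent (X j).
Proof.
move=> B mB; pose B' k i := if k == j then B i else setT.
have mB' k i : measurable (B' k i) by rewrite /B'; case: ifP.
have := indX mB'; rewrite (bigD1 j)//= [X in _ * X]big1 ?mule1; last first.
  by move=> k /negbTE kj; apply: big1 => i _; rewrite /B' kj preimage_setT probability_setT.
rewrite /B' eqxx => <-; congr (P _).
apply/seteqP; split => w /= h.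
  by move=> k i; case: eqP => // ->.
by move=> i; have := h j i; rewrite eqxx.
Qed.

(** Boxes give way to arbitrary measurable sets one block at a time; [s] lists the blocks where [A]
    need not be a box. With the other blocks fixed, both sides are finite measures of the set in
    block [j0], equal on boxes by induction. *)
Lemma independent_blocks (A : J -> set (coord_space R I)) :
  (forall j, measurable (A j)) ->
  P [set w | forall j, A j (Xv j w)] = \prod_j P (Xv j @^-1` A j).
Proof.
suff H (s : seq J) : forall A : J -> set (coord_space R I),
    (forall j, measurable (A j)) -> (forall j, j \notin s -> boxes (A j)) ->
    P [set w | forall j, A j (Xv j w)] = \prod_j P (Xv j @^-1` A j).
  by move=> mA; apply: (H (enum J)) => // j; rewrite mem_enum.
elim: s => [|j0 s IH] {}A mA boxA.
  have /choice[B BA] : forall j, exists B : I -> set R,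
      (forall i, measurable (B i)) /\ A j = box B by move=> j; exact: boxA.
  transitivity (P [set w | forall j i, B j i (X j i w)]).
    congr (P _); apply/seteqP; split => w /= h j.
      by move=> i; have := h j; rewrite (BA j).2; apply.
    by rewrite (BA j).2 => i; exact: h.
  rewrite indX; last by move=> j; exact: (BA j).1.
  apply: eq_bigr => j _; rewrite -independent_block; last exact: (BA j).1.
  by congr (P _); rewrite (BA j).2.
pose upd E j := if j == j0 then E else A j.
have mXA j E : measurable E -> measurable (Xv j @^-1` E).
  by move=> mE; rewrite -[X in measurable X]setTI; exact: mXv.
pose D := \bigcap_(j in [set j | j != j0]) (Xv j @^-1` A j).
have mD : measurable D.
  by apply: fin_bigcap_measurable => [|j _]; [exact: finite_finset|exact: mXA].
pose c := \prod_(j | j != j0) P (Xv j @^-1` A j).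
have c_fin : c \is a fin_num by apply: prode_fin_num => j _; apply: fin_num_measure; exact: mXA.
have c0 : (0 <= fine c)%R by rewrite fine_ge0// prode_ge0.
pose m1 : {measure set (coord_space R I) -> \bar R} := pushm (mrestr P mD) (mXv j0).
pose m2 : {measure set (coord_space R I) -> \bar R} := mscale (NngNum c0) (pushm P (mXv j0)).
have m1E E : m1 E = P [set w | forall j, upd E j (Xv j w)].
  rewrite /m1 /pushforward /mrestr/=; congr (P _); apply/seteqP; split => w /=.
    by move=> [Ew Dw] j; rewrite /upd; case: eqP => [->//|/eqP jj0]; apply: Dw.
  move=> h; split; first by have := h j0; rewrite /upd eqxx.
  by move=> j /= jj0; have := h j; rewrite /upd (negbTE jj0).
have m2E E : m2 E = \prod_j P (Xv j @^-1` upd E j).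
  rewrite (bigD1 j0)//= /upd eqxx /m2 /mscale/= fineK// muleC; congr (_ * _).
  by apply: eq_bigr => j /negbTE ->.
have m12 E : measurable E -> m1 E = m2 E.
  apply: eq_coord_measure.
    rewrite /m1 /pushforward /mrestr/=; apply: le_lt_trans (ltry 1).
    by apply: probability_le1; apply: measurableI => //; exact: mXA.
  move=> B mB; rewrite m1E m2E; apply: IH.
    by move=> j; rewrite /upd; case: ifP => // _; exact: measurable_box.
  move=> j js; rewrite /upd; case: eqP => [_|/eqP jj0]; first by exists B.
  by apply: boxA; rewrite inE negb_or jj0.
have := m12 (A j0) (mA j0); rewrite m1E m2E.
have -> : upd (A j0) = A by apply/funext => j; rewrite /upd; case: eqP => // ->.
by [].
Qed.

End blocks.
End independence.

Section equality_in_law.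
Context {d1 d2 d3} {T1 : measurableType d1} {T2 : measurableType d2}
  {S : measurableType d3} {R : realType}.

Lemma Rint_eq_law (P1 : probability T1 R) (P2 : probability T2 R)
    (f1 : T1 -> S) (f2 : T2 -> S) (g : S -> R) :
  measurable_fun setT f1 -> measurable_fun setT f2 ->
  (forall A, measurable A -> P1 (f1 @^-1` A) = P2 (f2 @^-1` A)) -> bmf g ->
  \int[P1]_x g (f1 x) = \int[P2]_x g (f2 x).
Proof.
move=> mf1 mf2 P12 [mg [C gC]].
have b1 : bmf (g \o f1) by split; [exact: measurableT_comp|exists C => x; exact: gC].
have b2 : bmf (g \o f2) by split; [exact: measurableT_comp|exists C => x; exact: gC].
have mEg : measurable_fun setT (EFin \o g) by exact/measurable_EFinP.
rewrite /Rintegral; congr fine.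
have := @integral_pushforward _ _ _ _ R _ mf1 P1 setT (EFin \o g) mEg _ measurableT.
rewrite preimage_setT => <-; last exact: bmf_integrable b1.
have := @integral_pushforward _ _ _ _ R _ mf2 P2 setT (EFin \o g) mEg _ measurableT.
rewrite preimage_setT => <-; last exact: bmf_integrable b2.
by apply: eq_measure_integral => A mA _; exact: P12.
Qed.

End equality_in_law.

Section independent_pair.
Context {d} {T : measurableType d} {R : realType} (P : probability T R).

(** The law of the pair agrees with the product of the marginals on rectangles, hence is the product
    measure; Tonelli's theorem then factors the integral. *)
Lemma Rint_indep_mul (U V : T -> R) (f g : R -> R) :
  measurable_fun setT U -> measurable_fun setT V ->
  (forall A B, measurable A -> measurable B ->
    P (U @^-1` A `&` V @^-1` B) = (P (U @^-1` A) * P (V @^-1` B))%E) ->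
  bmf f -> bmf g -> (forall x, 0 <= f x) -> (forall x, 0 <= g x) ->
  \int[P]_w (f (U w) * g (V w)) = \int[P]_w f (U w) * \int[P]_w g (V w).
Proof.
move=> mU mV UV bf bg f0 g0.
have mUV : measurable_fun setT (fun w => (U w, V w)) by exact: measurable_fun_pair.
pose m1 := distribution P (mfun_of mU); pose m2 := distribution P (mfun_of mV).
pose F (z : R * R) : \bar R := (f z.1 * g z.2)%:E.
have [mf _] := bf; have [mg _] := bg.
have mF : measurable_fun setT F.
  apply/measurable_EFinP; apply: measurable_funM.
    exact: measurableT_comp mf measurable_fst.
  exact: measurableT_comp mg measurable_snd.
have F0 z : (0 <= F z)%E by rewrite lee_fin mulr_ge0.
have mEf : measurable_fun setT (EFin \o f) by exact/measurable_EFinP.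
have mEg : measurable_fun setT (EFin \o g) by exact/measurable_EFinP.
have E1 : (\int[m1]_x (f x)%:E = \int[P]_w (f (U w))%:E)%E.
  by rewrite ge0_integral_distribution.
have E2 : (\int[m2]_x (g x)%:E = \int[P]_w (g (V w))%:E)%E.
  by rewrite ge0_integral_distribution.
have bfU : bmf (f \o U).
  by have [_ [C fC]] := bf; split; [exact: measurableT_comp|exists C => x; exact: fC].
have bgV : bmf (g \o V).
  by have [_ [C gC]] := bg; split; [exact: measurableT_comp|exists C => x; exact: gC].
have fin1 := integrable_fin_num measurableT (bmf_integrable P bfU).
have fin2 := integrable_fin_num measurableT (bmf_integrable P bgV).
have E12 : (\int[P]_w (f (U w) * g (V w))%:E =
    \int[P]_w (f (U w))%:E * \int[P]_w (g (V w))%:E)%E.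
  have -> : (\int[P]_w (f (U w) * g (V w))%:E = \int[pushm P mUV]_z F z)%E.
    by rewrite ge0_integral_pushforward.
  transitivity (\int[m1 \x m2]_z F z)%E.
    apply: eq_measure_integral => A mA _; apply/esym.
    by apply: (@product_measure_unique _ _ _ _ R m1 m2 (pushm P mUV)) => // B C mB mC; exact: UV.
  rewrite fubini_tonelli1// -E1 -E2 -ge0_integralZr//; last 2 first.
    by move=> x _; rewrite lee_fin.
    by apply: integral_ge0 => x _; rewrite lee_fin.
  apply: eq_integral => x _; rewrite /fubini_F/= -ge0_integralZl//.
    by move=> y _; rewrite lee_fin.
  by rewrite lee_fin.
by rewrite /Rintegral E12 fineM.
Qed.

End independent_pair.

(** Identifies the recursive [radm] with an average over sign vectors. Flipping the head index is an
    involution, which pairs the terms into the average over that sign; [uniq] keeps the flip away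
    from the tail. *)
Lemma sum_signs {R : realType} {I : finType} (F : R -> R) (v : I -> R)
    (s : seq I) (y : R) : uniq s ->
  \sum_(e : {ffun I -> bool}) F (y + \sum_(i <- s) (-1) ^+ e i * v i) =
  #|{ffun I -> bool}|%:R * radm F [seq v i | i <- s] y.
Proof.
elim: s y => [|i s IH] y /=.
  by move=> _; under eq_bigr do rewrite big_nil addr0; rewrite sumr_const mulr_natl.
move=> /andP[iNs us].
pose flip (e : {ffun I -> bool}) := [ffun k => if k == i then ~~ e k else e k].
have flipK : involutive flip.
  by move=> e; apply/ffunP => k; rewrite !ffunE; case: eqP => // _; rewrite negbK.
pose f (e : {ffun I -> bool}) := F (y + \sum_(i <- i :: s) (-1) ^+ e i * v i).
have fE : \sum_e f e = \sum_e f (flip e) by rewrite (reindex_inj (inv_inj flipK)).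
have {}fE : \sum_e f e = (\sum_e (f e + f (flip e))) / 2.
  by rewrite big_split/= -fE; field.
rewrite -/(f _) fE mulrA mulrDr -!IH// -big_split/=; congr (_ / _).
apply: eq_bigr => e _; rewrite /f !big_cons !ffunE eqxx.
have -> : \sum_(j <- s) (-1) ^+ flip e j * v j = \sum_(j <- s) (-1) ^+ e j * v j.
  apply: eq_big_seq => j js; rewrite ffunE; case: eqP => // ji.
  by rewrite ji (negbTE iNs) in js.
move: (\sum_(j <- s) _) => S.
case: (e i) => /=; rewrite ?expr0 ?expr1 ?mul1r ?mulN1r !addrA; last by [].
exact: addrC.
Qed.

(** * Random signs from symmetry *)

Section symmetrization.
Context {d} {T : measurableType d} {R : realType} (P : probability T R).
Context {I : finType} (X : I -> T -> R).
Hypothesis mX : forall i, measurable_fun setT (X i).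
Hypothesis indX : independent P X.
Hypothesis symX : forall i A, measurable A ->
  P [set w | A (- X i w)] = P [set w | A (X i w)].

Definition flip_signs (e : I -> bool) (v : I -> R) : coord_space R I :=
  fun i => (-1) ^+ e i * v i.

Let Xv (w : T) : coord_space R I := fun i => X i w.

Let mXv : measurable_fun setT Xv.
Proof. by apply: measurable_coord_space => i; exact: mX. Qed.

Lemma measurable_flip e : measurable_fun setT (fun w => flip_signs e (Xv w)).
Proof.
by apply: measurable_coord_space => i; apply: measurable_funM => //; exact: mX.
Qed.

(** On boxes, independence reduces the claim to the symmetry of single coordinates; uniqueness of
    measures does the rest. *)
Lemma flip_signs_law e A : measurable A ->
  P ((fun w => flip_signs e (Xv w)) @^-1` A) = P (Xv @^-1` A).
Proof.
apply: (@eq_coord_measure R I (pushm P (measurable_flip e)) (pushm P mXv)).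
  by apply: le_lt_trans (ltry 1); apply: probability_le1; rewrite preimage_setT.
move=> B mB.
have mB' i : measurable [set x | B i ((-1) ^+ e i * x)].
  by rewrite -[X in measurable X]setTI; apply: measurable_funM => //; exact: measurable_id.
transitivity (\prod_i P (X i @^-1` [set x | B i ((-1) ^+ e i * x)%R]))%E.
  by rewrite -indX.
transitivity (\prod_i P (X i @^-1` B i))%E; last by rewrite -indX.
apply: eq_bigr => i _; case: (e i); last first.
  by congr (P _); apply/seteqP; split => w /=; rewrite expr0 mul1r.
by rewrite -(symX i (mB i)); congr (P _); apply/seteqP; split => w /=; rewrite expr1 mulN1r.
Qed.

Lemma Rint_flip_signs e (f : coord_space R I -> R) : bmf f ->
  \int[P]_w f (flip_signs e (Xv w)) = \int[P]_w f (Xv w).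
Proof.
move=> bf; apply: Rint_eq_law => //; first exact: measurable_flip.
exact: flip_signs_law.
Qed.

Section statistic.
Variables (F : R -> R) (c : coord_space R I -> R).
Hypotheses (bF : bmf F) (mc : measurable_fun setT c).
Hypothesis c_flip : forall e v, c (flip_signs e v) = c v.

Let f (v : coord_space R I) := F ((\sum_i v i) * c v).

Let bf : bmf f.
Proof.
have [mF [C FC]] := bF; split; last by exists C => x; exact: FC.
apply: measurableT_comp mF _; apply: measurable_funM => //.
by apply: measurable_sum => i; exact: measurable_coord.
Qed.

Let N0 : #|{ffun I -> bool}|%:R != 0 :> R.
Proof. by rewrite pnatr_eq0 -lt0n; apply/card_gt0P; exists [ffun=> true]. Qed.

Let bfe e : bmf (fun w => f (flip_signs e (Xv w))).
Proof.
have [mf [D fD]] := bf; split; last by exists D => w; exact: fD.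
exact: measurableT_comp (measurable_flip e).
Qed.

Let radmE w : radm F [seq X i w * c (Xv w) | i <- enum I] 0 =
  #|{ffun I -> bool}|%:R^-1 * \sum_(e : {ffun I -> bool}) f (flip_signs e (Xv w)).
Proof.
apply: (mulfI N0); rewrite mulVKf// -sum_signs ?enum_uniq//.
apply: eq_bigr => e _; rewrite /f c_flip add0r; congr F.
by rewrite mulr_suml big_enum/=; apply: eq_bigr => i _; rewrite mulrA.
Qed.

Lemma bmf_radm : bmf (fun w => radm F [seq X i w * c (Xv w) | i <- enum I] 0).
Proof.
rewrite (_ : (fun w => _) = fun w =>
  #|{ffun I -> bool}|%:R^-1 * \sum_(e : {ffun I -> bool}) f (flip_signs e (Xv w))).
  by apply: bmfM; [exact: bmf_cst|exact: bmf_sum].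
by apply/funext => w; exact: radmE.
Qed.

(** Every sign flip preserves the expectation and the factor [c], so one may average over all flips.
    The factor is [inv_norm] for self-normalized sums and 1 for plain sums. *)
Lemma Rint_radm : \int[P]_w F ((\sum_i X i w) * c (Xv w)) =
  \int[P]_w radm F [seq X i w * c (Xv w) | i <- enum I] 0.
Proof.
have -> : \int[P]_w F ((\sum_i X i w) * c (Xv w)) = \int[P]_w f (Xv w) by [].
under [RHS]eq_Rintegral do rewrite radmE.
rewrite RintZ; last exact: bmf_sum.
rewrite Rint_sum//; apply: (mulfI N0); rewrite mulVKf//.
under eq_bigr do rewrite Rint_flip_signs//.
by rewrite sumr_const mulr_natl.
Qed.

End statistic.
End symmetrization.

(** * Moderate deviations of self-normalized sums *)

Section truncated_moments.
Context {R : realType}.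
Implicit Types (k x : R).

Definition trunc_sq k x : R := x ^+ 2 * (`|x| <= k)%R%:R.
Definition trunc_cube k x : R := `|x| ^+ 3 * (`|x| <= k)%R%:R.

Lemma trunc_sq_ge0 k x : 0 <= trunc_sq k x.
Proof. by rewrite mulr_ge0 ?sqr_ge0. Qed.

Lemma trunc_cube_ge0 k x : 0 <= trunc_cube k x.
Proof. by rewrite mulr_ge0 ?exprn_ge0. Qed.

Lemma measurable_le_norm k : measurable [set x : R | `|x| <= k].
Proof.
rewrite [X in measurable X](_ : _ = `[- k, k]%classic); first exact: measurable_itv.
by apply/seteqP; split => x /=; rewrite in_itv/= ler_norml.
Qed.

Lemma bmf_trunc (f : R -> R) k : measurable_fun setT f ->
  (exists C : R, forall x, `|x| <= k -> `|f x| <= C) ->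
  bmf (fun x => f x * (`|x| <= k)%R%:R).
Proof.
move=> mf [C fC]; split.
  apply: measurable_funM => //.
  by have [] := @bmf_bool _ R R (fun x => `|x| <= k) (measurable_le_norm k).
exists (Num.max C 0) => x; have := fC x.
case: (`|x| <= k) => [/(_ isT)|_]; first by rewrite mulr1 le_max => ->.
by rewrite mulr0 normr0 le_max lexx orbT.
Qed.

Lemma bmf_trunc_sq k : bmf (trunc_sq k).
Proof.
apply: bmf_trunc => //; exists (k ^+ 2) => x xk.
by rewrite normrX lerXn2r// nnegrE (le_trans _ xk).
Qed.

Lemma bmf_trunc_cube k : bmf (trunc_cube k).
Proof.
apply: bmf_trunc; first by apply: measurable_funX; exact: normr_measurable.
exists (k ^+ 3) => x xk.
by rewrite normrX normr_id lerXn2r// nnegrE (le_trans _ xk).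
Qed.

(** Lets the truncated third moment bound the variance of the truncated squares. *)
Lemma trunc_sq_sq k x : trunc_sq k x ^+ 2 <= k * trunc_cube k x.
Proof.
rewrite /trunc_sq /trunc_cube; have [xk|_] := boolP (`|x| <= k); last by rewrite !mulr0 expr0n.
rewrite !mulr1 -exprM -(ger0_norm (exprn_even_ge0 _ _))// normrX exprS.
by rewrite ler_wpM2r// exprn_ge0.
Qed.

End truncated_moments.

Lemma bmf_comp {d1 d2} {T1 : measurableType d1} {T2 : measurableType d2}
    {R : realType} (f : T2 -> R) (g : T1 -> T2) :
  bmf f -> measurable_fun setT g -> bmf (fun w => f (g w)).
Proof.
by move=> [mf [C fC]] mg; split; [exact: measurableT_comp|exists C => w; exact: fC].
Qed.

Section self_normalized.
Context {R : realType} {I : finType}.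
Implicit Types (v : I -> R).

Definition inv_norm (v : coord_space R I) : R := (Num.sqrt (\sum_i v i ^+ 2))^-1.

Lemma measurable_inv_norm : measurable_fun setT inv_norm.
Proof.
rewrite (_ : inv_norm = (fun s => s `^ (- 2^-1)) \o fun v : coord_space R I => \sum_i v i ^+ 2).
  apply: measurableT_comp => //; apply: measurable_sum => i.
  by apply: measurable_funX; exact: measurable_coord.
apply/funext => v /=; rewrite powRN powR12_sqrt//.
by apply: sumr_ge0 => i _; exact: sqr_ge0.
Qed.

Lemma inv_norm_flip e v : inv_norm (flip_signs e v) = inv_norm v.
Proof.
congr (Num.sqrt _)^-1; apply: eq_bigr => i _.
by rewrite /flip_signs exprMn sqrr_sign mul1r.
Qed.

Definition weights v : seq R := [seq v i * inv_norm v | i <- enum I].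

(** The value is 1, except when all entries vanish: then [inv_norm v] is 0, as the inverse of 0. *)
Lemma sum_weights_sq v : \sum_(x <- weights v) x ^+ 2 =
  (0 < \sum_i v i ^+ 2)%R%:R.
Proof.
have s0 : 0 <= \sum_i v i ^+ 2 by apply: sumr_ge0 => i _; exact: sqr_ge0.
rewrite big_map big_enum/=; under eq_bigr do rewrite exprMn.
rewrite -mulr_suml /inv_norm exprVn sqr_sqrtr//.
have [->|sN0] := eqVneq (\sum_i v i ^+ 2) 0; first by rewrite mul0r ltxx.
by rewrite divff// lt_neqAle eq_sym sN0 s0.
Qed.

(* [h >= 1] unless all entries are at most [k], the truncated squares are close
   to their mean [m >= k^2] and the truncated cubes are small. *)
Lemma weights_cube_le v (k m tau : R) : 0 < k -> k ^+ 2 <= m -> 0 < tau ->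
  let h := \sum_i (k < `|v i|)%R%:R + 4 / k ^+ 4 * (\sum_i trunc_sq k (v i) - m) ^+ 2
    + 3 / (tau * k ^+ 3) * \sum_i trunc_cube k (v i) in
  0 <= h /\
  (1 <= h \/ (0 < \sum_i v i ^+ 2) /\ \sum_(x <- weights v) `|x| ^+ 3 <= tau).
Proof.
move=> k0 km tau0 h.
have [h1 h2 h3] : [/\ 0 <= \sum_i (k < `|v i|)%R%:R :> R,
    0 <= 4 / k ^+ 4 * (\sum_i trunc_sq k (v i) - m) ^+ 2 &
    0 <= 3 / (tau * k ^+ 3) * \sum_i trunc_cube k (v i)].
  split; first by apply: sumr_ge0.
    by rewrite mulr_ge0 ?sqr_ge0// divr_ge0// exprn_ge0// ltW.
  rewrite mulr_ge0// ?sumr_ge0//; last by move=> i _; exact: trunc_cube_ge0.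
  by rewrite divr_ge0// mulr_ge0 ?exprn_ge0 ?ltW.
split; first by rewrite /h !addr_ge0.
have [/existsP[i ki]|] := boolP [exists i, k < `|v i|].
  left; rewrite /h -addrA ler_wpDr ?addr_ge0//.
  by rewrite (bigD1 i)//= ki lerDl sumr_ge0.
rewrite negb_exists => /forallP vk'.
have vk i : `|v i| <= k by rewrite leNgt vk'.
have sqE : \sum_i trunc_sq k (v i) = \sum_i v i ^+ 2.
  by apply: eq_bigr => i _; rewrite /trunc_sq vk mulr1.
have cubeE : \sum_i trunc_cube k (v i) = \sum_i `|v i| ^+ 3.
  by apply: eq_bigr => i _; rewrite /trunc_cube vk mulr1.
rewrite /h sqE cubeE in h2 h3 *; set s := \sum_i v i ^+ 2 in h2 *.
set b := \sum_i `|v i| ^+ 3 in h3 *.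
(* A sum of squares below [k ^+ 2 / 2] misses [m] by more than [k ^+ 2 / 2], whence the coefficient
   [4 / k ^+ 4]. *)
have [sk|ks] := ltP s (k ^+ 2 / 2).
  left; rewrite -addrA addrC ler_wpDr// ler_wpDr//.
  rewrite mulrAC ler_pdivlMr ?exprn_gt0// mul1r.
  have -> : k ^+ 4 = 4 * (k ^+ 2 / 2) ^+ 2 by field.
  have k20 := sqr_ge0 k.
  rewrite ler_wpM2l// -(sqrrN (s - m)) opprB lerXn2r ?nnegrE//; lra.
have [b1|b1] := lerP 1 (3 / (tau * k ^+ 3) * b).
  by left; rewrite addrC ler_wpDr// addr_ge0.
have k20 : 0 < k ^+ 2 by rewrite exprn_gt0.
have s0 : 0 < s by lra.
right; split => //.
rewrite big_map big_enum/=; under eq_bigr do rewrite normrM exprMn.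
have V0 : 0 < Num.sqrt s by rewrite sqrtr_gt0.
rewrite -mulr_suml -/b /inv_norm -/s (ger0_norm (ltW _)) ?invr_gt0// exprVn.
rewrite ler_pdivrMr ?exprn_gt0//.
have b2 : 3 * b <= tau * k ^+ 3.
  by move: b1; rewrite mulrAC ltr_pdivrMr ?mulr_gt0 ?exprn_gt0// mul1r; lra.
(* From [s >= k ^+ 2 / 2]; the coefficient 3 rounds up the power 3/2 of 2. *)
have : k ^+ 3 <= 3 * Num.sqrt s ^+ 3.
  rewrite -(@ler_pXn2r _ 2) ?nnegrE ?mulr_ge0 ?exprn_ge0 ?(ltW k0) ?(ltW V0)//.
  rewrite [leRHS]exprMn !(exprAC _ 3 2) sqr_sqrtr ?(ltW s0)//.
  have : (k ^+ 2 / 2) ^+ 3 <= s ^+ 3 by rewrite lerXn2r ?nnegrE ?divr_ge0 ?(ltW s0) ?(ltW k20).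
  have : 0 <= s ^+ 3 by rewrite exprn_ge0 ?(ltW s0).
  have -> : (k ^+ 2 / 2) ^+ 3 = (k ^+ 2) ^+ 3 / 8 by field.
  lra.
move=> /(ler_wpM2l (ltW tau0)); lra.
Qed.

End self_normalized.

Lemma independent_pair {d} {T : measurableType d} {R : realType}
    (P : probability T R) {I : finType} (X : I -> T -> R) i j (A B : set R) :
  independent P X -> i != j -> measurable A -> measurable B ->
  (P (X i @^-1` A `&` X j @^-1` B) = P (X i @^-1` A) * P (X j @^-1` B))%E.
Proof.
move=> indX ij mA mB.
pose C l := if l == i then A else if l == j then B else setT.
have mC l : measurable (C l) by rewrite /C; do 2 case: ifP => // _.
have := indX C mC; rewrite (bigD1 i)//= (bigD1 j)/=; last by rewrite eq_sym.
rewrite [X in (_ * (_ * X))%E]big1; last first.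
  move=> l /andP[/negbTE li /negbTE lj].
  by rewrite /C li lj preimage_setT probability_setT.
rewrite mule1 /C eqxx eq_sym (negbTE ij) eqxx => <-; congr (P _).
apply/seteqP; split => w /=.
  by move=> [Aw Bw] l; case: eqP => [->//|_]; case: eqP => [->//|].
move=> h; split; first by have := h i; rewrite eqxx.
by have := h j; rewrite eq_sym (negbTE ij) eqxx.
Qed.

Section moderate_deviation.
Context {d} {T : measurableType d} {R : realType} (P : probability T R).
Context {I : finType} (X : I -> T -> R).
Hypothesis mX : forall i, measurable_fun setT (X i).
Hypothesis indX : independent P X.
Hypothesis symX : forall i A, measurable A ->
  P [set w | A (- X i w)] = P [set w | A (X i w)].

Let Xv (w : T) : coord_space R I := fun i => X i w.

(** Off the diagonal, independence cancels the products of expectations against [m ^+ 2]; on the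
    diagonal [trunc_sq_sq] applies. *)
Lemma trunc_sq_variance (k : R) :
  let m := \sum_i \int[P]_w trunc_sq k (X i w) in
  \int[P]_w (\sum_i trunc_sq k (X i w) - m) ^+ 2 <=
  \sum_i k * \int[P]_w trunc_cube k (X i w).
Proof.
cbv zeta; set m := \sum_i \int[P]_w trunc_sq k (X i w).
pose e i := \int[P]_w trunc_sq k (X i w).
have bZ i : bmf (fun w => trunc_sq k (X i w)) := bmf_comp (bmf_trunc_sq k) (mX i).
have bC i : bmf (fun w => trunc_cube k (X i w)) := bmf_comp (bmf_trunc_cube k) (mX i).
have bW : bmf (fun w => \sum_i trunc_sq k (X i w)) by exact: bmf_sum.
have sqS (a : I -> R) : (\sum_i a i) ^+ 2 = \sum_i \sum_j a i * a j.
  by rewrite expr2 mulr_suml; apply: eq_bigr => i _; rewrite mulr_sumr.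
have -> : \int[P]_w (\sum_i trunc_sq k (X i w) - m) ^+ 2 =
    \int[P]_w (\sum_i \sum_j trunc_sq k (X i w) * trunc_sq k (X j w)
       + (- (2 * m) * \sum_i trunc_sq k (X i w) + m ^+ 2)).
  by apply: eq_Rintegral => w _; rewrite -sqS; ring.
have bS : bmf (fun w => \sum_i \sum_j trunc_sq k (X i w) * trunc_sq k (X j w)).
  by apply: bmf_sum => i; apply: bmf_sum => j; exact: bmfM.
rewrite RintD//; last by apply: bmfD; [exact: bmfM (bmf_cst _) bW|exact: bmf_cst].
rewrite RintD//; [|exact: bmfM (bmf_cst _) bW|exact: bmf_cst].
rewrite RintZ// Rint_cst (Rint_sum P _ bZ) -/m.
rewrite Rint_sum; last by move=> i; apply: bmf_sum => j; exact: bmfM.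
have mm : m ^+ 2 = \sum_i \sum_j e i * e j by rewrite /m sqS.
have : \sum_i \int[P]_w (\sum_j trunc_sq k (X i w) * trunc_sq k (X j w)) <=
    \sum_i (\sum_j e i * e j + k * \int[P]_w trunc_cube k (X i w)).
  apply: ler_sum => i _; rewrite Rint_sum; last by move=> j; exact: bmfM.
  rewrite (bigD1 i)//= [X in _ <= X + _](bigD1 i)//= addrAC lerD//.
    apply: (@le_trans _ _ (k * \int[P]_w trunc_cube k (X i w))); last first.
      by rewrite lerDr mulr_ge0// Rint_ge0// => w; exact: trunc_sq_ge0.
    rewrite -RintZ//; apply: Rint_le => [||w]; [exact: bmfM|exact: bmfM (bmf_cst _) (bC i)|].
    by rewrite -expr2 trunc_sq_sq.
  rewrite le_eqVlt; apply/orP; left; apply/eqP; apply: eq_bigr => j ji.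
  apply: (@Rint_indep_mul _ _ _ P _ _ (trunc_sq k) (trunc_sq k)) => //; first last.
  - exact: trunc_sq_ge0.
  - exact: trunc_sq_ge0.
  - exact: bmf_trunc_sq.
  - exact: bmf_trunc_sq.
  - by move=> A B mA mB; apply: independent_pair; rewrite // eq_sym.
rewrite big_split/= -mm; lra.
Qed.

(** The penalty [h] of [weights_cube_le] has small expectation. Where [h >= 1], the conditional
    probability and [gtail x] are both at most [2 * gauss x], so the exceptional event enters
    multiplied by [gauss x]; elsewhere [radm_gtail] applies. *)
Lemma moderate_deviation_bound (F : R -> R) (k dl tau x M theta : R) :
  bmf F -> (forall y, (x < y)%R%:R <= F y <= (x <= y)%R%:R) ->
  0 < k -> 0 <= dl -> 0 < tau <= 1 -> 0 <= x -> 1 <= M -> 0 < theta ->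
  M * theta <= 1 -> (1 + x) ^+ 3 * tau <= 1 ->
  \sum_i fine (P [set w | k < `|X i w|]) <= dl ->
  \sum_i \int[P]_w trunc_cube k (X i w) <= dl * k ^+ 3 ->
  k ^+ 2 <= \sum_i \int[P]_w trunc_sq k (X i w) ->
  `|\int[P]_w F ((\sum_i X i w) * inv_norm (Xv w)) - gtail x| <=
  16 * gauss x * (dl / tau) + 16 * expR 3 * gauss x *
     ((1 + x) ^+ 3 * tau / theta ^+ 3 + M * theta / (1 + x) + gauss M).
Proof.
move=> bF FE k0 dl0 /andP[tau0 tau1] x0 M1 th0 Mth xtau Hq Hc Hs.
have bZ i : bmf (fun w => trunc_sq k (X i w)) := bmf_comp (bmf_trunc_sq k) (mX i).
have bC i : bmf (fun w => trunc_cube k (X i w)) := bmf_comp (bmf_trunc_cube k) (mX i).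
set m := \sum_i _ in Hs.
set K := 16 * expR 3 * gauss x * _.
have K0 : 0 <= K.
  by rewrite !mulr_ge0 ?expR_ge0// !addr_ge0 ?expR_ge0// ?mulr_ge0 ?invr_ge0 ?exprn_ge0 ?addr_ge0//; lra.
pose h w := \sum_i (k < `|X i w|)%R%:R
    + 4 / k ^+ 4 * (\sum_i trunc_sq k (X i w) - m) ^+ 2
    + 3 / (tau * k ^+ 3) * \sum_i trunc_cube k (X i w).
have mk i : measurable [set w | k < `|X i w|].
  rewrite [X in measurable X](_ : _ = (fun w => `|X i w|) @^-1` `]k, +oo[); last first.
    by apply/seteqP; split => w /=; rewrite in_itv/= andbT.
  by rewrite -[X in measurable X]setTI; exact: (measurableT_comp (@normr_measurable R setT) (mX i)).
rewrite (Rint_radm mX indX symX bF measurable_inv_norm inv_norm_flip).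
have brad := bmf_radm mX bF measurable_inv_norm inv_norm_flip.
pose rad w := radm F (weights (fun i => X i w)) 0.
rewrite -[X in `|X - _|]/(\int[P]_w rad w).
have bW : bmf (fun w => \sum_i trunc_sq k (X i w)) by exact: bmf_sum.
have bq : bmf (fun w => \sum_i (k < `|X i w|)%R%:R : R) by apply: bmf_sum => i; exact: bmf_bool.
have bV : bmf (fun w => (\sum_i trunc_sq k (X i w) - m) ^+ 2).
  by apply: (bmfM (f := fun w => _ - m) (g := fun w => _ - m)); apply: bmfD => //; exact: bmf_cst.
have bCs : bmf (fun w => \sum_i trunc_cube k (X i w)) by exact: bmf_sum.
have b1 : bmf (fun w => 4 / k ^+ 4 * (\sum_i trunc_sq k (X i w) - m) ^+ 2).
  exact: bmfM (bmf_cst _) bV.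
have b2 : bmf (fun w => 3 / (tau * k ^+ 3) * \sum_i trunc_cube k (X i w)).
  exact: bmfM (bmf_cst _) bCs.
have bh : bmf h by apply: bmfD => //; exact: bmfD.
(* 8 is 1 + 4 + 3, one contribution for each term of [h]. *)
have Eh : \int[P]_w h w <= 8 * (dl / tau).
  rewrite RintD//; last exact: bmfD.
  rewrite RintD// !RintZ// !Rint_sum//; last by move=> i; exact: bmf_bool.
  under eq_bigr do rewrite Rint_prob//.
  have := trunc_sq_variance k; rewrite -/m -mulr_sumr => var.
  have k4 : 0 < k ^+ 4 by rewrite exprn_gt0.
  have k3 : 0 < k ^+ 3 by rewrite exprn_gt0.
  have dlt : dl <= dl / tau by rewrite ler_pdivlMr// ler_piMr.
  have e2 : 4 / k ^+ 4 * \int[P]_w (\sum_i trunc_sq k (X i w) - m) ^+ 2 <= 4 * dl.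
    rewrite mulrAC ler_pdivrMr// -mulrA ler_wpM2l//.
    by apply: le_trans var _; rewrite [k ^+ 4]exprS mulrCA ler_wpM2l// ltW.
  have e3 : 3 / (tau * k ^+ 3) * \sum_i \int[P]_w trunc_cube k (X i w) <= 3 * (dl / tau).
    rewrite mulrAC ler_pdivrMr ?mulr_gt0// -mulrA ler_wpM2l//.
    by rewrite mulrA divfK ?gt_eqF.
  lra.
have gx0 := gauss_gt0 x.
have rad_h w : `|rad w - gtail x| <= 2 * gauss x * h w + K.
  have [h0 [h1|[V0 cube]]] := weights_cube_le (fun i => X i w) k0 Hs tau0.
    rewrite -/(h w) in h0 h1.
    have r0 : 0 <= rad w.
      by apply: radm_ge0 => y; have /andP[+ _] := FE y; apply: le_trans.
    have r1 : rad w <= gauss x.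
      apply: radm_le_gauss => //; first by rewrite sum_weights_sq; case: (_ < _).
      by move=> y; have /andP[] := FE y.
    have g1 := gtail_le_gauss x0; have g0 := gtail_ge0 x.
    have : 2 * gauss x <= 2 * gauss x * h w by rewrite ler_peMr// mulr_ge0// ltW.
    by rewrite ler_norml => ?; apply/andP; split; lra.
  have b0 : 0 <= \sum_(y <- weights (fun i => X i w)) `|y| ^+ 3.
    by apply: sumr_ge0 => i _; exact: exprn_ge0.
  have x3 : 0 <= (1 + x) ^+ 3 by rewrite exprn_ge0// addr_ge0.
  have := @radm_gtail R F (weights (fun i => X i w)) x M theta x0 M1 th0 Mth.
  rewrite sum_weights_sq V0 => /(_ erefl (le_trans (ler_wpM2l x3 cube) xtau) FE).
  move=> /le_trans; apply.
  apply: (@le_trans _ _ K); last by rewrite lerDr mulr_ge0// mulr_ge0// ltW.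
  rewrite ler_wpM2l ?mulr_ge0 ?expR_ge0// !lerD2r ler_wpM2r ?invr_ge0 ?exprn_ge0 ?(ltW th0)//.
  by rewrite ler_wpM2l.
have bR : bmf (fun w => 2 * gauss x * h w + K) by apply: bmfD; [exact: bmfM (bmf_cst _) bh|exact: bmf_cst].
have ER : \int[P]_w (2 * gauss x * h w + K) <= 16 * gauss x * (dl / tau) + K.
  have bH2 : bmf (fun w => 2 * gauss x * h w) := bmfM (bmf_cst _) bh.
  rewrite RintD//; last exact: bmf_cst.
  rewrite RintZ// Rint_cst.
  rewrite lerD2r; have := ler_wpM2l (ltW gx0) Eh; lra.
rewrite ler_distl; apply/andP; split.
  have : \int[P]_w gtail x <= \int[P]_w (rad w + (2 * gauss x * h w + K)).
    apply: Rint_le => [||w]; [exact: bmf_cst|exact: bmfD|].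
    by have := rad_h w; rewrite ler_distl => /andP[+ _]; rewrite lerBlDr.
  rewrite Rint_cst RintD//; lra.
have : \int[P]_w rad w <= \int[P]_w (gtail x + (2 * gauss x * h w + K)).
  apply: Rint_le => [||w]; [exact: brad|exact: bmfD (bmf_cst _) bR|].
  by have := rad_h w; rewrite ler_distl => /andP[_ +].
rewrite RintD//; last exact: bmf_cst.
rewrite Rint_cst; lra.
Qed.

(** From the degree 5 term of the exponential series. The power 10 still leaves more than [1 / M]
    after the loss of a factor of order [M ^+ 8]. *)
Lemma gauss_le_inv (M : R) : 0 < M -> gauss M <= 5`!%:R * 2 ^+ 5 / M ^+ 10.
Proof.
move=> M0; have M10 : 0 < M ^+ 10 by rewrite exprn_gt0.
rewrite ler_pdivlMr// /gauss mulNr expRN mulrC ler_pdivrMr ?expR_gt0//.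
have := @expR_ge1Dxn R (M ^+ 2 / 2) 4.
rewrite divr_ge0 ?sqr_ge0// => /(_ isT).
rewrite expr_div_n -exprM -mulrA -invfM (mulrC (2 ^+ 5)) => H.
by rewrite mulrC -ler_pdivrMr ?mulr_gt0 ?exprn_gt0 ?ltr0n ?fact_gt0//; lra.
Qed.

(** The 16 serves the range [x > M ^+ 8]. For smaller [x] the numerator collects the four error
    terms, and the denominator is the constant of [gtail_ge_gauss], which turns [gauss x / (1 + x)]
    into [gtail x]. *)
Definition moderate_const : R := 16 +
  (32 + 16 * expR 3 * (17 + 4 * (5`!%:R * 2 ^+ 5))) / (gauss_peak * expR (- (3 / 2))).

(** Hoeffding's inequality for fixed absolute values, then integrated. *)
Lemma self_normalized_tail_le_gauss (F : R -> R) x : 0 <= x -> bmf F ->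
  (forall y, (x < y)%R%:R <= F y <= (x <= y)%R%:R) ->
  0 <= \int[P]_w F ((\sum_i X i w) * inv_norm (Xv w)) /\
  \int[P]_w F ((\sum_i X i w) * inv_norm (Xv w)) <= gauss x.
Proof.
move=> x0 bF FE; have F0 y : 0 <= F y by have /andP[+ _] := FE y; apply: le_trans.
split; first exact: Rint_ge0.
rewrite (Rint_radm mX indX symX bF measurable_inv_norm inv_norm_flip).
rewrite -[leRHS](Rint_cst P); apply: Rint_le; last first.
- move=> w; apply: (@radm_le_gauss R F (weights (Xv w))) => //.
    by rewrite sum_weights_sq; case: (_ < _).
  by move=> y; have /andP[] := FE y.
- exact: bmf_cst.
- by have brad := bmf_radm mX bF measurable_inv_norm inv_norm_flip; exact: brad.
Qed.

Lemma moderate_deviation (F : R -> R) (k dl x M p : R) :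
  bmf F -> (forall y, (x < y)%R%:R <= F y <= (x <= y)%R%:R) ->
  0 < k -> 0 <= dl -> 0 <= x -> 2 <= M -> dl * M ^+ 48 <= 1 ->
  1 <= p -> ln p <= M ^+ 16 / 8 ->
  \sum_i fine (P [set w | k < `|X i w|]) <= dl ->
  \sum_i \int[P]_w trunc_cube k (X i w) <= dl * k ^+ 3 ->
  k ^+ 2 <= \sum_i \int[P]_w trunc_sq k (X i w) ->
  `|\int[P]_w F ((\sum_i X i w) * inv_norm (Xv w)) - gtail x| <=
  moderate_const / M * (gtail x + p^-1).
Proof.
move=> bF FE k0 dl0 x0 M2 dlM p1 lnp Hq Hc Hs; rewrite /moderate_const.
have gM_le M' : 0 < M' -> gauss M' <= 5`!%:R * 2 ^+ 5 / M' ^+ 10 := @gauss_le_inv M'.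
have : 0 <= 5`!%:R * 2 ^+ 5 :> R by rewrite mulr_ge0 ?exprn_ge0.
move: (5`!%:R * 2 ^+ 5) gM_le => B gM_le B0.
set D := 16 + _.
have M0 : 0 < M by lra.
have p0 : 0 < p by lra.
have C16 : 16 <= D.
  rewrite /D lerDl divr_ge0//; last by rewrite mulr_ge0 ?expR_ge0// ltW// gauss_peak_gt0.
  by rewrite addr_ge0// mulr_ge0// ?addr_ge0 ?mulr_ge0// expR_ge0.
have C0 : 0 < D by lra.
have M8 : 1 <= M ^+ 8 by rewrite exprn_ege1; lra.
(* These exponents make each error, measured against [gauss x / (1 + x)] with [1 + x <= 2 * M ^+ 8],
   a multiple of [1 / M]: the exceptional event has exponent -48 + 39 + 8, the cubic term 32 - 39 +
   6, the shift 1 - 2. *)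
pose tau := M ^- 39; pose theta := M ^- 2.
have Mn0 n : 0 < M ^+ n by rewrite exprn_gt0.
have MnE n : M ^+ n != 0 by rewrite gt_eqF.
have M1 : 1 <= M by lra.
have tau01 : 0 < tau <= 1.
  by rewrite /tau invr_gt0 Mn0/= invf_le1 ?Mn0// exprn_ege1.
have th0 : 0 < theta by rewrite invr_gt0.
have Mth : M * theta <= 1.
  rewrite /theta (_ : M * M ^- 2 = M^-1); last by field; exact: (MnE 1%N).
  by rewrite invf_le1.
have tauM : (2 * M ^+ 8) ^+ 3 * tau <= 1.
  rewrite /tau ler_pdivrMr// mul1r exprMn -exprM.
  rewrite (_ : M ^+ 39 = M ^+ 15 * M ^+ (8 * 3)); last by rewrite -exprD.
  rewrite ler_wpM2r ?(ltW (Mn0 _))//.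
  apply: (@le_trans _ _ (M ^+ 3)); first by rewrite lerXn2r// nnegrE ltW.
  exact: ler_weXn2l.
have [xM|Mx] := leP x (M ^+ 8).
  have x1M : 1 + x <= 2 * M ^+ 8 by lra.
  have x10 : 0 < 1 + x by lra.
  have x1n n : (1 + x) ^+ n <= (2 * M ^+ 8) ^+ n.
    by rewrite lerXn2r// nnegrE ?mulr_ge0// ltW.
  have tau0 : 0 <= tau by case/andP: tau01 => /ltW.
  have := @moderate_deviation_bound F k dl tau x M theta bF FE k0 dl0 tau01 x0 M1 th0 Mth
     (le_trans (ler_wpM2r tau0 (x1n 3%N)) tauM) Hq Hc Hs.
  move=> /le_trans; apply.
  have gt_g := gtail_ge_gauss x0.
  set g := gauss x / (1 + x).
  have g0 : 0 < g by rewrite divr_gt0 ?gauss_gt0.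
  have gE : gauss x = g * (1 + x) by rewrite /g divfK// gt_eqF.
  have e0 : 0 < gauss_peak * expR (- (3 / 2)) :> R by rewrite mulr_gt0 ?gauss_peak_gt0 ?expR_gt0.
  have t1 : dl / tau * (1 + x) <= 2 / M.
    rewrite ler_pdivlMr// /tau invrK.
    apply: (@le_trans _ _ (dl * M ^+ 39 * (2 * M ^+ 8) * M)).
      by rewrite ler_wpM2r ?(ltW M0)// ler_wpM2l// mulr_ge0 ?(ltW (Mn0 _)).
    rewrite (_ : dl * M ^+ 39 * (2 * M ^+ 8) * M = 2 * (dl * M ^+ 48)); last by ring.
    by lra.
  have t2 : (1 + x) ^+ 3 * tau / theta ^+ 3 * (1 + x) <= 16 / M.
    rewrite ler_pdivlMr// /tau /theta.
    rewrite (_ : _ * M = (1 + x) ^+ 4 * M ^- 32); last first.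
      by field; exact: (MnE 1%N).
    by rewrite ler_pdivrMr// (le_trans (x1n 4%N))// exprMn -exprM ler_wpM2r ?(ltW (Mn0 _))//; lra.
  have t3 : M * theta / (1 + x) * (1 + x) <= 1 / M.
    by rewrite divfK ?gt_eqF// /theta le_eqVlt; apply/orP; left; apply/eqP; field; exact: (MnE 1%N).
  have t4 : gauss M * (1 + x) <= 4 * B / M.
    apply: (@le_trans _ _ (B / M ^+ 10 * (2 * M ^+ 8))).
      by rewrite ler_pM// ?(ltW x10) ?(ltW (gauss_gt0 _))// gM_le.
    rewrite (_ : B / M ^+ 10 * (2 * M ^+ 8) = 2 * B / M * M^-1); last by field; exact: (MnE 1%N).
    have Mi0 : 0 <= M^-1 by rewrite invr_ge0 ltW.
    have Mi1 : M^-1 <= 1 by rewrite invf_le1.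
    have BM : 0 <= B / M by rewrite divr_ge0 ?(ltW M0).
    by have := ler_wpM2l BM Mi1; lra.
  have -> : 16 * gauss x * (dl / tau) + 16 * expR 3 * gauss x *
      ((1 + x) ^+ 3 * tau / theta ^+ 3 + M * theta / (1 + x) + gauss M) =
    g * (16 * (dl / tau * (1 + x)) + 16 * expR 3 *
     ((1 + x) ^+ 3 * tau / theta ^+ 3 * (1 + x) + M * theta / (1 + x) * (1 + x)
       + gauss M * (1 + x))) by rewrite gE; ring.
  apply: (@le_trans _ _ (g * ((32 + 16 * expR 3 * (17 + 4 * B)) / M))).
    rewrite ler_wpM2l ?(ltW g0)//.
    have -> : (32 + 16 * expR 3 * (17 + 4 * B)) / M =
      16 * (2 / M) + 16 * expR 3 * (16 / M + 1 / M + 4 * B / M) by ring.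
    by rewrite lerD ?ler_wpM2l ?mulr_ge0 ?expR_ge0// !lerD.
  apply: (@le_trans _ _ (D / M * gtail x)); last first.
    by rewrite ler_wpM2l ?divr_ge0 ?(ltW C0) ?(ltW M0)// lerDl invr_ge0 ltW.
  have gg : g <= gtail x / (gauss_peak * expR (- (3 / 2))).
    by rewrite ler_pdivlMr// mulrC /g mulrA.
  have E0 : 0 <= (32 + 16 * expR 3 * (17 + 4 * B)) / M.
    by rewrite divr_ge0 ?(ltW M0)// addr_ge0// mulr_ge0// ?addr_ge0 ?mulr_ge0// expR_ge0.
  apply: le_trans (ler_wpM2r E0 gg) _.
  set e1 := gauss_peak * _; set E1 := 32 + _.
  have -> : D / M * gtail x = gtail x / e1 * (E1 / M) + 16 / M * gtail x.
    by rewrite /D -/e1 -/E1; field; rewrite (gt_eqF e0) (gt_eqF M0).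
  by rewrite lerDl mulr_ge0 ?gtail_ge0// divr_ge0// ltW.
(* Beyond [M ^+ 8], with [y = M ^+ 16], [gauss x] is at most [expR (- y / 2)]: the part
   [expR (- y / 8)] pays for [p^-1], and the remaining 3/8 of the exponent for [1 / M]. *)
have x8 : M ^+ 8 <= x := ltW Mx.
have [i0 i1] := self_normalized_tail_le_gauss x0 bF FE.
have g1 := gtail_le_gauss x0; have g0 := gtail_ge0 x.
apply: (@le_trans _ _ (2 * gauss x)).
  by rewrite ler_norml; apply/andP; split; lra.
apply: (@le_trans _ _ (D / M * p^-1)); last first.
  by rewrite ler_wpM2l ?divr_ge0 ?(ltW C0) ?(ltW M0)// lerDr.
apply: (@le_trans _ _ (16 / M * p^-1)); last first.
  by rewrite ler_wpM2r ?invr_ge0 ?(ltW p0)// ler_wpM2r ?invr_ge0 ?(ltW M0).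
pose y := M ^+ 16.
have yM : M <= y by rewrite -[leLHS]expr1; exact: ler_weXn2l.
have y0 : 0 < y by lra.
have gy : gauss x <= expR (- (3 * y / 8)) * expR (- (y / 8)).
  rewrite -expRD ler_expR.
  have : y <= x ^+ 2 by rewrite /y (exprM _ 8 2) lerXn2r ?nnegrE ?(ltW (Mn0 _)).
  lra.
have py : expR (- (y / 8)) <= p^-1.
  by rewrite -[p]lnK ?posrE// -expRN ler_expR lerN2.
have y3 : 0 <= 3 * y / 8 by rewrite divr_ge0// mulr_ge0// ltW.
have e3 : expR (- (3 * y / 8)) <= 8 / M.
  have := expRN_le y3; rewrite -ler_pdivlMr; last by lra.
  move=> /le_trans; apply.
  rewrite ler_pdivrMr; last by lra.
  by rewrite mulrAC ler_pdivlMr// mul1r; lra.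
have : expR (- (3 * y / 8)) * expR (- (y / 8)) <= 8 / M * p^-1.
  by rewrite ler_pM ?expR_ge0.
lra.
Qed.

End moderate_deviation.

(** * Levy's condition and the truncation level *)

Section rademacher_maximal.
Context {R : realType}.
Implicit Types (F : R -> R) (ws : seq R).

Lemma radm_shift F ws (y u : R) : radm F ws (y + u) = radm (fun z => F (z + u)) ws y.
Proof. by elim: ws y => [|w ws IH] y //=; rewrite -!IH addrAC (addrAC y u). Qed.

Lemma radm_cst (c : R) ws y : radm (fun=> c) ws y = c.
Proof. by elim: ws y => [|w ws IH] y //=; rewrite !IH; field. Qed.

Lemma radm_sqr ws (y : R) : radm (fun z => z ^+ 2) ws y = y ^+ 2 + \sum_(w <- ws) w ^+ 2.
Proof.
elim: ws y => [|w ws IH] y /=; first by rewrite big_nil addr0.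
by rewrite !IH big_cons; field.
Qed.

(* Of [z + w] and [z - w] at least one exceeds [t] in absolute value. *)
Lemma radm_max ws (t y w : R) : w \in ws -> t < `|w| ->
  1 / 2 <= radm (fun z => (t < `|z|)%R%:R) ws y.
Proof.
move=> + tw; elim: ws y => [//|a ws IH] y /=; rewrite inE => /predU1P[<-|wws].
  rewrite radm_shift -(mul1r (radm _ ws (y - w))) radm_shift -radm_linear.
  rewrite ler_wpM2r// -[leLHS](radm_cst 1 ws y); apply: radm_le => z; rewrite mul1r.
  have [_|zw] := ltP t `|z + w|; first by rewrite lerDl.
  have [_|zw'] := ltP t `|z - w|; first by rewrite add0r.
  have := ler_normB (z + w) (z - w).
  rewrite (_ : z + w - (z - w) = w *+ 2); last by rewrite mulr2n; ring.
  by rewrite normrMn mulr2n; lra.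
have := IH (y + a) wws; have := IH (y - a) wws; lra.
Qed.

End rademacher_maximal.

Section symmetric_sums.
Context {d} {T : measurableType d} {R : realType} (P : probability T R).
Context {I : finType} (X : I -> T -> R).
Hypothesis mX : forall i, measurable_fun setT (X i).
Hypothesis indX : independent P X.
Hypothesis symX : forall i A, measurable A ->
  P [set w | A (- X i w)] = P [set w | A (X i w)].

Let S w := \sum_i X i w.

Let mS : measurable_fun setT S. Proof. exact: measurable_sum. Qed.

Let mSi (A : set R) : measurable A -> measurable [set w | A (S w)].
Proof. by move=> mA; rewrite -[X in measurable X]setTI; exact: mS. Qed.

Let meas_norm_gt (t : R) : measurable [set x : R | t < `|x|].
Proof.
rewrite (_ : [set x : R | t < `|x|] = ~` [set x : R | `|x| <= t]).
  by apply: measurableC; exact: measurable_le_norm.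
by apply/seteqP; split => x /=; rewrite ltNge => /negP.
Qed.

Lemma sum_sym (A : set R) : measurable A ->
  P [set w | A (- S w)] = P [set w | A (S w)].
Proof.
move=> mA; have mSv : measurable_fun setT (fun v : coord_space R I => \sum_i v i).
  by apply: measurable_sum => i; exact: measurable_coord.
have mA' : measurable ((fun v : coord_space R I => \sum_i v i) @^-1` A).
  by rewrite -[X in measurable X]setTI; exact: mSv.
rewrite -[RHS](flip_signs_law mX indX symX (fun=> true) mA').
congr (P _); apply/seteqP; split => w /=; rewrite /flip_signs;
  by under eq_bigr do rewrite expr1 mulN1r; rewrite sumrN.
Qed.

Lemma sum_median :
  fine (P [set w | S w < 0]) <= 1 / 2 /\ 1 / 2 <= fine (P [set w | S w <= 0]).
Proof.
have mlt : measurable [set x : R | x < 0].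
  by rewrite [X in measurable X](_ : _ = `]-oo, 0[%classic).
have mle : measurable [set x : R | x <= 0].
  by rewrite [X in measurable X](_ : _ = `]-oo, 0]%classic).
have E : P [set w | 0 < S w] = P [set w | S w < 0].
  have := sum_sym mlt; rewrite /= => <-; congr (P _).
  by apply/seteqP; split => w /=; rewrite oppr_lt0.
have C : fine (P [set w | S w <= 0]) = 1 - fine (P [set w | 0 < S w]).
  have -> : [set w | 0 < S w] = ~` [set w | S w <= 0].
    by apply/seteqP; split => w /=; rewrite ltNge => /negP.
  rewrite probability_setC; last exact: mSi mle.
  by rewrite fineB ?fin_num_measure//; [rewrite /=; lra|exact: mSi mle].
rewrite C E; suff : fine (P [set w | S w < 0]) <= fine (P [set w | S w <= 0]).
  by rewrite C E; lra.
apply: fine_le; rewrite ?fin_num_measure//; [exact: mSi mlt|exact: mSi mle|].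
by apply: le_measure; rewrite ?inE; [exact: mSi mlt|exact: mSi mle|move=> w /= /ltW].
Qed.

Let Rint_radm1 (F : R -> R) : bmf F ->
  \int[P]_w F (S w) = \int[P]_w radm F [seq X i w | i <- enum I] 0.
Proof.
move=> bF; have := @Rint_radm _ _ _ P _ _ mX indX symX F (fun=> 1) bF (measurable_cst _) (fun _ _ => erefl).
under eq_Rintegral do rewrite mulr1.
by under [in RHS]eq_Rintegral => w _ do under eq_map do rewrite mulr1.
Qed.

Let brad1 (F : R -> R) : bmf F -> bmf (fun w => radm F [seq X i w | i <- enum I] 0).
Proof.
move=> bF; have := @bmf_radm _ _ _ _ _ mX F (fun=> 1) bF (measurable_cst _) (fun _ _ => erefl).
by under eq_fun => w do under eq_map do rewrite mulr1.
Qed.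

Let bgt (t : R) : bmf (fun y : R => (t < `|y|)%R%:R : R).
Proof. exact: bmf_bool (meas_norm_gt t). Qed.

(** Once some summand exceeds [t] in absolute value, random signs carry the sum beyond [t] with
    conditional probability at least 1/2. *)
Lemma prob_sum_gt_ge (t : R) :
  (1 - fine (P [set w | forall i, `|X i w| <= t])) / 2 <=
  fine (P [set w | t < `|S w|]).
Proof.
rewrite -Rint_prob; last exact: (mSi (meas_norm_gt t)).
rewrite (Rint_radm1 (bgt t)).
have mall : measurable [set w | [forall i, `|X i w| <= t]].
  rewrite [X in measurable X](_ : _ = \bigcap_(i in setT) (X i @^-1` [set x | `|x| <= t])).
    apply: fin_bigcap_measurable => // i _; rewrite -[X in measurable X]setTI.
    by apply: mX => //; exact: measurable_le_norm.
  by apply/seteqP; split => w /= => [/forallP h i _|h]; [exact: h|apply/forallP => i; exact: h].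
have -> : [set w | forall i, `|X i w| <= t] = [set w | [forall i, `|X i w| <= t]].
  by apply/seteqP; split => w /= => [h|/forallP//]; apply/forallP.
rewrite -Rint_prob//.
have ball := @bmf_bool _ _ R _ mall.
have -> : (1 - \int[P]_w [forall i, `|X i w| <= t]%:R) / 2 =
   \int[P]_w (1 / 2 + - (1 / 2) * [forall i, `|X i w| <= t]%:R).
  rewrite RintD; [|exact: bmf_cst|exact: bmfM (bmf_cst _) ball].
  by rewrite Rint_cst RintZ//; field.
apply: Rint_le; first by apply: bmfD; [exact: bmf_cst|exact: bmfM (bmf_cst _) ball].
  exact: brad1 (bgt t).
move=> w; case: (boolP [forall i, _]) => [_|].
  by rewrite mulr1 addrN radm_ge0.
rewrite negb_forall => /existsP[i]; rewrite -ltNge => tXi.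
rewrite mulr0 addr0; apply: radm_max tXi.
by apply/mapP; exists i; rewrite ?mem_enum.
Qed.

End symmetric_sums.

Section truncated_sums.
Context {d} {T : measurableType d} {R : realType} (P : probability T R).
Context {I : finType} (X : I -> T -> R).
Hypothesis mX : forall i, measurable_fun setT (X i).
Hypothesis indX : independent P X.
Hypothesis symX : forall i A, measurable A ->
  P [set w | A (- X i w)] = P [set w | A (X i w)].

Let meas_norm_gt (t : R) : measurable [set x : R | t < `|x|].
Proof.
rewrite (_ : [set x : R | t < `|x|] = ~` [set x : R | `|x| <= t]).
  by apply: measurableC; exact: measurable_le_norm.
by apply/seteqP; split => x /=; rewrite ltNge => /negP.
Qed.

(** Truncation at [t], then Chebyshev's inequality; the truncated summands are again symmetric, and
    averaging over signs removes the cross terms. *)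
Lemma prob_sum_gt_le (t r : R) : 0 < r ->
  fine (P [set w | r < `|\sum_i X i w|]) <=
  \sum_i fine (P [set w | t < `|X i w|]) + (\sum_i \int[P]_w trunc_sq t (X i w)) / r ^+ 2.
Proof.
move=> r0; pose tr (x : R) := x * (`|x| <= t)%R%:R.
have mtr : measurable_fun setT tr.
  apply: measurable_funM => //.
  by have [] := @bmf_bool _ R R (fun x => `|x| <= t) (measurable_le_norm t).
pose X' i w := tr (X i w).
have mX' i : measurable_fun setT (X' i) by exact: measurableT_comp.
have mtrp (A : set R) : measurable A -> measurable (tr @^-1` A).
  by move=> mA; rewrite -[X in measurable X]setTI; exact: mtr.
have indX' : independent P X' by move=> B mB; exact: (indX (fun i => mtrp _ (mB i))).
have symX' i A : measurable A -> P [set w | A (- X' i w)] = P [set w | A (X' i w)].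
  move=> mA; rewrite -(symX i (mtrp _ mA)); congr (P _).
  by apply/seteqP; split => w /=; rewrite /X' /tr normrN mulNr.
have mS : measurable_fun setT (fun w => \sum_i X i w) by exact: measurable_sum.
have mS' : measurable_fun setT (fun w => \sum_i X' i w) by exact: measurable_sum.
have mpre (f : T -> R) (u : R) : measurable_fun setT f -> measurable [set w | u < `|f w|].
  by move=> mf; rewrite -[X in measurable X]setTI; exact: mf _ _ (meas_norm_gt u).
have bgt (f : T -> R) (u : R) : measurable_fun setT f -> bmf (fun w => (u < `|f w|)%R%:R : R).
  by move=> mf; exact: bmf_bool (mpre f u mf).
have bsum : bmf (fun w => \sum_i (t < `|X i w|)%R%:R : R).
  by apply: bmf_sum => i; exact: bgt.
have bsq i : bmf (fun w => trunc_sq t (X i w)) := bmf_comp (bmf_trunc_sq t) (mX i).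
rewrite -Rint_prob; last exact: mpre.
apply: (@le_trans _ _ (\int[P]_w (\sum_i (t < `|X i w|)%R%:R + (r < `|\sum_i X' i w|)%R%:R))).
  apply: Rint_le; [exact: bgt|apply: bmfD => //; exact: bgt|move=> w].
  have [/existsP[i ti]|] := boolP [exists i, t < `|X i w|].
    apply: (@le_trans _ _ 1); first by case: (_ < _).
    by rewrite (bigD1 i)//= ti -!addrA lerDl !addr_ge0// sumr_ge0.
  rewrite negb_exists => /forallP h.
  rewrite (eq_bigr (fun i => X' i w)); first by rewrite lerDr sumr_ge0.
  by move=> i _; rewrite /X' /tr leNgt h mulr1.
rewrite RintD//; last exact: bgt.
rewrite Rint_sum; last by move=> i; exact: bgt.
apply: lerD.
  by apply: ler_sum => i _; rewrite Rint_prob//; exact: mpre.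
have bF : bmf (fun y : R => (r < `|y|)%R%:R : R) by exact: bmf_bool (meas_norm_gt r).
have := @Rint_radm _ _ _ P _ _ mX' indX' symX' _ (fun=> 1) bF (measurable_cst _) (fun _ _ => erefl).
under eq_Rintegral do rewrite mulr1.
move=> ->.
have brad := @bmf_radm _ _ _ _ _ mX' _ (fun=> 1) bF (measurable_cst _) (fun _ _ => erefl).
rewrite -Rint_sum// mulrC -RintZ; last exact: bmf_sum.
apply: Rint_le => //; first by apply: bmfM; [exact: bmf_cst|exact: bmf_sum].
move=> w; apply: (@le_trans _ _ (radm (fun y => 0 + r ^- 2 * y ^+ 2) [seq X' i w * 1 | i <- enum I] 0)).
  apply: radm_le => y; rewrite add0r.
  have [ry|_] := ltP r `|y|; last by rewrite mulr_ge0 ?sqr_ge0// invr_ge0 sqr_ge0.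
  rewrite mulrC ler_pdivlMr ?exprn_gt0// mul1r -[leRHS](ger0_norm (sqr_ge0 _)) normrX.
  by rewrite lerXn2r ?nnegrE ?(ltW r0)// ltW.
rewrite radm_linear radm_cst radm_sqr expr0n/= !add0r big_map big_enum/=.
rewrite ler_wpM2l ?invr_ge0 ?sqr_ge0//; apply: ler_sum => i _.
rewrite mulr1 /X' /tr /trunc_sq exprMn; case: (`|X i w| <= t); first by rewrite expr1n.
by rewrite expr0n mulr0.
Qed.

End truncated_sums.

Section levy_core.
Context {d} {T : measurableType d} {R : realType} (P : probability T R).
Context {n : nat} (X : 'I_n -> T -> R).
Hypothesis mX : forall i, measurable_fun setT (X i).
Hypothesis indX : independent P X.
Hypothesis symX : forall i A, measurable A ->
  P [set w | A (- X i w)] = P [set w | A (X i w)].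
Variables (a b t eta M lam q L p1 : R).
Let G x := fine (P [set w | (\sum_i X i w - b) / a <= x]).

Let S w := \sum_i X i w.

Let mS : measurable_fun setT S. Proof. exact: measurable_sum. Qed.

Let mSi (A : set R) : measurable A -> measurable [set w | A (S w)].
Proof. by move=> mA; rewrite -[X in measurable X]setTI; exact: mS. Qed.

Let mle c : measurable [set w | S w <= c].
Proof.
apply: (mSi (A := [set x | x <= c])).
by rewrite [X in measurable X](_ : _ = `]-oo, c]%classic).
Qed.

Let mlt c : measurable [set w | S w < c].
Proof.
apply: (mSi (A := [set x | x < c])).
by rewrite [X in measurable X](_ : _ = `]-oo, c[%classic).
Qed.

Let mgt c : measurable [set w | c < S w].
Proof.
apply: (mSi (A := [set x | c < x])).
by rewrite [X in measurable X](_ : _ = `]c, +oo[%classic)//; apply/seteqP; split => x /=; rewrite in_itv/= andbT.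
Qed.

Let mnorm c : measurable [set w | c < `|S w|].
Proof.
apply: (mSi (A := [set x | c < `|x|])).
rewrite (_ : [set x : R | c < `|x|] = ~` [set x : R | `|x| <= c]).
  by apply: measurableC; exact: measurable_le_norm.
by apply/seteqP; split => x /=; rewrite ltNge => /negP.
Qed.

Let fine_mono A B : measurable A -> measurable B -> A `<=` B -> fine (P A) <= fine (P B).
Proof.
move=> mA mB AB; apply: fine_le; rewrite ?fin_num_measure//.
by apply: le_measure; rewrite ?inE.
Qed.

Let fine_subadd A B C : measurable A -> measurable B -> measurable C ->
  A `<=` B `|` C -> fine (P A) <= fine (P B) + fine (P C).
Proof.
move=> mA mB mC ABC; rewrite -lee_fin EFinD !fineK ?fin_num_measure//.
apply: le_trans (measureU2 _ mB mC); apply: le_measure; rewrite ?inE//.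
exact: measurableU.
Qed.

(* A heavy tail at level [t] gives [S] more mass beyond [t] than the Gaussian
   tail allows, since [t] is many multiples of the scale [a]. *)
Lemma levy_core : 0 < a -> 0 < t -> 0 < eta -> 2 <= M -> 0 < lam <= 1 ->
  (forall i, fine (P [set w | t < `|X i w|]) = q) ->
  (forall i, \int[P]_w trunc_sq t (X i w) = L) ->
  1 / 2 < G (1 / 2) -> G (- (1 / 2)) < 1 / 2 -> G 2 <= 1 - 3 / 4 * p1 -> 0 < p1 ->
  1 - gtail (M - 1) - lam / 32 <= G (M - 1) ->
  G (- (M - 1)) <= gtail (M - 1) + lam / 32 ->
  2 * gtail (M - 1) <= lam / 8 ->
  lam <= n%:R * q <= 2 * lam -> 2 * lam + 2 * lam * M ^+ 2 / eta <= p1 / 2 ->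
  eta * L < t ^+ 2 * q -> False.
Proof.
move=> a0 t0 eta0 M2 /andP[lam0 lam1] Xq XL G1 G2 G3 p10 G4 G5 gM /andP[nq1 nq2] lamp etaL.
have GE x : G x = fine (P [set w | S w <= b + x * a]).
  rewrite /G; congr (fine (P _)); apply/seteqP; split => w /=;
    by rewrite ler_pdivrMr// lerBlDl.
have [med1 med2] := sum_median mX indX symX.
(* The symmetric sum has median 0, while [G] passes 1/2 between -1/2 and 1/2; this confines the
   unknown centring to [- a <= b <= a]. *)
have ba : - a <= b.
  rewrite leNgt; apply/negP => ba; have : G (1 / 2) <= fine (P [set w | S w < 0]).
    rewrite GE; apply: fine_mono; [exact: mle|exact: mlt|].
    by move=> w /=; lra.
  by rewrite /S; lra.
have ab : b <= a.
  rewrite leNgt; apply/negP => ab; have : fine (P [set w | S w <= 0]) <= G (- (1 / 2)).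
    rewrite GE; apply: fine_mono; [exact: mle|exact: mle|].
    by move=> w /=; lra.
  by rewrite /S; lra.
have fineC c : fine (P [set w | c < S w]) = 1 - fine (P [set w | S w <= c]).
  have -> : [set w | c < S w] = ~` [set w | S w <= c].
    by apply/seteqP; split => w /=; rewrite ltNge => /negP.
  by rewrite probability_setC ?fineB ?fin_num_measure.
have M0 : 0 < M by lra.
(* Otherwise [S > b + 2 * a] implies [S > t / M]. The Gaussian limit gives this event probability at
   least [3 / 4 * p1], but truncation at [t] bounds it by [p1 / 2]. *)
have aM : a <= t / M.
  rewrite leNgt; apply/negP => ta.
  have r0 : 0 < t / M by rewrite divr_gt0.
  have := prob_sum_gt_le mX indX symX t r0.
  rewrite (eq_bigr (fun=> q)) => [|i _]; last exact: Xq.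
  rewrite [X in _ <= _ + X / _](eq_bigr (fun=> L)) => [|i _]; last exact: XL.
  have sumc (c : R) : \sum_(i < n) c = n%:R * c by rewrite sumr_const card_ord mulr_natl.
  rewrite (sumc q) (sumc L) => H.
  have : fine (P [set w | b + 2 * a < S w]) <= fine (P [set w | t / M < `|S w|]).
    apply: fine_mono; [exact: mgt|exact: mnorm|move=> w /= h].
    by apply: lt_le_trans (ler_norm _); lra.
  rewrite fineC -GE.
  have : n%:R * L / (t / M) ^+ 2 <= 2 * lam * M ^+ 2 / eta.
    rewrite ler_pdivrMr ?exprn_gt0// expr_div_n.
    have -> : 2 * lam * M ^+ 2 / eta * (t ^+ 2 / M ^+ 2) = 2 * lam * (t ^+ 2 / eta).
      by field; rewrite !gt_eqF.
    have L' : L <= t ^+ 2 / eta * q.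
      by rewrite mulrAC ler_pdivlMr// mulrC; lra.
    have te : 0 <= t ^+ 2 / eta by rewrite divr_ge0 ?sqr_ge0// ltW.
    apply: (@le_trans _ _ (n%:R * (t ^+ 2 / eta * q))); first by rewrite ler_wpM2l.
    rewrite (_ : n%:R * _ = n%:R * q * (t ^+ 2 / eta)); last by ring.
    by rewrite ler_wpM2r.
  by move: H; rewrite -/(S _); lra.
have Mat : M * a <= t by rewrite mulrC -ler_pdivlMr.
(* Some summand exceeds [t] with probability [1 - (1 - q) ^+ n], at least [lam / 2]; random signs
   keep half of it. *)
have lowE : lam / 4 <= fine (P [set w | t < `|S w|]).
  apply: le_trans (prob_sum_gt_ge mX indX symX t).
  have Pi i : P (X i @^-1` [set x | `|x| <= t]) = (1 - q)%:E.
    have mi : measurable [set w | `|X i w| <= t].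
      by have := mX i measurableT (measurable_le_norm t); rewrite setTI.
    have := Xq i; have -> : [set w | t < `|X i w|] = ~` [set w | `|X i w| <= t].
      by apply/seteqP; split => w /=; rewrite ltNge => /negP.
    rewrite probability_setC// fineB ?fin_num_measure//= => <-.
    by rewrite opprB addrCA subrr addr0 fineK ?fin_num_measure.
  have := indX (fun=> measurable_le_norm t); rewrite /= => ->.
  under eq_bigr do rewrite Pi.
  rewrite prodEFin /= prodr_const card_ord.
  have nq0 : 0 <= n%:R * q by lra.
  suff : (1 - q) ^+ n <= 1 - lam / 2 by lra.
  have [n0|n0] := posnP n; first by move: nq1; rewrite n0 mul0r; lra.
  have q0 : 0 <= 1 - q.
    by rewrite -lee_fin -(Pi (Ordinal n0)) measure_ge0.
  apply: (@le_trans _ _ (expR (- (n%:R * q)))).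
    rewrite -mulrN expRM_natl lerXn2r ?nnegrE ?expR_ge0//.
    exact: expR_ge1Dx.
  apply: (@le_trans _ _ (expR (- lam))); first by rewrite ler_expR lerN2.
  have := expRN_le (ltW lam0); have := expR_ge0 (- lam); nra.
(* As [t >= M * a >= b + (M - 1) * a], the tails of [G] at [M - 1] apply, and [lam / 8 + lam / 16]
   falls short of [lam / 4]. *)
have upE : fine (P [set w | t < `|S w|]) <= lam / 8 + lam / 16.
  apply: (@le_trans _ _ (fine (P [set w | S w <= b + - (M - 1) * a]) +
      fine (P [set w | b + (M - 1) * a < S w]))).
    apply: fine_subadd; [exact: mnorm|exact: mle|exact: mgt|].
    by move=> w /=; rewrite ltr_normr => /orP[h|h]; [right|left] => /=; lra.
  rewrite fineC -!GE; lra.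
lra.
Qed.

End levy_core.

Section law_transfer.
Context {R : realType} {d1 d2} {T1 : measurableType d1} {T2 : measurableType d2}
  {P1 : probability T1 R} {P2 : probability T2 R}.
Variables (X : {RV P1 >-> R}) (Y : {RV P2 >-> R}).
Hypothesis XY : has_law X (distribution P2 Y).

Lemma has_law_prob (A : set R) : measurable A ->
  P1 [set w | A (X w)] = P2 [set w | A (Y w)].
Proof. exact: XY. Qed.

Lemma has_law_Rint (g : R -> R) : bmf g ->
  \int[P1]_w g (X w) = \int[P2]_w g (Y w).
Proof. by move=> bg; apply: Rint_eq_law. Qed.

Lemma has_law_sym (A : set R) : symmetric_law Y -> measurable A ->
  P1 [set w | A (- X w)] = P1 [set w | A (X w)].
Proof.
move=> symY mA.
have mA' : measurable [set x | A (- x)].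
  by rewrite -[X in measurable X]setTI; exact: oppr_measurable.
have -> : P1 [set w | A (X w)] = P2 [set w | A (Y w)] by exact: XY.
have -> : P1 [set w | A (- X w)] = P2 [set w | A (- Y w)] by exact: (XY mA').
exact: symY.
Qed.

End law_transfer.

Section levy_condition.
Context {R : realType} {d} {T : measurableType d} {P : probability T R}
  (Y : {RV P >-> R}).

Lemma measurable_norm_gt (t : R) : measurable [set x : R | t < `|x|].
Proof.
rewrite (_ : [set x : R | t < `|x|] = ~` [set x : R | `|x| <= t]).
  by apply: measurableC; exact: measurable_le_norm.
by apply/seteqP; split => x /=; rewrite ltNge => /negP.
Qed.

Lemma measurable_RV_norm_gt (t : R) : measurable [set w | t < `|Y w|].
Proof.
exact: (measurable_funPTI Y (measurable_norm_gt t)).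
Qed.

Lemma norm_tail_small (e : R) : 0 < e ->
  exists2 t0, 0 < t0 & forall t, t0 <= t -> fine (P [set w | t < `|Y w|]) <= e.
Proof.
move=> e0; have mY : measurable_fun setT (fun w => `|Y w|) by exact: measurableT_comp.
have := cvg_cdfy1 (mfun_of mY : {RV P >-> R}).
move=> /fine_cvg /cvgrPdist_le /(_ e e0) [t1 [_ Ht1]].
exists (Num.max t1 0 + 1) => [|t]; first by rewrite ltr_wpDl// le_max lexx orbT.
have : t1 <= Num.max t1 0 by rewrite le_max lexx.
move=> t1m tm; have t1t : t1 < t by lra.
have := Ht1 _ t1t; rewrite /=.
have mle : measurable [set w | `|Y w| <= t].
  exact: (measurable_funPTI Y (measurable_le_norm t)).
have -> : [set w | t < `|Y w|] = ~` [set w | `|Y w| <= t].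
  by apply/seteqP; split => w /=; rewrite ltNge => /negP.
rewrite probability_setC// fineB ?fin_num_measure//=.
by move=> /(le_trans (ler_norm _)); rewrite /cdf/= /distribution /pushforward/=.
Qed.

(** If the inequality fails at [t], choose [n] close to [lam / q], so that about [lam] summands are
    expected beyond [t]. For large [t] the probability [q] is small, which makes [n] large enough
    for the Gaussian approximation. *)
Lemma levy_condition : in_normal_domain_of_attraction Y -> symmetric_law Y ->
  forall eta, 0 < eta -> exists2 t0, 0 < t0 & forall t, t0 <= t ->
    t ^+ 2 * fine (P [set w | t < `|Y w|]) <= eta * \int[P]_w trunc_sq t (Y w).
Proof.
move=> [d' [T' [P' [xi [a [b [[ind_xi law_xi] a0 cvg_xi]]]]]]] symY eta eta0.
pose p1 := gtail (2 : R).
have p10 : 0 < p1.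
  apply: lt_le_trans (gtail_ge_gauss _) => //.
  by rewrite divr_gt0// mulr_gt0 ?gauss_gt0// mulr_gt0 ?gauss_peak_gt0 ?expR_gt0.
have p11 : p1 <= 1 := gtail_le1 _.
have gB := @gauss_le_inv R; have : 0 <= 5`!%:R * 2 ^+ 5 :> R by rewrite mulr_ge0 ?exprn_ge0.
move: (5`!%:R * 2 ^+ 5) gB => B gB B0.
(* [gtail u] must be small against [lam], which is of order [eta * p1 / u ^+ 2]; cubic decay and
   this size of [u] suffice. *)
pose u := 1 + eta + 2 ^+ 10 * B / (eta * p1).
have ep0 : 0 < eta * p1 by rewrite mulr_gt0.
have uB : 0 <= 2 ^+ 10 * B / (eta * p1).
  by apply: divr_ge0 (ltW ep0); apply: mulr_ge0 B0; exact: exprn_ge0.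
have u1 : 1 <= u by rewrite /u; lra.
have u0 : 0 < u by lra.
have uBe : 2 ^+ 10 * B <= eta * p1 * u.
  by rewrite -ler_pdivrMl// mulrC /u; lra.
have ueta : eta <= u by rewrite /u; lra.
move: u u1 u0 uBe ueta {uB} => u u1 u0 uBe ueta.
pose M := u + 1.
have M2 : 2 <= M by rewrite /M; lra.
have M0 : 0 < M by lra.
have M20 : 0 < M ^+ 2 by exact: exprn_gt0.
have MM2 : M <= M ^+ 2 by rewrite expr2 ler_peMl//; lra.
(* Makes the truncation term [2 * lam * M ^+ 2 / eta] equal to [p1 / 4]. *)
pose lam := eta * p1 / (8 * M ^+ 2).
have M80 : 0 < 8 * M ^+ 2 by apply: mulr_gt0.
have lam0 : 0 < lam by exact: divr_gt0.
have lam8 : lam <= p1 / 8.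
  rewrite /lam ler_pdivrMr//.
  have -> : p1 / 8 * (8 * M ^+ 2) = p1 * M ^+ 2 by field.
  rewrite mulrC ler_pM2l//; apply: le_trans MM2; rewrite /M; lra.
have lam01 : 0 < lam <= 1 by rewrite lam0/=; lra.
have lamp : 2 * lam + 2 * lam * M ^+ 2 / eta <= p1 / 2.
  have -> : 2 * lam * M ^+ 2 / eta = p1 / 4 by rewrite /lam; field; rewrite (gt_eqF eta0) (gt_eqF M0).
  by lra.
have gM : 2 * gtail (M - 1) <= lam / 8.
  rewrite /M addrK.
  have g1 := gtail_le_gauss (ltW u0); have g2 := gB u u0.
  have g3 : B / u ^+ 10 <= B / u ^+ 3.
    by rewrite ler_wpM2l// lef_pV2 ?posrE ?exprn_gt0// ler_weXn2l.
  have g4 : 4 * (B / u ^+ 3) <= lam / 8.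
    rewrite /lam -[leRHS]mulrA -invfM.
    have -> : 4 * (B / u ^+ 3) = 4 * B / u ^+ 3 by rewrite mulrA.
    have M88 : 0 < 8 * M ^+ 2 * 8 by exact: mulr_gt0.
    rewrite ler_pdivrMr ?exprn_gt0// mulrAC ler_pdivlMr//.
    have Mu : M ^+ 2 <= 4 * u ^+ 2.
      have -> : 4 * u ^+ 2 = (2 * u) ^+ 2 by ring.
      by rewrite lerXn2r ?nnegrE ?(ltW M0) ?mulr_ge0 ?(ltW u0)// /M; lra.
    have : 2 ^+ 10 * B * u ^+ 2 <= eta * p1 * u ^+ 3.
      by rewrite (exprS u 2) [leRHS]mulrA ler_wpM2r// sqr_ge0.
    apply: le_trans.
    have B8 : 0 <= 2 ^+ 8 * B by apply: mulr_ge0 B0; exact: exprn_ge0.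
    have -> : 4 * B * (8 * M ^+ 2 * 8) = 2 ^+ 8 * B * M ^+ 2 by ring.
    have -> : 2 ^+ 10 * B * u ^+ 2 = 2 ^+ 8 * B * (4 * u ^+ 2) by ring.
    exact: ler_wpM2l.
  lra.
have uM : u = M - 1 by rewrite /M addrK.
pose G n x := fine (P' [set w | (\sum_(i < n) xi i w - b n) / a n <= x]).
have Gcvg x : G n x @[n --> \oo] --> Phi x.
  have := cvg_xi x; rewrite (_ : [set y : R | y <= x] = `]-oo, x]%classic)//.
  rewrite -[normal_prob 0 1 _]fineK ?fin_num_measure//.
  by move/fine_cvg.
have Phih : Phi (1 / 2) = 1 - Phi (- (1 / 2)) :> R by rewrite PhiN; lra.
have Phihlt : Phi (- (1 / 2)) < Phi (1 / 2) :> R.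
  have [||c _ cE] := @MVT_closed R Phi (fun y => gauss_peak * gauss y) (- (1 / 2)) (1 / 2).
  - lra.
  - by move=> y _; exact: is_derive_Phi.
  rewrite -subr_gt0 cE mulr_gt0 ?mulr_gt0 ?gauss_peak_gt0 ?gauss_gt0//; lra.
have l32 : 0 < lam / 32 by rewrite divr_gt0.
have near_le x e : 0 < e -> \forall n \near \oo, G n x <= Phi x + e.
  move=> e0; have /cvgrPdist_le /(_ _ e0) := Gcvg x.
  by apply: filterS => n; rewrite ler_distlC => /andP[].
have near_ge x e : 0 < e -> \forall n \near \oo, Phi x - e <= G n x.
  move=> e0; have /cvgrPdist_le /(_ _ e0) := Gcvg x.
  by apply: filterS => n; rewrite ler_distlC => /andP[].
have [N _ HN] : \forall n \near \oo, [/\ 1 / 2 < G n (1 / 2), G n (- (1 / 2)) < 1 / 2,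
    G n 2 <= 1 - 3 / 4 * p1, 1 - gtail (M - 1) - lam / 32 <= G n (M - 1) &
    G n (- (M - 1)) <= gtail (M - 1) + lam / 32].
  pose e := (Phi (1 / 2) - 1 / 2) / 2 : R.
  have e0 : 0 < e by rewrite divr_gt0//; lra.
  have p40 : 0 < p1 / 4 by rewrite divr_gt0.
  near=> n; split.
  - apply: (@lt_le_trans _ _ (Phi (1 / 2) - e)); first by rewrite /e; lra.
    by near: n; exact: near_ge.
  - apply: (@le_lt_trans _ _ (Phi (- (1 / 2)) + e)); last by rewrite /e; lra.
    by near: n; exact: near_le.
  - apply: (@le_trans _ _ (Phi 2 + p1 / 4)); last by rewrite /p1 gtailE; lra.
    by near: n; exact: near_le.
  - apply: (@le_trans _ _ (Phi (M - 1) - lam / 32)); first by rewrite gtailE; lra.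
    by near: n; exact: near_ge.
  - apply: (@le_trans _ _ (Phi (- (M - 1)) + lam / 32)); last by [].
    by near: n; exact: near_le.
have lN : 0 < lam / N.+1%:R by rewrite divr_gt0.
have [t0 t00 Ht0] := norm_tail_small lN.
exists t0 => // t tt0; rewrite leNgt; apply/negP => etaL.
have tgt0 : 0 < t := lt_le_trans t00 tt0.
set q := fine (P _) in etaL; set L := \int[P]_w _ in etaL.
have L0 : 0 <= L by apply: Rint_ge0 => w; exact: trunc_sq_ge0.
have q0 : 0 < q.
  have : 0 < t ^+ 2 * q by apply: le_lt_trans etaL; rewrite mulr_ge0// ltW.
  by rewrite pmulr_rgt0// exprn_gt0.
have qlam : q <= lam / N.+1%:R := Ht0 _ tt0.
have qlam1 : q <= lam.
  by apply: (le_trans qlam); rewrite ler_pdivrMr// ler_peMr ?(ltW lam0)// ler1n.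
(* Rounding up gives [lam <= n * q <= lam + q], and [q <= lam]; the choice of [t0] ensures
   [N <= n]. *)
pose n := (Num.truncn (lam / q)).+1.
have lq0 : 0 <= lam / q by rewrite divr_ge0// ltW.
have [n1 n2] : n%:R - 1 <= lam / q /\ lam / q < n%:R.
  have := truncn_itv lq0; rewrite /n => /andP[h1 h2]; split => //.
  by rewrite -natr1 addrK.
have Nn : (N <= n)%N.
  rewrite -(ler_nat R) ltW//; apply: le_lt_trans n2.
  have : N.+1%:R <= lam / q by rewrite ler_pdivlMr// mulrC -ler_pdivlMr.
  by apply: le_trans; rewrite ler_nat.
have [G1 G2 G3 G4 G5] := HN n Nn.
pose X (i : 'I_n) : T' -> R := xi i.
have indX : independent P' X.
  by apply: (@mutually_independent_sub _ _ _ P' _ 'I_n xi (@nat_of_ord n)) => //; exact: val_inj.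
apply: (@levy_core _ _ _ P' n X _ indX _ (a n) (b n) t eta M lam q L p1) => //.
- by move=> i A mA; exact: (has_law_sym (law_xi i) symY mA).
- by move=> i; rewrite /q; congr fine; exact: (has_law_prob (law_xi i) (measurable_norm_gt t)).
- by move=> i; exact: (has_law_Rint (law_xi i) (bmf_trunc_sq t)).
- apply/andP; split.
    by rewrite -ler_pdivrMr// ltW.
  have : (n%:R - 1) * q <= lam by rewrite -ler_pdivlMr.
  lra.
Unshelve. all: by end_near. Qed.

End levy_condition.

(** * Growth of [kappa0] and vanishing of [delta0] *)

Section kappa_delta.
Context {R : realType} {d} {T : measurableType d} {P : probability T R}
  (Y : {RV P >-> R}).
Hypothesis Y_attraction : in_normal_domain_of_attraction Y.
Hypothesis Y_nondegenerate : nondegenerate_law Y.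
Hypothesis Y_symmetric : symmetric_law Y.

Let q (t : R) : R := fine (P [set w | t < `|Y w|]).
Let L t := \int[P]_w trunc_sq t (Y w).
Let C t := \int[P]_w trunc_cube t (Y w).

Let mY : measurable_fun setT Y. Proof. exact: measurable_funPT. Qed.

Let bL t : bmf (fun w => trunc_sq t (Y w)) := bmf_comp (bmf_trunc_sq t) mY.
Let bC t : bmf (fun w => trunc_cube t (Y w)) := bmf_comp (bmf_trunc_cube t) mY.
Let bq (t : R) : bmf (fun w => (t < `|Y w|)%R%:R : R).
Proof. exact: bmf_bool (measurable_RV_norm_gt Y t). Qed.

Let qE t : q t = \int[P]_w (t < `|Y w|)%R%:R.
Proof. by rewrite Rint_prob//; exact: measurable_RV_norm_gt. Qed.

Let q_ge0 t : 0 <= q t. Proof. by rewrite fine_ge0. Qed.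

Let L_ge0 t : 0 <= L t. Proof. by apply: Rint_ge0 => w; exact: trunc_sq_ge0. Qed.

Let L_mono s t : s <= t -> L s <= L t.
Proof.
move=> st; apply: Rint_le => // w; rewrite /trunc_sq ler_wpM2l ?sqr_ge0//.
by have [/le_trans/(_ st)->|_] := leP `|Y w| s.
Qed.

Let q_mono s t : s <= t -> q t <= q s.
Proof.
move=> st; rewrite !qE; apply: Rint_le => // w.
by have [/(le_lt_trans st)->|_] := ltP t `|Y w|.
Qed.

Let q_small (e : R) : 0 < e -> exists2 t0, 0 < t0 & forall t, t0 <= t -> q t <= e.
Proof. exact: norm_tail_small. Qed.

Let levy (eta : R) : 0 < eta ->
  exists2 t0, 0 < t0 & forall t, t0 <= t -> t ^+ 2 * q t <= eta * L t.
Proof. exact: levy_condition. Qed.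

(** If [L] vanished at all large levels, [levy] would make [q] vanish there too, and [Y] would be 0
    almost surely, against nondegeneracy. *)
Let L_gt0 : exists2 s0, 0 < s0 & forall s, s0 <= s -> 0 < L s.
Proof.
have [t0 t00 Ht] := levy ltr01.
suff [s0 ts0 Ls0] : exists2 s0, t0 <= s0 & 0 < L s0.
  exists s0; first exact: lt_le_trans ts0.
  by move=> s /L_mono; apply: lt_le_trans.
apply: contrapT => nL; apply: Y_nondegenerate; exists 0.
have {nL}L0 t : t0 <= t -> L t = 0.
  move=> tt0; apply/eqP; rewrite eq_le L_ge0 andbT leNgt; apply/negP => Lt.
  by apply: nL; exists t.
have q0 e : 0 < e -> q e = 0.
  move=> e0; apply/eqP; rewrite eq_le q_ge0 andbT.
  pose t := Num.max t0 e; have tt0 : t0 <= t by rewrite le_max lexx.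
  have qt : q t = 0.
    have := Ht t tt0; rewrite (L0 t tt0) mulr0 => h.
    apply/eqP; rewrite eq_le q_ge0 andbT; move: h.
    by rewrite pmulr_rle0// exprn_gt0// (lt_le_trans t00).
  have : e ^+ 2 * q e <= \int[P]_w (trunc_sq t (Y w) + e ^+ 2 * (t < `|Y w|)%R%:R).
    rewrite qE -RintZ//; apply: Rint_le.
    - exact: bmfM (bmf_cst _) (bq e).
    - by apply: bmfD => //; exact: bmfM (bmf_cst _) (bq t).
    move=> w; rewrite /trunc_sq; have [eY|_] := ltP e `|Y w|; last first.
      by rewrite mulr0 addr_ge0// mulr_ge0 ?sqr_ge0.
    have [_|_] := leP `|Y w| t; last by rewrite !mulr1 mulr0 add0r.
    rewrite !mulr1 mulr0 addr0 -[leRHS](ger0_norm (sqr_ge0 _)) normrX.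
    by rewrite lerXn2r ?nnegrE ?(ltW e0)// ltW.
  rewrite RintD//; last exact: bmfM (bmf_cst _) (bq t).
  rewrite RintZ// -qE qt mulr0 addr0 -/(L t) (L0 t tt0).
  by rewrite pmulr_rle0// exprn_gt0.
have neg : P.-negligible (\bigcup_k [set w | k.+1%:R^-1 < `|Y w|]).
  apply: negligible_bigcup => k; apply/negligibleP; first exact: measurable_RV_norm_gt.
  have := q0 k.+1%:R^-1; rewrite invr_gt0 ltr0n => /(_ isT) qk.
  by rewrite -[LHS]fineK ?fin_num_measure -/(q _) ?qk//; exact: measurable_RV_norm_gt.
have m0 : measurable [set w | Y w = 0].
  by have := measurable_funPTI Y (measurable_set1 (0 : R)).
have : P (~` [set w | Y w = 0]) = 0%E.
  apply/eqP; rewrite eq_le measure_ge0 andbT.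
  have [B [mB PB subB]] := neg.
  apply: (@le_trans _ _ (P B)); last by rewrite PB.
  apply: le_measure; rewrite ?inE//; first exact: measurableC.
  move=> w /= Yw; apply: subB.
  have Y0 : 0 < `|Y w| by rewrite normr_gt0; exact/eqP.
  have [k] := ltr_add_invr Y0; rewrite add0r => kY.
  by exists k.
rewrite probability_setC//.
have : P [set w | Y w = 0] \is a fin_num by exact: fin_num_measure.
rewrite -[distribution P Y [set 0]]/(P [set w | Y w = 0]).
case: (P _) => // r _; rewrite -EFinB => -[] h; congr (_%:E); lra.
Qed.

Let k n := kappa0 Y n.

Let kappa_set n := [set s : R | 0 < s /\ 1 <= n%:R * s ^- 2 * L s].

Let kE n : k n = sup (kappa_set n).
Proof.
rewrite /k /kappa0; congr sup; apply/seteqP; split => s /=;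
  by rewrite fine_expectation.
Qed.

Let in_kappa_set n s : kappa_set n s <-> 0 < s /\ s ^+ 2 <= n%:R * L s.
Proof.
split=> -[s0 h]; split=> //; move: h;
  by rewrite mulrAC ler_pdivlMr ?exprn_gt0// mul1r.
Qed.

(** With [q A <= 1 / (2 * n.+1)], members beyond [A] satisfy [s ^+ 2 <= n * A ^+ 2 + s ^+ 2 / 2].
    The successor covers [n = 0]. *)
Let kappa_set_ub n : has_ubound (kappa_set n).
Proof.
have n10 : 0 < (2 * n.+1%:R)^-1 :> R by rewrite invr_gt0 mulr_gt0.
have [A A0 HA] := q_small n10.
exists (2 * n.+1%:R * A ^+ 2 + A + 1) => s /in_kappa_set[s0 sn].
have N0 : 0 <= n%:R :> R by [].
have [sA|As] := leP s A; first by apply: (le_trans sA); have := mulr_ge0 (mulr_ge0 (ler0n R 2) (ler0n R n.+1)) (sqr_ge0 A); lra.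
have LA : L s <= A ^+ 2 + s ^+ 2 * q A.
  rewrite qE -RintZ// -[X in X + _](Rint_cst P) -RintD; [|exact: bmf_cst|exact: bmfM (bmf_cst _) (bq A)].
  apply: Rint_le => //; first by apply: bmfD; [exact: bmf_cst|exact: bmfM (bmf_cst _) (bq A)].
  move=> w; rewrite /trunc_sq; have [Ys|_] := leP `|Y w| s; last first.
    by rewrite mulr0 addr_ge0 ?sqr_ge0// mulr_ge0 ?sqr_ge0.
  rewrite mulr1 -[leLHS](ger0_norm (sqr_ge0 _)) normrX.
  have [_|YA] := ltP A `|Y w|.
    by rewrite mulr1 ler_wpDl ?sqr_ge0// lerXn2r// nnegrE ltW.
  by rewrite mulr0 addr0 lerXn2r// nnegrE ltW.
have qA := HA A (lexx _).
have : n%:R * (s ^+ 2 * q A) <= s ^+ 2 / 2.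
  have -> : s ^+ 2 / 2 = n.+1%:R * (s ^+ 2 * (2 * n.+1%:R)^-1).
    by field; rewrite -natr1 in n10 *; rewrite gt_eqF//; lra.
  apply: ler_pM => //; [by rewrite mulr_ge0 ?sqr_ge0|by rewrite ler_nat|].
  by rewrite ler_wpM2l ?sqr_ge0.
have nA : n%:R * A ^+ 2 <= n.+1%:R * A ^+ 2 by rewrite ler_wpM2r ?sqr_ge0// ler_nat.
have := ler_wpM2l N0 LA; rewrite mulrDr.
have : s <= s ^+ 2 + 1 by have := sqr_ge0 (s - 1); rewrite sqrrB; have := sqr_ge0 s; nra.
lra.
Qed.

Let kappa_cvgy A : \forall n \near \oo, A <= k n.
Proof.
have [s0 s00 Hs] := L_gt0.
pose B := Num.max A s0; have sB : s0 <= B by rewrite le_max lexx orbT.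
have B0 : 0 < B := lt_le_trans s00 sB.
have LB := Hs B sB.
exists (Num.truncn (B ^+ 2 / L B)).+1 => // n /= nB.
apply: (@le_trans _ _ B); first by rewrite le_max lexx.
rewrite kE; apply: ub_le_sup; first exact: kappa_set_ub.
apply/in_kappa_set; split => //; rewrite -ler_pdivrMr//.
have h : 0 <= B ^+ 2 / L B by rewrite divr_ge0 ?sqr_ge0// ltW.
have := truncn_itv h => /andP[_ /ltW/le_trans]; apply.
by rewrite ler_nat.
Qed.

(** The inequality passes to the supremum by monotonicity of [L]: if it failed, a member [s] between
    [r] and [k n] would have [s ^+ 2 <= n * L (k n) = r ^+ 2]. *)
Let kappa_sq_le n : 0 < k n -> k n ^+ 2 <= n%:R * L (k n).
Proof.
move=> k0; rewrite leNgt; apply/negP => h.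
have nL0 : 0 <= n%:R * L (k n) by rewrite mulr_ge0.
pose r := Num.sqrt (n%:R * L (k n)).
have rk : r < k n.
  by rewrite -[ltRHS](ger0_norm (ltW k0)) -sqrtr_sqr ltr_sqrt// exprn_gt0.
have hs : has_sup (kappa_set n).
  split; last exact: kappa_set_ub.
  apply/set0P/eqP => e0; move: k0; rewrite kE e0 sup0 ltxx//.
have [] := @sup_adherent R (kappa_set n) (k n - r) _ hs; first by rewrite subr_gt0.
move=> s sS; rewrite -kE opprB addrCA subrr addr0 => rs.
have sk : s <= k n by rewrite kE; apply: ub_le_sup => //; exact: kappa_set_ub.
move: sS => /in_kappa_set[s0 sL].
have r0 : 0 <= r := sqrtr_ge0 _.
have : s ^+ 2 <= r ^+ 2.
  by rewrite /r sqr_sqrtr//; apply: le_trans sL _; rewrite ler_wpM2l// L_mono.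
rewrite leNgt => /negP; apply; rewrite ltrXn2r ?nnegrE//; exact: ltW.
Qed.

(** [2 * k n] lies beyond the supremum and so violates the defining inequality; the factor 4 stands
    in for continuity of [L]. *)
Let kappa_sq_ge n : 0 < k n -> n%:R * L (k n) <= 4 * k n ^+ 2.
Proof.
move=> k0; have k20 : 0 < 2 * k n by rewrite mulr_gt0.
apply: (@le_trans _ _ (n%:R * L (2 * k n))).
  by rewrite ler_wpM2l// L_mono//; lra.
have -> : 4 * k n ^+ 2 = (2 * k n) ^+ 2 by ring.
rewrite leNgt; apply/negP => h.
have : 2 * k n <= k n.
  by rewrite [leRHS]kE; apply: ub_le_sup; [exact: kappa_set_ub|apply/in_kappa_set; split=> //; exact: ltW].
lra.
Qed.

(** Symmetry removes the middle term of [delta0]. *)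
Let trunc_mean0 (s : R) : fine 'E_P[fun w => Y w * (`|Y w| <= s)%R%:R] = 0.
Proof.
pose tr (x : R) := x * (`|x| <= s)%R%:R.
have btr : bmf tr.
  by apply: bmf_trunc => //; exists s.
rewrite fine_expectation.
have : \int[P]_w tr (- Y w) = \int[P]_w tr (Y w).
  apply: Rint_eq_law => //; first exact: measurableT_comp.
have -> : \int[P]_w tr (- Y w) = \int[P]_w (-1 * tr (Y w)).
  by apply: eq_Rintegral => w _; rewrite /tr normrN !mulNr mul1r.
have bt : bmf (fun w => tr (Y w)) := bmf_comp btr mY.
rewrite RintZ// => h; rewrite -[LHS]/(\int[P]_w tr (Y w)); lra.
Qed.

Lemma delta0E n : delta0 Y n =
  n%:R * q (k n) + n%:R * k n ^- 3 * \int[P]_w trunc_cube (k n) (Y w).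
Proof.
by rewrite /delta0 trunc_mean0 normr0 mulr0 addr0 fine_expectation.
Qed.

Let delta_le n eps eta : 0 < eps <= 1 -> 0 < eta -> 0 < k n ->
  (eps * k n) ^+ 2 * q (eps * k n) <= eta * L (eps * k n) ->
  delta0 Y n <= 4 * eps + 8 * (eta / eps ^+ 2).
Proof.
move=> /andP[e0 e1] eta0 k0 lev; rewrite delta0E.
have ek : eps * k n <= k n by rewrite ler_piMl// ltW.
have ek0 : 0 < eps * k n by rewrite mulr_gt0.
have N0 : 0 <= n%:R :> R by [].
have k20 : 0 < k n ^+ 2 by rewrite exprn_gt0.
have e20 : 0 < eps ^+ 2 by rewrite exprn_gt0.
have nq : n%:R * q (eps * k n) <= 4 * (eta / eps ^+ 2).
  have h1 : k n ^+ 2 * (eps ^+ 2 * q (eps * k n)) <= eta * L (k n).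
    have -> : k n ^+ 2 * (eps ^+ 2 * q (eps * k n)) = (eps * k n) ^+ 2 * q (eps * k n) by ring.
    apply: le_trans lev _.
    by rewrite ler_wpM2l ?(ltW eta0)// L_mono.
  have h2 := kappa_sq_ge k0.
  rewrite mulrA ler_pdivlMr// -(ler_pM2l k20).
  apply: (@le_trans _ _ (n%:R * (eta * L (k n)))).
    rewrite (_ : k n ^+ 2 * _ = n%:R * (k n ^+ 2 * (eps ^+ 2 * q (eps * k n)))); last by ring.
    exact: ler_wpM2l.
  have := ler_wpM2l (ltW eta0) h2; lra.
have nqk : n%:R * q (k n) <= 4 * (eta / eps ^+ 2).
  by apply: le_trans nq; rewrite ler_wpM2l// q_mono.
have cubeE : C (k n) <= eps * k n * L (k n) + k n ^+ 3 * q (eps * k n).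
  rewrite qE -!RintZ// -RintD; [|exact: bmfM (bmf_cst _) (bL _)|exact: bmfM (bmf_cst _) (bq _)].
  apply: Rint_le => //.
    by apply: bmfD; [exact: bmfM (bmf_cst _) (bL _)|exact: bmfM (bmf_cst _) (bq _)].
  move=> w; rewrite /trunc_cube /trunc_sq; have [Yk|_] := leP `|Y w| (k n); last first.
    by rewrite !mulr0 add0r mulr_ge0// exprn_ge0// ltW.
  rewrite !mulr1; have Y0 : 0 <= `|Y w| by [].
  have [_|Ye] := ltP (eps * k n) `|Y w|.
    rewrite mulr1; apply: (@le_trans _ _ (k n ^+ 3)).
      by rewrite lerXn2r ?nnegrE ?(ltW k0).
    by rewrite lerDr mulr_ge0 ?sqr_ge0 ?(ltW ek0).
  by rewrite mulr0 addr0 exprS -(normrX 2) (ger0_norm (sqr_ge0 _)) ler_wpM2r ?sqr_ge0.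
have k30 : 0 < k n ^+ 3 by rewrite exprn_gt0.
have : n%:R * k n ^- 3 * C (k n) <= 4 * eps + n%:R * q (eps * k n).
  rewrite mulrAC ler_pdivrMr//.
  apply: (le_trans (ler_wpM2l N0 cubeE)).
  have -> : n%:R * (eps * k n * L (k n) + k n ^+ 3 * q (eps * k n)) =
    eps * k n * (n%:R * L (k n)) + n%:R * q (eps * k n) * k n ^+ 3 by ring.
  rewrite mulrDl lerD2r.
  have := ler_wpM2l (ltW ek0) (kappa_sq_ge k0).
  by move/le_trans; apply; rewrite le_eqVlt; apply/orP; left; apply/eqP; ring.
rewrite /C; lra.
Qed.

Lemma delta0_near e : 0 < e -> \forall n \near \oo, [/\ 0 < kappa0 Y n,
   0 < delta0 Y n <= e & kappa0 Y n ^+ 2 <= n%:R * \int[P]_w trunc_sq (kappa0 Y n) (Y w)].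
Proof.
move=> e0; pose eps := Num.min 1 (e / 12).
have eps0 : 0 < eps by rewrite lt_min ltr01 divr_gt0.
have eps1 : eps <= 1 by rewrite ge_min lexx.
have epse : 12 * eps <= e by rewrite mulrC -ler_pdivlMr// ge_min lexx orbT.
(* With [eta = eps ^+ 3] the bound of [delta_le] becomes [12 * eps]. *)
have eta0 : 0 < eps ^+ 3 by rewrite exprn_gt0.
have [t0 t00 Ht] := levy eta0.
near=> n.
have tk : t0 / eps <= k n by near: n; exact: kappa_cvgy.
have k0 : 0 < k n by apply: lt_le_trans tk; rewrite divr_gt0.
have te : t0 <= eps * k n by rewrite mulrC -ler_pdivrMr.
have ksq := kappa_sq_le k0.
split => //; apply/andP; split; last first.
  apply: (le_trans (delta_le _ eta0 k0 (Ht _ te))); first by rewrite eps0.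
  rewrite (_ : eps ^+ 3 / eps ^+ 2 = eps); last by field; rewrite gt_eqF.
  lra.
have k30 : 0 < k n ^+ 3 by rewrite exprn_gt0.
have n0 : 0 < n%:R :> R.
  rewrite lt_neqAle eq_sym ler0n andbT; apply/eqP => n0.
  by move: ksq; rewrite n0 mul0r leNgt exprn_gt0.
rewrite delta0E ltr_wpDl ?mulr_ge0// mulr_gt0// ?mulr_gt0 ?invr_gt0//.
rewrite lt_neqAle eq_sym Rint_ge0 ?andbT; last by move=> w; exact: trunc_cube_ge0.
(* [delta0] must be positive for its negative powers to be meaningful. A zero cubic moment would
   force [L (k n) = 0], since the square is at most [u ^+ 2] plus the cube divided by [u], for every
   [u > 0]. *)
apply/eqP => C0.
have L0 : 0 < L (k n).
  by rewrite -(pmulr_rgt0 _ n0); apply: lt_le_trans ksq; rewrite exprn_gt0.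
have Lu u : 0 < u -> L (k n) <= u ^+ 2 + u^-1 * C (k n).
  move=> u0; rewrite -RintZ// -[X in X + _](Rint_cst P) -RintD; [|exact: bmf_cst|exact: bmfM (bmf_cst _) (bC _)].
  apply: Rint_le => //; first by apply: bmfD; [exact: bmf_cst|exact: bmfM (bmf_cst _) (bC _)].
  move=> w; rewrite /trunc_sq /trunc_cube; have [_|_] := leP `|Y w| (k n); last first.
    by rewrite !mulr0 addr0 sqr_ge0.
  rewrite !mulr1 -[leLHS](ger0_norm (sqr_ge0 _)) normrX.
  have [Yu|uY] := leP `|Y w| u.
    rewrite ler_wpDr ?mulr_ge0 ?invr_ge0 ?(ltW u0) ?exprn_ge0//.
    by rewrite lerXn2r ?nnegrE// ltW.
  rewrite ler_wpDl ?sqr_ge0// (exprS `|Y w| 2) mulrA ler_peMl ?sqr_ge0//.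
  by rewrite mulrC ler_pdivlMr// mul1r ltW.
have u0 : 0 < Num.sqrt (L (k n) / 2) by rewrite sqrtr_gt0 divr_gt0.
have := Lu _ u0; rewrite /C C0 mulr0 addr0 sqr_sqrtr ?divr_ge0 ?(ltW L0)//; lra.
Unshelve. all: by end_near. Qed.

End kappa_delta.

(** * Hyperrectangle probabilities *)

Section product_comparison.
Context {R : realType} {I : finType}.
Implicit Types a b : I -> R.

Lemma prod_sub_le a b : (forall i, 0 <= a i <= 1) -> (forall i, 0 <= b i <= 1) ->
  `|\prod_i a i - \prod_i b i| <= \sum_i `|a i - b i|.
Proof.
move=> a01 b01.
suff [_ _] : [/\ 0 <= \prod_i a i <= 1, 0 <= \prod_i b i <= 1 &
    `|\prod_i a i - \prod_i b i| <= \sum_i `|a i - b i|] by [].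
apply: (big_ind3 (fun x y z : R => [/\ 0 <= x <= 1, 0 <= y <= 1 & `|x - y| <= z])).
- by rewrite subrr normr0 lexx ler01.
- move=> x x' z y y' z' [/andP[x0 x1] /andP[x'0 x'1] xx'] [/andP[y0 y1] /andP[y'0 y'1] yy'].
  rewrite !mulr_ge0//= !mulr_ile1//; split => //.
  rewrite (_ : x * y - x' * y' = (x - x') * y + x' * (y - y')); last by ring.
  apply: (le_trans (ler_normD _ _)); rewrite !normrM (ger0_norm y0) (ger0_norm x'0).
  by apply: lerD; [apply: le_trans xx'; rewrite ler_piMr|apply: le_trans yy'; rewrite ler_piMl].
- by move=> i _; rewrite a01 b01.
Qed.

Lemma prod_le_expRN a : (forall i, 0 <= a i) ->
  \prod_i a i <= expR (- \sum_i (1 - a i)).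
Proof.
move=> a0; rewrite -sumrN expR_sum; apply: ler_prod => i _; rewrite a0/=.
by have := @expR_ge1Dx R (- (1 - a i)); lra.
Qed.

(* When the total exit mass [s] is small the products are compared term by
   term; when it is large both products are exponentially small in [s]. *)
Lemma prod_tail_compare a b (eta : R) : 0 < eta <= 1 / 2 ->
  (forall i, 0 <= a i <= 1) -> (forall i, 0 <= b i <= 1) -> (0 < #|I|)%N ->
  (forall i, `|a i - b i| <= eta * (1 - b i + #|I|%:R^-1)) ->
  `|\prod_i a i - \prod_i b i| <= 6 * Num.sqrt eta.
Proof.
move=> /andP[eta0 eta2] a01 b01 I0 ab; pose s := \sum_i (1 - b i).
have s0 : 0 <= s by apply: sumr_ge0 => i _; rewrite subr_ge0; case/andP: (b01 i).
have sum_ab : \sum_i `|a i - b i| <= eta * s + eta.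
  apply: (@le_trans _ _ (\sum_i (eta * (1 - b i) + eta * #|I|%:R^-1))).
    by apply: ler_sum => i _; rewrite -mulrDr.
  rewrite big_split/= -mulr_sumr lerD2l sumr_const -mulrnAr -[_^-1 *+ _]mulr_natr.
  by rewrite mulVf ?mulr1// pnatr_eq0 -lt0n.
set r := Num.sqrt eta; have r0 : 0 < r by rewrite sqrtr_gt0.
have rE : eta = r ^+ 2 by rewrite sqr_sqrtr// ltW.
have r1 : r <= 1 by rewrite /r -[leRHS]sqrtr1 ler_wsqrtr//; lra.
(* Below the threshold, [eta * s + eta] is at most [2 * r]. Above it, the products are at most
   [2 * expR (- (s / 2))] and [expR (- (s / 2))], and this exponential is at most [2 * r]: three
   times two gives 6. *)
have [sr|rs] := leP (s * r) 1.
  apply: (le_trans (prod_sub_le a01 b01)); apply: (le_trans sum_ab).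
  rewrite rE; nra.
have aE : \prod_i a i <= expR (eta * s + eta - s).
  apply: (le_trans (@prod_le_expRN a _)); first by move=> i; case/andP: (a01 i).
  rewrite ler_expR; have -> : \sum_i (1 - a i) = s - \sum_i (a i - b i).
    by rewrite /s -sumrB; apply: eq_bigr => i _; ring.
  have : \sum_i (a i - b i) <= \sum_i `|a i - b i| by apply: ler_sum => i _; exact: ler_norm.
  lra.
have bE : \prod_i b i <= expR (- s).
  by apply: prod_le_expRN => i; case/andP: (b01 i).
have a0 : 0 <= \prod_i a i by apply: prodr_ge0 => i _; case/andP: (a01 i).
have b0 : 0 <= \prod_i b i by apply: prodr_ge0 => i _; case/andP: (b01 i).
have sgt0 : 0 < s by nra.
have es : expR (- (s / 2)) * (s / 2) <= 1.
  apply: le_trans (expRN_le (ltW (divr_gt0 sgt0 (ltr0n R 2)))).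
  by rewrite ler_wpM2l ?expR_ge0//; lra.
have e1 : expR (eta * s + eta - s) <= 2 * expR (- (s / 2)).
  apply: (@le_trans _ _ (expR (1 / 2 + - (s / 2)))); first by rewrite ler_expR; nra.
  rewrite expRD ler_wpM2r ?expR_ge0//.
  have : expR (1 / 2) * (1 - 1 / 2) <= 1 :> R.
    apply: (@le_trans _ _ (expR (1 / 2) * expR (- (1 / 2)))).
      by rewrite ler_wpM2l ?expR_ge0//; have := @expR_ge1Dx R (- (1 / 2)); lra.
    by rewrite -expRD subrr expR0.
  lra.
have e2 : expR (- s) <= expR (- (s / 2)) by rewrite ler_expR; lra.
have : expR (- (s / 2)) <= 2 * r.
  have : 0 <= expR (- (s / 2)) :> R by exact: expR_ge0.
  by move: (expR (- (s / 2))) es => e; nra.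
by move=> er; apply: (le_trans (ler_normB _ _)); rewrite !ger0_norm//; lra.
Qed.

End product_comparison.

(** * Interval probabilities with possibly infinite endpoints *)

Section extended_tails.
Context {R : realType}.
Implicit Types (a b : \bar R) (x : R).

Lemma measurable_ge_ext a : measurable [set x : R | (a <= x%:E)%E].
Proof.
have := @EFin_measurable R setT measurableT `[a, +oo[%classic (emeasurable_itv _).
rewrite setTI [X in measurable X -> _](_ : _ = [set x : R | (a <= x%:E)%E])//.
by apply/seteqP; split => x /=; rewrite in_itv/= andbT.
Qed.

Lemma measurable_le_ext b : measurable [set x : R | (x%:E <= b)%E].
Proof.
have := @EFin_measurable R setT measurableT `]-oo, b]%classic (emeasurable_itv _).
by rewrite setTI [X in measurable X -> _](_ : _ = [set x : R | (x%:E <= b)%E]).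
Qed.

Lemma measurable_lt_ext a : measurable [set x : R | (x%:E < a)%E].
Proof.
rewrite [X in measurable X](_ : _ = ~` [set x : R | (a <= x%:E)%E]).
  by apply: measurableC; exact: measurable_ge_ext.
by apply/seteqP; split => x /=; [move/lt_geF->|move/negP; rewrite -ltNge].
Qed.

Lemma measurable_gt_ext b : measurable [set x : R | (b < x%:E)%E].
Proof.
rewrite [X in measurable X](_ : _ = ~` [set x : R | (x%:E <= b)%E]).
  by apply: measurableC; exact: measurable_le_ext.
by apply/seteqP; split => x /=; [move/lt_geF->|move/negP; rewrite -ltNge].
Qed.

Definition gtail_ext b : R :=
  match b with x%:E => gtail x | +oo%E => 0 | -oo%E => 1 end.

Section one_variable.
Context {d} {T : measurableType d} (P : probability T R) (S : T -> R).
Hypothesis mS : measurable_fun setT S.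

Let mpre (A : set R) : measurable A -> measurable [set w | A (S w)].
Proof. by move=> mA; rewrite -[X in measurable X]setTI; exact: mS. Qed.

Lemma prob_interval a b : (a <= b)%E ->
  fine (P [set w | (a <= (S w)%:E <= b)%E]) =
  1 - (fine (P [set w | ((S w)%:E < a)%E]) + fine (P [set w | (b < (S w)%:E)%E])).
Proof.
move=> ab.
have ma := mpre (measurable_lt_ext a); have mb := mpre (measurable_gt_ext b).
have mab : measurable [set w | (a <= (S w)%:E <= b)%E].
  rewrite [X in measurable X](_ : _ = [set w | (a <= (S w)%:E)%E] `&` [set w | ((S w)%:E <= b)%E]).
    exact: measurableI (mpre (measurable_ge_ext a)) (mpre (measurable_le_ext b)).
  by apply/seteqP; split => w /=; [case/andP|move=> [-> ->]].
apply/eqP; rewrite -subr_eq opprK; apply/eqP.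
rewrite -!Rint_prob// -!RintD; try exact: bmf_bool.
- rewrite -[RHS](Rint_cst P); apply: eq_Rintegral => w _.
  have [aw|wa] := leP a (S w)%:E; have [wb|bw] := leP (S w)%:E b => /=; rewrite ?addr0 ?add0r//.
  by have := lt_trans (lt_le_trans wa ab) bw; rewrite ltxx.
- by apply: bmfD; exact: bmf_bool.
Qed.

Lemma prob_gtE x : fine (P [set w | x < S w]) = 1 - fine (P [set w | S w <= x]).
Proof.
have mx : measurable [set w | x < S w] := mpre (measurable_gt_ext x%:E).
have mx' : measurable [set w | S w <= x] := mpre (measurable_le_ext x%:E).
apply/eqP; rewrite -subr_eq opprK; apply/eqP.
rewrite -!Rint_prob// -RintD; try exact: bmf_bool.
by rewrite -[RHS](Rint_cst P); apply: eq_Rintegral => w _; case: leP; rewrite ?addr0 ?add0r.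
Qed.

End one_variable.

Lemma normal_lt a :
  fine (normal_prob 0 1 [set x : R | (x%:E < a)%E]) = gtail_ext (- a)%E.
Proof.
case: a => [x||].
- rewrite /= /gtail opprK /Phi; congr fine.
  have N0 : normal_prob 0 1 [set x] = 0%E.
    have /null_content_dominatesP := @normal_prob_dominates R 0 1.
    by apply; [exact: measurable_set1|exact: lebesgue_measure_set1].
  rewrite -(setUitv1 true (a := -oo%O))// measureU0//.
- rewrite [X in normal_prob _ _ X](_ : _ = setT); last by apply/seteqP; split => y //= _; exact: ltry.
  by rewrite probability_setT.
- by rewrite [X in normal_prob _ _ X](_ : _ = set0) ?measure0//; apply/seteqP; split.
Qed.

Lemma normal_gt b :
  fine (normal_prob 0 1 [set x : R | (b < x%:E)%E]) = gtail_ext b.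
Proof.
case: b => [x||].
- rewrite /= gtailE -(@prob_gtE _ (measurableTypeR R) (normal_prob 0 1) idfun)//; exact: measurable_id.
- by rewrite [X in normal_prob _ _ X](_ : _ = set0) ?measure0//; apply/seteqP; split.
- rewrite [X in normal_prob _ _ X](_ : _ = setT); last by apply/seteqP; split => y //= _; exact: ltNyr.
  by rewrite probability_setT.
Qed.

Section symmetric_tails.
Context {d} {T : measurableType d} (P : probability T R) (S : T -> R).
Hypothesis mS : measurable_fun setT S.
Variables (eta q : R).
Hypothesis eta0 : 0 <= eta.
Hypothesis q0 : 0 <= q.
Hypothesis S_sym : forall A, measurable A ->
  P [set w | A (- S w)] = P [set w | A (S w)].
Hypothesis tail_gt : forall x, 0 <= x ->
  `|fine (P [set w | x < S w]) - gtail x| <= eta * (gtail x + q).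
Hypothesis tail_ge : forall x, 0 <= x ->
  `|fine (P [set w | x <= S w]) - gtail x| <= eta * (gtail x + q).

(** A negative threshold is reflected, [P(S > x) = 1 - P(S >= - x)], which exchanges strict and weak
    inequalities; this is why both tail hypotheses are present. *)
Let tail_ext b :
  `|fine (P [set w | (b < (S w)%:E)%E]) - gtail_ext b| <= eta * (gtail_ext b + q).
Proof.
case: b => [x||] /=; last 2 first.
- rewrite [X in P X](_ : _ = set0); last by apply/seteqP; split => w.
  by rewrite measure0 subrr normr0 add0r mulr_ge0.
- rewrite [X in P X](_ : _ = setT); last by apply/seteqP; split => w //= _; exact: ltNyr.
  by rewrite probability_setT subrr normr0 mulr_ge0// addr_ge0.
have [x0|x0] := leP 0 x; first by rewrite (_ : [set w | _] = [set w | x < S w])// tail_gt.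
have x0' : 0 <= - x by lra.
rewrite [X in P X](_ : _ = [set w | x < S w])// (prob_gtE _ mS).
rewrite -(S_sym (measurable_le_ext x%:E)) (_ : [set w | _] = [set w | - x <= S w]); last first.
  by apply/seteqP; split => w /=; rewrite lee_fin lerNl.
have := tail_ge x0'; rewrite {1}/gtail opprK => h.
have gx : gtail (- x) <= gtail x by apply: gtail_nhomo; lra.
rewrite gtailE distrC (_ : _ - _ = fine (P [set w | - x <= S w]) - Phi x); last by ring.
apply: (le_trans h); rewrite ler_wpM2l// lerD2r -gtailE//.
Qed.

(** The exit probability is a sum of two one-sided tails, each with its own allowance [q]; hence the
    factor 2. *)
Lemma interval_tail_compare a b : (a <= b)%E ->
  let g := fine (normal_prob 0 1 [set x : R | (a <= x%:E <= b)%E]) in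
  `|fine (P [set w | (a <= (S w)%:E <= b)%E]) - g| <= 2 * eta * (1 - g + q).
Proof.
move=> ab /=; rewrite (prob_interval _ mS)//.
have -> : fine (normal_prob 0 1 [set x : R | (a <= x%:E <= b)%E]) =
    1 - (gtail_ext (- a)%E + gtail_ext b).
  rewrite (@prob_interval _ (measurableTypeR R) (normal_prob 0 1) idfun)//; last exact: measurable_id.
  by rewrite normal_lt normal_gt.
have g0 c : 0 <= eta * gtail_ext c.
  by apply: mulr_ge0 => //; case: c => //= x; exact: gtail_ge0.
have ga := g0 (- a)%E; have gb := g0 b.
have := tail_ext b; have := tail_ext (- a)%E.
rewrite (_ : [set w | (- a < (S w)%:E)%E] = [set w | ((- S w)%:E < a)%E]); last first.
  by apply/seteqP; split => w /=; rewrite EFinN lteNl.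
rewrite (S_sym (measurable_lt_ext a)).
set x := fine _; set y := fine _; rewrite !ler_norml => /andP[h1 h2] /andP[h3 h4].
by apply/andP; split; lra.
Qed.

End symmetric_tails.
End extended_tails.

Lemma moderate_const_gt0 {R : realType} : 0 < moderate_const :> R.
Proof.
rewrite /moderate_const; have : 0 <= 5`!%:R * 2 ^+ 5 :> R by rewrite mulr_ge0 ?exprn_ge0.
move: (5`!%:R * 2 ^+ 5) => B B0; rewrite ltr_pwDl// divr_ge0//; last first.
  by rewrite mulr_ge0 ?expR_ge0// ltW// gauss_peak_gt0.
by rewrite addr_ge0// mulr_ge0// ?addr_ge0 ?mulr_ge0// expR_ge0.
Qed.

Section self_normalized_coordinate.
Context {R : realType} {I : finType}.

Definition self_norm (v : coord_space R I) : R := (\sum_i v i) * inv_norm v.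

Lemma measurable_self_norm : measurable_fun setT self_norm.
Proof.
apply: measurable_funM; last exact: measurable_inv_norm.
by apply: measurable_sum => i; exact: measurable_coord.
Qed.

Context {d} {T : measurableType d} (P : probability T R) (X : I -> T -> R).
Hypothesis mX : forall i, measurable_fun setT (X i).
Hypothesis indX : independent P X.
Hypothesis symX : forall i A, measurable A ->
  P [set w | A (- X i w)] = P [set w | A (X i w)].

Let Xv (w : T) : coord_space R I := fun i => X i w.

Let mXv : measurable_fun setT Xv.
Proof. by apply: measurable_coord_space => i; exact: mX. Qed.

Lemma self_norm_sym A : measurable A ->
  P [set w | A (- self_norm (Xv w))] = P [set w | A (self_norm (Xv w))].
Proof.
move=> mA; have mB : measurable (self_norm @^-1` A).
  by rewrite -[X in measurable X]setTI; exact: measurable_self_norm.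
rewrite -[RHS](flip_signs_law mX indX symX xpredT mB).
have flipE w : self_norm (flip_signs xpredT (Xv w)) = - self_norm (Xv w).
  rewrite /self_norm inv_norm_flip -mulNr -sumrN; congr (_ * _).
  by apply: eq_bigr => i _; rewrite /flip_signs mulN1r.
by congr (P _); apply/seteqP; split => w /=; rewrite flipE.
Qed.

Lemma self_norm_interval (k dl M p : R) (a b : \bar R) :
  0 < k -> 0 <= dl -> 2 <= M -> dl * M ^+ 48 <= 1 ->
  1 <= p -> ln p <= M ^+ 16 / 8 ->
  \sum_i fine (P [set w | k < `|X i w|]) <= dl ->
  \sum_i \int[P]_w trunc_cube k (X i w) <= dl * k ^+ 3 ->
  k ^+ 2 <= \sum_i \int[P]_w trunc_sq k (X i w) ->
  (a <= b)%E ->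
  let g := fine (normal_prob 0 1 [set x : R | (a <= x%:E <= b)%E]) in
  `|fine (P [set w | (a <= (self_norm (Xv w))%:E <= b)%E]) - g| <=
  2 * (moderate_const / M) * (1 - g + p^-1).
Proof.
move=> k0 dl0 M2 dlM p1 lnp Hq Hc Hs ab.
have mS : measurable_fun setT (fun w => self_norm (Xv w)).
  exact: (measurableT_comp measurable_self_norm mXv).
have mpre (A : set R) : measurable A -> measurable [set w | A (self_norm (Xv w))].
  by move=> mA; rewrite -[X in measurable X]setTI; exact: mS.
apply: (interval_tail_compare mS) => //.
- by rewrite divr_ge0 ?(ltW moderate_const_gt0)//; lra.
- by rewrite invr_ge0; lra.
- exact: self_norm_sym.
- move=> x x0; rewrite -Rint_prob; last exact: (mpre _ (measurable_gt_ext x%:E)).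
  apply: (moderate_deviation (F := fun y => (x < y)%R%:R) mX indX symX _ _ k0 dl0 x0 M2 dlM p1 lnp Hq Hc Hs).
    exact: bmf_bool (measurable_gt_ext x%:E).
  by move=> y; rewrite lexx/= ler_nat; case: ltP => // /ltW->.
- move=> x x0; rewrite -Rint_prob; last exact: (mpre _ (measurable_ge_ext x%:E)).
  apply: (moderate_deviation (F := fun y => (x <= y)%R%:R) mX indX symX _ _ k0 dl0 x0 M2 dlM p1 lnp Hq Hc Hs).
    exact: bmf_bool (measurable_ge_ext x%:E).
  by move=> y; rewrite lexx andbT ler_nat; case: ltP => // /ltW->.
Qed.

End self_normalized_coordinate.

Lemma fine_prob01 {R : realType} {d} {T : measurableType d} (P : probability T R)
  (A : set T) : measurable A -> 0 <= fine (P A) <= 1.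
Proof.
by move=> mA; rewrite fine_ge0//= -lee_fin fineK ?probability_le1 ?fin_num_measure.
Qed.

(** * From coordinates to hyperrectangles *)

Section hyperrectangle_distance.
Context {R : realType} {d} {T : measurableType d} {P : probability T R}
  {Y : {RV P >-> R}} (Y_symmetric : symmetric_law Y) {n p : nat}
  {d1} {T1 : measurableType d1} {P1 : probability T1 R}
  (X : 'I_n -> 'I_p -> {RV P1 >-> R})
  {d2} {T2 : measurableType d2} {P2 : probability T2 R}
  (Z : 'I_p -> {RV P2 >-> R}).
Hypothesis p0 : (0 < p)%N.
Hypothesis X_iid :
  iid_with_law (fun ij : 'I_n * 'I_p => X ij.1 ij.2) (distribution P Y).
Hypothesis Z_gauss : standard_gaussian_vector Z.

Let XY i j : has_law (X i j) (distribution P Y).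
Proof. exact: (X_iid.2 (i, j)). Qed.

Let mX (j : 'I_p) (i : 'I_n) : measurable_fun setT (X i j).
Proof. exact: measurable_funPT. Qed.

Let indX (B : 'I_p -> 'I_n -> set R) : (forall j i, measurable (B j i)) ->
  P1 [set w | forall j i, B j i (X i j w)] =
  (\prod_j \prod_i P1 (X i j @^-1` B j i))%E.
Proof.
move=> mB; pose f (ji : 'I_p * 'I_n) := (ji.2, ji.1).
have fI : injective f by move=> [j i] [j' i'] [-> ->].
have := mutually_independent_sub fI X_iid.1 (fun ji => mB ji.1 ji.2).
rewrite (pair_big predT predT) /= => <-; congr (P1 _).
by apply/seteqP; split => w /= h; [move=> [j i]; exact: h|move=> j i; exact: (h (j, i))].
Qed.

Let Xv j (w : T1) : coord_space R 'I_n := fun i => X i j w.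

Let in_interval (a b : \bar R) (x : R) := (a <= x%:E <= b)%E.

Let measurable_interval a b : measurable [set x | in_interval a b x].
Proof.
rewrite [X in measurable X](_ : _ = [set x : R | (a <= x%:E)%E] `&` [set x : R | (x%:E <= b)%E]).
  exact: measurableI (measurable_ge_ext a) (measurable_le_ext b).
by apply/seteqP; split => w /=; [case/andP|rewrite /in_interval; move=> [-> ->]].
Qed.

Let measurable_X_interval j a b :
  measurable [set w | in_interval a b (self_norm (Xv j w))].
Proof.
have mXv : measurable_fun setT (Xv j) by apply: measurable_coord_space => i; exact: mX.
rewrite -[X in measurable X]setTI.
exact: (measurableT_comp measurable_self_norm mXv measurableT (measurable_interval a b)).
Qed.

Let prob_X (a b : 'I_p -> \bar R) :
  fine (P1 [set w | forall j, (a j <= (self_normalized_sum X w 0 j)%:E <= b j)%E]) =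
  \prod_j fine (P1 [set w | in_interval (a j) (b j) (self_norm (Xv j w))]).
Proof.
have mA j : measurable [set v : coord_space R 'I_n | in_interval (a j) (b j) (self_norm v)].
  rewrite -[X in measurable X]setTI.
  exact: (measurable_self_norm measurableT (measurable_interval (a j) (b j))).
have := independent_blocks mX indX mA.
rewrite [X in P1 X](_ : _ = [set w | forall j, (a j <= (self_normalized_sum X w 0 j)%:E <= b j)%E]); last first.
  by apply/seteqP; split => w /= h j; have := h j; rewrite mxE.
move=> ->; rewrite -[RHS]/(fine (\prod_j fine (P1 [set w | in_interval (a j) (b j) (self_norm (Xv j w))]))%:E).
rewrite -prodEFin; congr fine; apply: eq_bigr => j _; rewrite fineK//.
by apply: fin_num_measure; exact: measurable_X_interval.
Qed.

Let prob_Z (a b : 'I_p -> \bar R) :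
  fine (P2 [set w | forall j, (a j <= ((\row_(j < p) Z j w) 0 j)%:E <= b j)%E]) =
  \prod_j fine (normal_prob 0 1 [set x | in_interval (a j) (b j) x]).
Proof.
have := mutually_independent_sub (@inj_id _) Z_gauss.1 (fun j => measurable_interval (a j) (b j)).
rewrite [X in P2 X](_ : _ = [set w | forall j, (a j <= ((\row_(j < p) Z j w) 0 j)%:E <= b j)%E]); last first.
  by apply/seteqP; split => w /= h j; have := h j; rewrite mxE.
move=> ->; rewrite -[RHS]/(fine (\prod_j fine (normal_prob 0 1 [set x | in_interval (a j) (b j) x]))%:E).
rewrite -prodEFin; congr fine; apply: eq_bigr => j _; rewrite fineK; last first.
  by apply: fin_num_measure; exact: measurable_interval.
exact: (Z_gauss.2 j _ (measurable_interval (a j) (b j))).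
Qed.

(** [prod_tail_compare] with [eta = 2 * (moderate_const / M)]; the hypothesis
    [4 * moderate_const <= M] is its condition [eta <= 1 / 2]. *)
Lemma tau_re_le (M : R) : 0 < kappa0 Y n -> 0 < delta0 Y n ->
  kappa0 Y n ^+ 2 <= n%:R * \int[P]_w trunc_sq (kappa0 Y n) (Y w) ->
  2 <= M -> 4 * moderate_const <= M -> delta0 Y n * M ^+ 48 <= 1 ->
  ln p%:R <= M ^+ 16 / 8 ->
  0 <= tau_re X Z <= 6 * Num.sqrt (2 * (moderate_const / M)).
Proof.
move=> k0 dl0 ksq M2 CM dlM lnp; set B := 6 * _.
have symX j i A : measurable A -> P1 [set w | A (- X i j w)] = P1 [set w | A (X i j w)].
  exact: (has_law_sym (XY i j) Y_symmetric).
have n0 : 0 <= n%:R :> R by [].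
have k30 : 0 < kappa0 Y n ^+ 3 by rewrite exprn_gt0.
have dE := delta0E Y_symmetric n.
have q0 : 0 <= fine (P [set w | kappa0 Y n < `|Y w|]) by rewrite fine_ge0.
have c0 : 0 <= \int[P]_w trunc_cube (kappa0 Y n) (Y w).
  by apply: Rint_ge0 => w; exact: trunc_cube_ge0.
have nc0 : 0 <= n%:R / kappa0 Y n ^+ 3 * \int[P]_w trunc_cube (kappa0 Y n) (Y w).
  by rewrite mulr_ge0// divr_ge0// ltW.
have Hq j : \sum_i fine (P1 [set w | kappa0 Y n < `|X i j w|]) <= delta0 Y n.
  rewrite (eq_bigr (fun=> fine (P [set w | kappa0 Y n < `|Y w|]))); last first.
    by move=> i _; rewrite (has_law_prob (XY i j) (measurable_norm_gt _)).
  by rewrite sumr_const card_ord -mulr_natl dE lerDl.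
have Hc j : \sum_i \int[P1]_w trunc_cube (kappa0 Y n) (X i j w) <= delta0 Y n * kappa0 Y n ^+ 3.
  rewrite (eq_bigr (fun=> \int[P]_w trunc_cube (kappa0 Y n) (Y w))); last first.
    by move=> i _; rewrite (has_law_Rint (XY i j) (bmf_trunc_cube _)).
  rewrite sumr_const card_ord -mulr_natl -ler_pdivrMr// mulrAC dE lerDr.
  by rewrite mulr_ge0.
have Hs j : kappa0 Y n ^+ 2 <= \sum_i \int[P1]_w trunc_sq (kappa0 Y n) (X i j w).
  rewrite (eq_bigr (fun=> \int[P]_w trunc_sq (kappa0 Y n) (Y w))); last first.
    by move=> i _; rewrite (has_law_Rint (XY i j) (bmf_trunc_sq _)).
  by rewrite sumr_const card_ord -mulr_natl.
have p1 : 1 <= p%:R :> R by rewrite ler1n.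
have ubB : ubound [set `|fine (P1 [set w | A (self_normalized_sum X w)])
             - fine (P2 [set w | A (\row_(j < p) Z j w)])| | A in @hyperrectangles R p] B.
  move=> _ [_ [a [b [ab ->]]] <-].
  rewrite prob_X prob_Z.
  apply: prod_tail_compare => //.
  - have := @moderate_const_gt0 R => C0; rewrite mulr_gt0 ?divr_gt0//=; last lra.
    by rewrite mulrA ler_pdivrMr; lra.
  - by move=> j; apply: fine_prob01; exact: measurable_X_interval.
  - by move=> j; apply: fine_prob01; exact: measurable_interval.
  - by rewrite card_ord.
  move=> j; rewrite card_ord.
  exact: (self_norm_interval (mX j) (independent_block indX j) (symX j) k0 (ltW dl0)
    M2 dlM p1 lnp (Hq j) (Hc j) (Hs j) (ab j)).
have ne0 : [set `|fine (P1 [set w | A (self_normalized_sum X w)])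
             - fine (P2 [set w | A (\row_(j < p) Z j w)])| | A in @hyperrectangles R p] !=set0.
  by eexists; exists [set x | forall j, (0 <= (x 0 j)%:E <= 0)%E]; [exists (fun=> 0%E), (fun=> 0%E)|].
apply/andP; split; last exact: ge_sup.
have [y yS] := ne0; apply: (@le_trans _ _ y); first by case: yS => A _ <-.
by apply: ub_le_sup => //; exists B.
Qed.

End hyperrectangle_distance.

Lemma tau_re_cvg0 {R : realType} {d} {T : measurableType d} {P : probability T R}
    (Y : {RV P >-> R}) :
  in_normal_domain_of_attraction Y -> nondegenerate_law Y -> symmetric_law Y ->
  forall (p : nat -> nat)
    (dX : nat -> measure_display) (TX : forall n, measurableType (dX n))
    (PX : forall n, probability (TX n) R)
    (X : forall n, 'I_n -> 'I_(p n) -> {RV (PX n) >-> R})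
    (dZ : nat -> measure_display) (TZ : forall n, measurableType (dZ n))
    (PZ : forall n, probability (TZ n) R)
    (Z : forall n, 'I_(p n) -> {RV (PZ n) >-> R}),
    (forall n, (0 < p n)%N) ->
    (forall n, iid_with_law (fun ij : 'I_n * 'I_(p n) => X n ij.1 ij.2)
                            (distribution P Y)) ->
    (forall n, standard_gaussian_vector (Z n)) ->
    (\forall n \near \oo, ln (p n)%:R <= omega0 Y n ^+ 2 / 8) ->
    tau_re (X n) (Z n) @[n --> \oo] --> (0 : R).
Proof.
move=> attr nondeg sym p dX TX PX X dZ TZ PZ Z p0 iidX gaussZ lnp.
pose C : R := moderate_const; have C0 : 0 < C := moderate_const_gt0.
apply/cvgrPdist_le => e e0.
have s0 : 0 < (e / 6) ^+ 2 by rewrite exprn_gt0// divr_gt0.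
(* The first two terms meet the hypotheses of [tau_re_le]; the third makes
   [6 * Num.sqrt (2 * (C / M)) <= e] as soon as [K <= M]. *)
pose K : R := 2 + 4 * C + 2 * C / (e / 6) ^+ 2.
have Ke0 : 0 < 2 * C / (e / 6) ^+ 2 by rewrite divr_gt0// mulr_gt0.
have K0 : 0 < K by rewrite /K; lra.
have K48 : 0 < K ^- 48 by rewrite invr_gt0 exprn_gt0.
near=> n.
have [k0 /andP[dl0 dlK] ksq] : [/\ 0 < kappa0 Y n, 0 < delta0 Y n <= K ^- 48
    & kappa0 Y n ^+ 2 <= n%:R * \int[P]_w trunc_sq (kappa0 Y n) (Y w)].
  by near: n; exact: delta0_near.
have lnpn : ln (p n)%:R <= omega0 Y n ^+ 2 / 8 by near: n.
pose M := delta0 Y n `^ (- (1 / 48)).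
have M0 : 0 < M by exact: powR_gt0.
have M48 : M ^+ 48 = (delta0 Y n)^-1.
  rewrite -powR_mulrn ?(ltW M0)// -powRrM.
  by rewrite (_ : - (1 / 48) * 48 = -1 :> R) ?powR_inv1 ?(ltW dl0)//; field.
have MK : K <= M.
  rewrite leNgt; apply/negP => MK.
  have : M ^+ 48 < K ^+ 48 by rewrite ltrXn2r// ?nnegrE ltW.
  by rewrite M48 ltNge -(invrK (K ^+ 48)) lef_pV2 ?posrE// dlK.
have M16 : omega0 Y n ^+ 2 = M ^+ 16.
  rewrite /omega0 -(powR_mulrn 2 (powR_ge0 _ _)) -(powR_mulrn 16 (ltW M0)) /M -2!powRrM.
  by rewrite (_ : - (1 / 6) * 2 = - (1 / 48) * 16 :> R)//; field.
have /andP[t0 tM] : 0 <= tau_re (X n) (Z n) <= 6 * Num.sqrt (2 * (C / M)).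
  apply: (tau_re_le sym (p0 n) (iidX n) (gaussZ n)) => //.
  - by apply: le_trans MK; rewrite /K; lra.
  - by apply: le_trans MK; rewrite /K -/C; lra.
  - by rewrite M48 mulfV// gt_eqF.
  - by rewrite -M16.
rewrite sub0r normrN ger0_norm//; apply: (le_trans tM).
rewrite mulrC -ler_pdivlMr// -[leRHS](ger0_norm (ltW (divr_gt0 e0 _)))// -sqrtr_sqr.
rewrite ler_wsqrtr// mulrA ler_pdivrMr// -ler_pdivrMl//.
by apply: le_trans MK; rewrite /K; lra.
Unshelve. all: by end_near. Qed.

Theorem theorem2 (R : realType) (d : measure_display) (T : measurableType d)
    (P : probability T R) (Y : {RV P >-> R})
    (Y_attraction : in_normal_domain_of_attraction Y)
    (Y_nondegenerate : nondegenerate_law Y) (Y_symmetric : symmetric_law Y) :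
  (forall (p : nat -> nat)
     (dX : nat -> measure_display) (TX : forall n, measurableType (dX n))
     (PX : forall n, probability (TX n) R)
     (X : forall n, 'I_n -> 'I_(p n) -> {RV (PX n) >-> R})
     (dZ : nat -> measure_display) (TZ : forall n, measurableType (dZ n))
     (PZ : forall n, probability (TZ n) R)
     (Z : forall n, 'I_(p n) -> {RV (PZ n) >-> R}),
     (forall n, (0 < p n)%N) ->
     (forall n, iid_with_law (fun ij : 'I_n * 'I_(p n) => X n ij.1 ij.2)
                             (distribution P Y)) ->
     (forall n, standard_gaussian_vector (Z n)) ->
     (fun n => ln (p n)%:R : R^o) =o_\oo (fun n => omega0 Y n ^+ 2 : R^o) ->
     tau_re (X n) (Z n) @[n --> \oo] --> (0 : R))
  /\
  exists c : R, [/\ 0 < c, c <= 1 / 8 &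
    forall eps : R, 0 < eps -> eps < c ->
    forall (p : nat -> nat)
     (dX : nat -> measure_display) (TX : forall n, measurableType (dX n))
     (PX : forall n, probability (TX n) R)
     (X : forall n, 'I_n -> 'I_(p n) -> {RV (PX n) >-> R})
     (dZ : nat -> measure_display) (TZ : forall n, measurableType (dZ n))
     (PZ : forall n, probability (TZ n) R)
     (Z : forall n, 'I_(p n) -> {RV (PZ n) >-> R}),
     (forall n, (0 < p n)%N) ->
     (forall n, iid_with_law (fun ij : 'I_n * 'I_(p n) => X n ij.1 ij.2)
                             (distribution P Y)) ->
     (forall n, standard_gaussian_vector (Z n)) ->
     (\forall n \near \oo, ln (p n)%:R <= eps * omega0 Y n ^+ 2) ->
     (limn_esup (fun n => (tau_re (X n) (Z n))%:E) < (eps `^ (5 / 3))%:E)%E].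
Proof.
split=> [p dX TX PX X dZ TZ PZ Z p0 iidX gaussZ lnp|].
  apply: (tau_re_cvg0 Y_attraction Y_nondegenerate Y_symmetric p0 iidX gaussZ).
  have e8 : 0 < 1 / 8 :> R by rewrite divr_gt0.
  pose f : nat -> R^o := fun n => ln (p n)%:R.
  have fo : \forall n \near \oo, `|f n| <= 1 / 8 * `|omega0 Y n ^+ 2 : R^o|.
    by rewrite [f]lnp; exact: littleoP.
  apply: filterS fo => n H.
  apply: (le_trans (ler_norm _)); apply: (le_trans H).
  by rewrite ger0_norm ?sqr_ge0//; lra.
(* The largest admissible constant works: the limit is 0, below any positive power of [eps]. *)
exists (1 / 8); split => //.
move=> eps eps0 eps8 p dX TX PX X dZ TZ PZ Z p0 iidX gaussZ lnp.
have tau0 : tau_re (X n) (Z n) @[n --> \oo] --> (0 : R).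
  apply: (tau_re_cvg0 Y_attraction Y_nondegenerate Y_symmetric p0 iidX gaussZ); apply: filterS lnp => n /le_trans; apply.
  by rewrite mulrC ler_wpM2l ?sqr_ge0//; lra.
have tauE : (tau_re (X n) (Z n))%:E @[n --> \oo] --> (0 : R)%:E.
  by apply: cvg_EFin => //; near=> n.
rewrite (cvg_limn_einf_sup tauE) lte_fin powR_gt0//.
Unshelve. all: by end_near. Qed.
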